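(* Let $X(\cdot)$ be a spectrally positive L\'evy process with $X(0)=0$ and Laplace exponent $\phi(a)=\log\mathbb{E}\,e^{-aX(1)}$, $a\ge 0$. Let $\tau\ge 0$ and let $Q(\cdot)$ be the process $X(\cdot)$ reflected at its infimum, started at $Q(0)=\tau$, i.e. $$Q(t)=X(t)+\max\Big\{\tau,\sup_{0\le s\le t}-X(s)\Big\},\qquad t\ge 0,$$ and let $\alpha(t)=\int_0^t 1_{\{Q(s)\le\tau\}}\,{\rm d}s$ be the occupation time of $A=[0,\tau]$ up to time $t$. Then, for $q,\theta\ge 0$, $$\int_0^\infty e^{-qt}\,\mathbb{E}\,e^{-\theta\alpha(t)}\,{\rm d}t=\frac1q\,\frac{\psi(q)\,Z_{\psi(q)}^{(\theta)}(\tau)}{\theta\,W_{\psi(q)}^{(\theta)}(\tau)+\psi(q)\,Z_{\psi(q)}^{(\theta)}(\tau)},$$ where for $q=0$ the right-hand side is read as its limit as $q\downarrow 0$.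
   Context: A spectrally positive L\'evy process is a L\'evy process whose L\'evy measure is concentrated on the positive half-line (only upward jumps). The function $\psi$ is the inverse of $\phi$ if $\mathbb{E}X(1)<0$, and otherwise the right-inverse of $\phi$. For $q\ge0$ the scale function $W^{(q)}$ is the increasing continuous function on $[0,\infty)$ with Laplace transform $\int_0^\infty e^{-ax}W^{(q)}(x)\,{\rm d}x=\frac{1}{\phi(a)-q}$ for $a>\psi(q)$; $W^{(q)}(x)=0$ for $x<0$. For $q,\theta\ge0$ and $x\ge 0$ set $$W_{\psi(q)}^{(\theta)}(x)=e^{-\psi(q)x}W^{(q+\theta)}(x),\qquad Z_{\psi(q)}^{(\theta)}(x)=1+\theta\int_0^x W_{\psi(q)}^{(\theta)}(y)\,{\rm d}y.$$ *)

(* Defs.v *)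
From HB Require Import structures.
From mathcomp Require Import all_boot all_order all_algebra.
From mathcomp Require Import all_classical all_reals all_analysis.

Set Implicit Arguments.
Unset Strict Implicit.
Unset Printing Implicit Defensive.

Import Order.TTheory GRing.Theory Num.Theory.
Import numFieldNormedType.Exports.

Local Open Scope classical_set_scope.
Local Open Scope ring_scope.

Section levy_process.
Context (R : realType) (d : measure_display) (T : measurableType d).
Variable P : probability T R.

(* Product rule over all Borel sets; choosing [B i = setT] for some [i] gives
   the rule for subfamilies. *)
Definition mutually_independent (n : nat) (Y : 'I_n -> T -> R) : Prop :=
  forall B : 'I_n -> set R, (forall i, measurable (B i)) ->
    (P (\bigcap_(i in [set: 'I_n]) (Y i @^-1` B i)) =
     \prod_(i < n) P (Y i @^-1` B i))%E.

(* The time set is [0, +oo[: the values of [X] at negative times are never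
   used. *)
Variable X : R -> {RV P >-> R}.

Definition increment (s t : R) : T -> R := fun w => X t w - X s w.

Definition independent_increments : Prop :=
  forall (n : nat) (t : nat -> R), 0 <= t 0%N ->
    {homo t : i j / (i <= j)%N >-> i <= j} ->
    mutually_independent (fun i : 'I_n => increment (t i) (t i.+1)).

Definition stationary_increments : Prop :=
  forall s t : R, 0 <= s -> s <= t -> forall B : set R, measurable B ->
    P (increment s t @^-1` B) = P (increment 0 (t - s) @^-1` B).

Definition cadlag (x : R -> R) : Prop :=
  (forall t, 0 <= t -> x s @[s --> t^'+] --> x t) /\
  (forall t, 0 < t -> cvg (x s @[s --> t^'-])).

Definition levy_process : Prop :=
  [/\ {ae P, forall w, X 0 w = 0},
      independent_increments,
      stationary_increments
    & {ae P, forall w, cadlag (fun t => X t w)}].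

Definition jump (t : R) (w : T) : R := X t w - lim (X s w @[s --> t^'-]).

(* The Levy measure of [B] is the expected number of nonzero jumps with size
   in [B] per unit of time. *)
Definition levy_measure (B : set R) : \bar R :=
  (\int[P]_w
     counting [set t : R | [/\ 0 < t <= 1, jump t w != 0 & B (jump t w)]%R])%E.

Definition spectrally_positive_levy : Prop :=
  levy_process /\ levy_measure (~` `]0, +oo[) = 0%E.

Definition laplace_exponent (a : R) : R := ln (fine ('M_P (X 1) (- a))).

(* The (right-)inverse is a function from [0, +oo[ to [0, +oo[. It exists as
   soon as [X] is not a subordinator; the existence of [psi] thus encodes the
   usual convention that spectrally positive processes are not monotone
   increasing. *)
Definition exponent_inverse (psi : R -> R) : Prop :=
  (('E_P[X 1%R] < 0)%E ->
     (forall q, 0 <= q -> 0 <= psi q /\ laplace_exponent (psi q) = q) /\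
     (forall a, 0 <= a -> psi (laplace_exponent a) = a)) /\
  (~ ('E_P[X 1%R] < 0)%E ->
     forall q, 0 <= q ->
       [/\ 0 <= psi q, laplace_exponent (psi q) = q
         & forall a, 0 <= a -> laplace_exponent a = q -> a <= psi q]).

(* [Wq] is the [q]-scale function; a continuous function on [0, +oo[ is
   determined by its Laplace transform. *)
Definition scale_function (psi : R -> R) (q : R) (Wq : R -> R) : Prop :=
  [/\ forall x : R, x < 0 -> Wq x = 0,
      {in `[0, +oo[ &, {homo Wq : x y / x <= y}},
      {within `[0, +oo[, continuous Wq}
    & forall a, psi q < a ->
        (\int[lebesgue_measure]_(x in `[0%R, +oo[)
           (expR (- (a * x)) * Wq x)%:E)%E =
        ((laplace_exponent a - q)^-1)%:E].

Definition reflected (tau t : R) (w : T) : R :=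
  X t w + Num.max tau (sup [set - X s w | s in `[0, t]]).

Definition occupation_time (tau t : R) (w : T) : R :=
  (\int[lebesgue_measure]_(s in `[0, t])
     \1_[set u : R | reflected tau u w <= tau] s)%R.

Definition occupation_transform (tau q theta : R) : \bar R :=
  (\int[lebesgue_measure]_(t in `[0%R, +oo[)
     ((expR (- (q * t)))%:E *
      'E_P[fun w => expR (- (theta * occupation_time tau t w))]))%E.

End levy_process.

Section tilted_scale_functions.
Context (R : realType).
Variables (psi : R -> R) (W : R -> R -> R).

Definition tilted_W (q theta x : R) : R :=
  expR (- (psi q * x)) * W (q + theta) x.

Definition tilted_Z (q theta x : R) : R :=
  1 + theta * (\int[lebesgue_measure]_(y in `[0, x]) tilted_W q theta y)%R.

Definition occupation_formula (tau q theta : R) : R :=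
  q^-1 * (psi q * tilted_Z q theta tau /
          (theta * tilted_W q theta tau + psi q * tilted_Z q theta tau)).

End tilted_scale_functions.

(* Main.v *)
Require Import Defs.
From HB Require Import structures.
From mathcomp Require Import all_boot all_order all_algebra.
From mathcomp Require Import all_classical all_reals all_analysis.
From mathcomp Require Import measurable_realfun ring lra.

Set Implicit Arguments.
Unset Strict Implicit.
Unset Printing Implicit Defensive.

Import Order.TTheory GRing.Theory Num.Theory.
Import numFieldNormedType.Exports.

Local Open Scope classical_set_scope.
Local Open Scope ring_scope.

(** Write [K t = exp (- q t - theta alpha t)] and let [nu g] be the integral
    over [t >= 0] of [E (K t * g (Q t))], so that the transform sought is the
    mass [nu 1]. The process [Q] is a Levy process reflected at 0 and killed at
    rate [q + theta 1_{Q <= tau}]; for such a process the Kella-Whitt identity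
    says that, for all [a >= 0] and a number [l] independent of [a],
<<
  (phi a - q) nu(exp (- a .)) - theta nu(exp (- a .); [0, tau])
    = a l - exp (- a tau).                                          (KW)
>>
    Here [l] is the expected discounted growth of the regulator that keeps [Q]
    nonnegative.

    From (KW) the mass is found by Laplace inversion. Let [F x = nu [0, x]] and
    let [W] be the [(q + theta)]-scale function. Dividing (KW) by
    [phi a - (q + theta)] shows that the Laplace transform of [l W - F] at [a]
    is at most [o(1) exp (- a tau) / a]. A transform that small can only come
    from a function vanishing on [0, tau] ([laplace_small_eq0]), so [F = l W]
    there ([weighted_cdf_scale]). At [a = psi q] the first term of (KW)
    disappears, which gives [l]; at [a = 0], (KW) reads
    [q nu 1 + theta nu [0, tau] = 1], which gives [nu 1]
    ([occupation_mass_formula]).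

    (KW) is proved by discretization. Along the grid of mesh [h = 1 / (n + 1)]
    the process is a random walk reflected at 0 (Lindley recursion), and one
    step gives an exact identity ([push_expE], [integrable_push_exp]) in which
    the regulator enters through [E (K (exp (a y) - 1))], where [y] is the
    part of the step that falls below 0. As [h] tends to 0 the other terms
    converge by dominated convergence ([cvg_int_push]). That the limit is linear
    in [a] is where the absence of negative jumps matters: [y] is then small
    outside an event of probability [o(h)] ([cvg_small_drops]), and
    [(exp (a y) - 1) / a] is independent of [a] to first order
    ([int_push_compare], [boundary_term_linear]). The discretization needs a
    continuous killing rate, so the indicator of [0, tau] is approximated by
    continuous functions at the end ([boundary_term_below_linear]).

    Exponential moments of [X 1] come for free from the existence of scale
    functions ([laplace_exponentE]). The case [q = 0] follows from [q > 0] by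
    monotone convergence ([laplace_at_right0]). *)

(** * Real-valued integrals *)

Section real_integrals.
Context d (T : measurableType d) (R : realType) (mu : {measure set T -> \bar R}).
Variables (D : set T) (mD : measurable D).
Implicit Types f g : T -> R.

Lemma integrable_le f g : measurable_fun D f -> mu.-integrable D (EFin \o g) ->
  (forall x, D x -> `|f x| <= g x) -> mu.-integrable D (EFin \o f).
Proof.
move=> mf ig fg; apply: le_integrable ig => //; first exact/measurable_EFinP.
by move=> x Dx /=; rewrite lee_fin (le_trans (fg x Dx))// ler_norm.
Qed.

Lemma Rintegral_dominated_cvg_ae (f_ : nat -> T -> R) f g :
  (forall n, measurable_fun D (f_ n)) -> measurable_fun D f ->
  {ae mu, forall x, D x -> f_ ^~ x @ \oo --> f x} ->
  mu.-integrable D (EFin \o g) ->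
  (forall n x, D x -> `|f_ n x| <= g x) ->
  mu.-integrable D (EFin \o f) /\
  (\int[mu]_(x in D) f_ n x)%R @[n --> \oo] --> (\int[mu]_(x in D) f x)%R.
Proof.
move=> mf_ mf cf ig fg.
have [] := @dominated_convergence _ T R mu D mD (fun n => EFin \o f_ n)
   (EFin \o f) (EFin \o g).
- by move=> n; exact/measurable_EFinP.
- exact/measurable_EFinP.
- apply: filterS cf => x cf Dx; apply: cvg_EFin; first exact: nearW.
  exact: cf.
- exact: ig.
- by apply: aeW => x n Dx; rewrite /= lee_fin fg.
move=> intf _ cv; split=> //.
apply: fine_cvg; rewrite fineK; last exact: integrable_fin_num.
exact: cv.
Qed.

Lemma Rintegral_dominated_cvg (f_ : nat -> T -> R) f g :
  (forall n, measurable_fun D (f_ n)) ->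
  (forall x, D x -> f_ ^~ x @ \oo --> f x) ->
  mu.-integrable D (EFin \o g) ->
  (forall n x, D x -> `|f_ n x| <= g x) ->
  mu.-integrable D (EFin \o f) /\
  (\int[mu]_(x in D) f_ n x)%R @[n --> \oo] --> (\int[mu]_(x in D) f x)%R.
Proof.
move=> mf_ cf ig fg; apply: (Rintegral_dominated_cvg_ae mf_ _ _ ig fg).
  exact: measurable_fun_cvg mf_ cf.
exact: aeW.
Qed.

Lemma integrable_scale (c : R) f : mu.-integrable D (EFin \o f) ->
  mu.-integrable D (EFin \o (fun x => c * f x)).
Proof. by move=> h; exact: (integrableZl mD c h). Qed.

Lemma integrable_normr f : mu.-integrable D (EFin \o f) ->
  mu.-integrable D (EFin \o (fun x => `|f x|)).
Proof. by move=> h; exact: (integrable_norm h). Qed.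

Lemma Rintegral_sum (I : Type) (s : seq I) (h : I -> T -> R) :
  (forall i, mu.-integrable D (EFin \o h i)) ->
  (\int[mu]_(x in D) (\sum_(i <- s) h i x))%R =
  \sum_(i <- s) (\int[mu]_(x in D) h i x)%R.
Proof.
move=> ih; rewrite /Rintegral.
under eq_integral do rewrite -sumEFin.
rewrite integral_sum//.
under eq_bigr => i _ do rewrite -(fineK (integrable_fin_num mD (ih i))).
by rewrite sumEFin.
Qed.

Lemma Rintegral_norm_le f g : mu.-integrable D (EFin \o f) ->
  mu.-integrable D (EFin \o g) -> (forall x, D x -> `|f x| <= g x) ->
  `|\int[mu]_(x in D) f x|%R <= (\int[mu]_(x in D) g x)%R.
Proof.
move=> intf intg fg; rewrite (le_trans (le_normr_Rintegral mD intf))//.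
apply: le_Rintegral => //.
exact: (integrable_norm intf).
Qed.

Lemma EFin_Rintegral f : mu.-integrable D (EFin \o f) ->
  (\int[mu]_(x in D) f x)%R%:E = (\int[mu]_(x in D) (f x)%:E)%E.
Proof. by move=> intf; rewrite fineK//; exact: integrable_fin_num. Qed.

End real_integrals.

(** * Functions with a rapidly decaying Laplace transform *)

Section gumbel.
Context (R : realType).
Implicit Types z : R.

(** Partial sums of the exponential series of [1 - exp (- z)]. *)
Definition gumbel_sum (m : nat) z : R :=
  \sum_(k < m) (-1) ^+ k / (k.+1)`!%:R * z ^+ k.+1.

Lemma gumbel_sumE m z : gumbel_sum m z = 1 - series (exp_coeff (- z)) m.+1.
Proof.
rewrite /series/= big_mkord big_ord_recl /= /exp_coeff/= expr0 divr1 opprD addrA.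
rewrite subrr add0r -sumrN; apply: eq_bigr => k _.
by rewrite /bump/= add1n [in RHS]exprNn !exprS mulN1r !mulNr opprK; ring.
Qed.

Lemma cvg_gumbel_sum z : gumbel_sum ^~ z @ \oo --> 1 - expR (- z).
Proof.
under eq_fun do rewrite gumbel_sumE.
apply: cvgB; first exact: cvg_cst.
have := @is_cvg_series_exp_coeff R (- z).
by rewrite -(cvg_shiftS (series (exp_coeff (- z)))); exact.
Qed.

Lemma sum_exp_le m z : 0 <= z -> \sum_(k < m) (k.+1)`!%:R^-1 * z ^+ k.+1 <= expR z - 1.
Proof.
move=> z0; rewrite lerBrDl.
have -> : 1 + \sum_(k < m) (k.+1)`!%:R^-1 * z ^+ k.+1 = series (exp_coeff z) m.+1.
  rewrite /series/= big_mkord big_ord_recl /= /exp_coeff/= expr0 divr1.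
  by congr (_ + _); apply: eq_bigr => k _; rewrite mulrC.
apply: nondecreasing_cvgn_le; last exact: is_cvg_series_exp_coeff.
by apply/nondecreasing_seqP => n; rewrite /series/= big_nat_recr//= lerDl exp_coeff_ge0.
Qed.

Lemma gumbel_sum_le m z : 0 <= z -> `|gumbel_sum m z| <= expR z - 1.
Proof.
move=> z0; apply: le_trans (sum_exp_le m z0).
rewrite (le_trans (ler_norm_sum _ _ _))// ler_sum// => k _.
rewrite !normrM normr_sign mul1r normfV !normrX.
by rewrite (ger0_norm z0) ger0_norm.
Qed.

End gumbel.

Section laplace_transform.
Context (R : realType).
Local Notation mu := (@lebesgue_measure R).
Implicit Types (H : R -> R) (a t : R).

Definition laplace H a : R :=
  (\int[mu]_(x in `[0%R, +oo[) (expR (- (a * x)) * H x))%R.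

Definition laplace_integrable H a : Prop :=
  mu.-integrable `[(0:R), +oo[ (fun x => (expR (- (a * x)) * H x)%:E).

Lemma measurable_expRNM a (D : set R) :
  measurable_fun D (fun x => expR (- (a * x))).
Proof.
apply: measurable_funTS; apply: measurableT_comp => //.
by apply: measurableT_comp => //; exact: mulrl_measurable.
Qed.

Lemma ler_expRNM (a b x : R) : a <= b -> 0 <= x -> expR (- (b * x)) <= expR (- (a * x)).
Proof. by move=> ab x0; rewrite ler_expR lerN2 ler_wpM2r. Qed.

Lemma laplace_integrableW H a b : measurable_fun `[(0:R), +oo[ H ->
  a <= b -> laplace_integrable H a -> laplace_integrable H b.
Proof.
move=> mH ab ia; apply: (le_integrable _ _ _ ia) => //=.
- apply/measurable_EFinP; apply: measurable_funM => //.
  exact: measurable_expRNM.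
- move=> x /=; rewrite in_itv/= andbT => x0.
  rewrite lee_fin !normrM ler_wpM2r// !ger0_norm ?expR_ge0//.
  exact: ler_expRNM.
Qed.

Lemma cvg_expRN_nat (c : R) : 0 < c -> expR (- (n%:R * c)) @[n --> \oo] --> (0 : R).
Proof.
move=> c0; apply: (@cvg_comp _ _ _ (fun n : nat => n%:R * c) (fun x => expR (- x)) \oo (+oo)%R).
  apply: (@cvg_comp _ _ _ (fun n : nat => n%:R : R) (fun x => x * c) \oo (+oo)%R).
    exact: cvgr_idn.
  by apply: (@gt0_cvgMly _ _ _ c id) => //; exact: cvg_id.
exact: cvgr_expR.
Qed.

Lemma expR_gumbel_cvg1 (c : R) : 0 < c ->
  expR (- expR (n%:R * c)) @[n --> \oo] --> (0 : R).
Proof.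
move=> c0; apply: (@squeeze_cvgr _ _ _ _ (cst 0) (fun n => expR (- (n%:R * c)))).
- apply: nearW => n /=; rewrite expR_ge0/= ler_expR lerN2.
  by apply: le_trans (expR_ge1Dx _); rewrite lerDr.
- exact: cvg_cst.
- exact: cvg_expRN_nat.
Qed.

Lemma expRB1_le (z : R) : 0 <= z -> expR z - 1 <= z * expR z.
Proof.
move=> z0; have := expR_ge1Dx (- z); rewrite expRN => h.
have : expR z * (1 - z) <= 1.
  by rewrite mulrC -ler_pdivlMr ?expR_gt0// div1r.
lra.
Qed.

Lemma expRN_le1Bx (z : R) : 0 <= z -> `|1 - expR (- z)| <= z /\ `|1 - expR (- z)| <= 1.
Proof.
move=> z0; have h := expR_ge1Dx (- z).
have h1 : expR (- z) <= 1 by rewrite -expR0 ler_expR oppr_le0.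
have h2 := expR_ge0 (- z).
rewrite ger0_norm; [split; lra|lra].
Qed.

(** The kernel [1 - exp (- exp (n (t - x)))] is a power series in
    [exp (- n x)]; integrated against [H], its [k]-th term is the value of the
    Laplace transform at [k n], and the assumed decay makes the sum at most
    [C (exp (exp (- n (tau - t))) - 1)]. *)
Lemma gumbel_laplace_bound H (a0 C tau t : R) (n : nat) :
  measurable_fun `[(0:R), +oo[ H -> laplace_integrable H a0 ->
  (forall k : nat, a0 <= k%:R -> `|laplace H k%:R| <= C * expR (- (k%:R * tau))) ->
  a0 <= n%:R -> 0 <= t ->
  `|(\int[mu]_(x in `[0%R, +oo[) (H x * (1 - expR (- expR (n%:R * (t - x))))))%R|
    <= C * (expR (expR (- (n%:R * (tau - t)))) - 1).
Proof.
move=> mH iH HC an t0.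
have iHn m : laplace_integrable H (m.+1 * n)%:R.
  apply: laplace_integrableW iH => //; apply: (le_trans an).
  by rewrite ler_nat leq_pmull.
pose Z := expR (n%:R * t).
pose g x := expR Z * Z * `|expR (- (a0 * x)) * H x|.
have mD : measurable (`[0%R, +oo[%classic : set R) by exact: measurable_itv.
have ig : mu.-integrable `[(0:R), +oo[ (EFin \o g).
  by apply: integrable_scale => //; exact: integrable_normr.
have zE x : expR (n%:R * (t - x)) = Z * expR (- (n%:R * x)).
  by rewrite mulrBr expRD.
have mz (m : nat) : measurable_fun `[(0:R), +oo[ (fun x => H x * gumbel_sum m (expR (n%:R * (t - x)))).
  apply: measurable_funM => //.
  rewrite /gumbel_sum; apply: measurable_sum => k.
  apply: measurable_funM => //; apply: measurable_funX.
  rewrite (funext zE); apply: measurable_funM => //.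
  exact: measurable_expRNM.
have bnd m x : (0 <= x) -> `|H x * gumbel_sum m (expR (n%:R * (t - x)))| <= g x.
  move=> x0; rewrite normrM mulrC /g normrM.
  have z0 : 0 <= expR (n%:R * (t - x)) by exact: expR_ge0.
  have zZ : expR (n%:R * (t - x)) <= Z.
    by rewrite ler_expR ler_wpM2l// lerBlDr lerDl.
  have ZZ : expR (n%:R * (t - x)) <= Z * expR (- (a0 * x)).
    by rewrite zE ler_wpM2l ?expR_ge0//; exact: ler_expRNM.
  rewrite mulrA ler_wpM2r// (le_trans (gumbel_sum_le m z0))//.
  rewrite (le_trans (expRB1_le z0))// (ger0_norm (expR_ge0 _)).
  rewrite mulrC -mulrA ler_pM ?expR_ge0// ler_expR//.
have [||_ cv] := @Rintegral_dominated_cvg _ _ _ mu `[0%R, +oo[ mD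
  (fun m x => H x * gumbel_sum m (expR (n%:R * (t - x))))
  (fun x => H x * (1 - expR (- expR (n%:R * (t - x))))) g mz _ ig _.
- by move=> x _; apply: cvgMr; exact: cvg_gumbel_sum.
- by move=> m x /=; rewrite in_itv/= andbT; exact: bnd.
have w0 : 0 <= expR (- (n%:R * (tau - t))) by exact: expR_ge0.
have C0 : 0 <= C.
  have := HC n an; have := expR_gt0 (- (n%:R * tau)) => e0 h.
  by rewrite -(pmulr_lge0 _ e0) (le_trans _ h).
have le_m m : `|(\int[mu]_(x in `[0%R, +oo[) (H x * gumbel_sum m (expR (n%:R * (t - x)))))%R|
    <= C * (expR (expR (- (n%:R * (tau - t)))) - 1).
  pose h (k : 'I_m) x := (-1) ^+ k / (k.+1)`!%:R * Z ^+ k.+1 * (expR (- ((k.+1 * n)%:R * x)) * H x).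
  have -> : (\int[mu]_(x in `[0%R, +oo[) (H x * gumbel_sum m (expR (n%:R * (t - x)))))%R =
    (\int[mu]_(x in `[0%R, +oo[) (\sum_(k <- index_enum 'I_m) h k x))%R.
    apply: eq_Rintegral => x _; rewrite /gumbel_sum mulr_sumr; apply: eq_bigr => k _.
    rewrite /h zE exprMn.
    have -> : expR (- ((k.+1 * n)%:R * x)) = expR (- (n%:R * x)) ^+ k.+1.
      by rewrite -expRM_natl natrM mulrN mulrA.
    by ring.
  rewrite Rintegral_sum//; last first.
    by move=> k; apply: integrable_scale => //; exact: iHn.
  apply: (@le_trans _ _ (\sum_(k < m) C * ((k.+1)`!%:R^-1 * expR (- (n%:R * (tau - t))) ^+ k.+1))).
    rewrite (le_trans (ler_norm_sum _ _ _))// ler_sum// => k _.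
    rewrite RintegralZl//; last exact: iHn.
    rewrite -/(laplace H _) !normrM normr_sign mul1r normfV normr_nat.
    have an1 : a0 <= (k.+1 * n)%:R.
      by rewrite (le_trans an)// ler_nat leq_pmull.
    rewrite -mulrA [leRHS]mulrCA ler_wpM2l ?invr_ge0//.
    rewrite normrX (ger0_norm (expR_ge0 _)).
    have -> : expR (- (n%:R * (tau - t))) ^+ k.+1 =
        Z ^+ k.+1 * expR (- ((k.+1 * n)%:R * tau)).
      by rewrite -!expRM_natl -expRD natrM; congr expR; ring.
    by rewrite mulrCA ler_wpM2l ?exprn_ge0 ?expR_ge0// HC.
  by rewrite -mulr_sumr ler_wpM2l// sum_exp_le.
apply: (cvgr_to_le (cvg_norm cv)); exact: nearW.
Qed.

(** As [n] grows, the kernels of [gumbel_laplace_bound] approach the indicator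
    of [x < t], while the bound tends to 0 as soon as [t < tau]. *)
Lemma Rintegral_laplace_small0 H (a0 C tau t : R) :
  measurable_fun `[(0:R), +oo[ H -> 0 <= a0 -> laplace_integrable H a0 ->
  (forall k : nat, a0 <= k%:R -> `|laplace H k%:R| <= C * expR (- (k%:R * tau))) ->
  0 <= t -> t < tau ->
  (\int[mu]_(x in `[0%R, t]) H x)%R = 0.
Proof.
move=> mH a00 iH HC t0 ttau.
have mD : measurable (`[0%R, +oo[%classic : set R) by exact: measurable_itv.
pose N := Num.truncn a0.
have aN n : a0 <= (n + N.+1)%:R.
  by rewrite (le_trans (ltW (truncnS_gt _)))// ler_nat leq_addl.
have Nn (n : nat) : (n%:R : R) <= (n + N.+1)%:R by rewrite ler_nat leq_addr.
pose k n x := H x * (1 - expR (- expR ((n + N.+1)%:R * (t - x)))).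
have mt : measurable (`[0%R, t]%classic : set R) by exact: measurable_itv.
have st : `[0%R, +oo[ `&` `[0%R, t] = `[0%R, t]%classic :> set R.
  apply/seteqP; split=> [x []//|x /=]; rewrite !in_itv/= andbT => /andP[-> ->].
  by [].
have ttx n x : 0 <= x -> `|1 - expR (- expR ((n + N.+1)%:R * (t - x)))| <= expR (a0 * (t - x)).
  move=> x0; have [b1 b2] := @expRN_le1Bx (expR ((n + N.+1)%:R * (t - x))) (expR_ge0 _).
  have [xt|tx] := leP x t.
    by rewrite (le_trans b2)// -expR0 ler_expR mulr_ge0// subr_ge0.
  rewrite (le_trans b1)// ler_expR ler_wnM2r// subr_le0 ltW//.
have [|||||_ cv] := @Rintegral_dominated_cvg_ae _ _ _ mu `[0%R, +oo[ mD k
  (H \_ `[0%R, t]) (fun x => expR (a0 * t) * `|expR (- (a0 * x)) * H x|).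
- move=> n; apply: measurable_funM => //; apply: measurable_funB => //.
  apply: measurable_funTS; apply: measurableT_comp => //; apply: measurableT_comp => //.
  apply: measurableT_comp => //; apply: measurable_funM => //.
  exact: measurable_funB.
- apply/measurable_restrict => //; rewrite st; apply: measurable_funS mH => //.
  by rewrite -st; exact: subIsetl.
(* At [x = t] the kernel has the constant value [1 - exp (- 1)]. *)
- exists [set t]; split => //; first exact: lebesgue_measure_set1.
  move=> x /=; apply: contra_notP => /eqP xt; rewrite in_itv/= andbT => x0.
  rewrite /k patchE mem_setE in_itv/= x0/=.
  have [xt'|tx|] := ltgtP x t; last by move=> /eqP; rewrite (negbTE xt).
    rewrite -[X in _ --> X]mulr1.
    apply: cvgMr; rewrite -[X in _ --> X](subr0 1); apply: cvgB; first exact: cvg_cst.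
    apply: (@squeeze_cvgr _ _ _ _ (cst 0) (fun n => expR (- expR (n%:R * (t - x))))).
    + apply: nearW => n /=; rewrite expR_ge0/= ler_expR lerN2 ler_expR.
      by rewrite ler_wpM2r// subr_ge0 ltW.
    + exact: cvg_cst.
    + by apply: expR_gumbel_cvg1; rewrite subr_gt0.
  rewrite -[X in _ --> X](mulr0 (H x)); apply: cvgMr.
  apply/norm_cvg0P.
  apply: (@squeeze_cvgr _ _ _ _ (cst 0) (fun n => expR (- (n%:R * (x - t))))).
  + apply: nearW => n /=; rewrite normr_ge0/=.
    have [b1 _] := @expRN_le1Bx (expR ((n + N.+1)%:R * (t - x))) (expR_ge0 _).
    rewrite (le_trans b1)// ler_expR -mulrN opprB ler_wnM2r//.
    by rewrite subr_le0 ltW.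
  + exact: cvg_cst.
  + by apply: cvg_expRN_nat; rewrite subr_gt0.
- by apply: integrable_scale => //; exact: integrable_normr.
- move=> n x /=; rewrite in_itv/= andbT => x0; rewrite /k !normrM mulrA.
  rewrite (ger0_norm (expR_ge0 _)) -expRD mulrC ler_wpM2r//.
  by rewrite -mulrBr; exact: ttx.
move: cv; rewrite -Rintegral_mkcondr st => cv.
rewrite -(cvg_lim _ cv)//; apply/cvg_lim => //.
apply/norm_cvg0P.
apply: (@squeeze_cvgr _ _ _ _ (cst 0)
  (fun n => C * (expR (expR (- (n%:R * (tau - t)))) - 1))).
- apply: nearW => n /=; rewrite normr_ge0/=.
  have C0 : 0 <= C.
    have := HC _ (aN n); have := expR_gt0 (- ((n + N.+1)%:R * tau)) => e0 h.
    by rewrite -(pmulr_lge0 _ e0) (le_trans _ h).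
  rewrite (le_trans (gumbel_laplace_bound mH iH HC (aN n) t0))//.
  rewrite ler_wpM2l// lerD2r ler_expR ler_expR lerN2 ler_wpM2r//.
  by rewrite subr_ge0 ltW.
- exact: cvg_cst.
- rewrite -[X in _ --> X](mulr0 C); apply: cvgMr.
  rewrite -[X in _ --> X](subrr 1); apply: cvgB; last exact: cvg_cst.
  rewrite -{2}expR0; apply: cvg_comp; last exact: continuous_expR.
  by apply: cvg_expRN_nat; rewrite subr_gt0.
Qed.
End laplace_transform.

Section exponential_tails.
Context (R : realType).
Local Notation mu := (@lebesgue_measure R).
Implicit Types (H : R -> R) (a t : R).

Lemma integral_expR_tail a y : 0 < a ->
  (\int[mu]_(x in `[y, +oo[) (a * expR (- (a * x)))%:E)%E = (expR (- (a * y)))%:E.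
Proof.
move=> a0.
have c1 : continuous (fun x : R => - (a * x)).
  by move=> x; apply: continuousN; apply: mulrl_continuous.
have ce : continuous (fun x : R => expR (- (a * x))).
  by move=> x; apply: (continuous_comp (c1 x)); exact: continuous_expR.
have dv (x : R) :
    is_derive x (1 : R) (fun x : R => - expR (- (a * x))) (a * expR (- (a * x))).
  have h1 : is_derive x (1 : R) (fun x : R => - (a * x)) (- a).
    by apply: is_derive_eq; rewrite /GRing.scale/= mulr1.
  by apply: is_derive_eq; rewrite mulrN opprK mulrC.
rewrite (@ge0_continuous_FTC2y R _ (fun x => - expR (- (a * x))) y 0).
- by rewrite sub0e EFinN oppeK.
- by move=> x _; rewrite mulr_ge0 ?expR_ge0// ltW.
- apply: continuous_subspaceT => x.
  by apply: (continuous_comp (ce x)); exact: mulrl_continuous.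
- rewrite -oppr0; apply: cvgN.
  apply: (@cvg_comp _ _ _ (fun x => a * x) (fun x => expR (- x)) _ (+oo)%R); last exact: cvgr_expR.
  by apply: (@gt0_cvgMry _ _ _ a id) => //; exact: cvg_id.
- by move=> x _; exact: ex_derive.
- by apply: cvgN; apply/cvg_at_right_filter; exact: ce.
- by move=> x _; rewrite derive1E; exact: derive_val.
Qed.

Lemma integrable_expR_tail a y : 0 < a ->
  mu.-integrable `[y, +oo[ (fun x => (expR (- (a * x)))%:E).
Proof.
move=> a0.
have i1 : mu.-integrable `[y, +oo[ (EFin \o (fun x => a * expR (- (a * x)))).
  apply/integrableP; split.
    apply/measurable_EFinP; apply: measurable_funM => //; exact: measurable_expRNM.
  under eq_integral => x _ do rewrite /= ger0_norm ?mulr_ge0 ?expR_ge0 ?ltW//.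
  by rewrite integral_expR_tail// ltry.
have : mu.-integrable `[y, +oo[ (EFin \o (fun x => a^-1 * (a * expR (- (a * x))))).
  exact: integrable_scale.
apply: eq_integrable => // x _ /=.
by rewrite mulrA mulVf ?gt_eqF// mul1r.
Qed.

Lemma Rintegral_expR_tail a y : 0 < a ->
  (\int[mu]_(x in `[y, +oo[) expR (- (a * x)))%R = a^-1 * expR (- (a * y)).
Proof.
move=> a0; apply: (mulfI (lt0r_neq0 a0)); rewrite mulrA mulfV ?gt_eqF// mul1r.
rewrite -RintegralZl//; last exact: integrable_expR_tail.
by rewrite /Rintegral integral_expR_tail.
Qed.

Lemma laplace_integrable_loc H a t : measurable_fun `[(0:R), +oo[ H -> 0 <= a ->
  laplace_integrable H a -> mu.-integrable `[(0:R), t] (EFin \o H).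
Proof.
move=> mH a0 iH.
have sD : `[0%R, t] `<=` (`[0%R, +oo[%classic : set R).
  by move=> x /=; rewrite !in_itv/= andbT => /andP[].
have iH' : mu.-integrable `[(0:R), t] (EFin \o (fun x => expR (- (a * x)) * H x)).
  by apply: integrableS iH.
have iN : mu.-integrable `[(0:R), t]
    (EFin \o (fun x => expR (a * t) * `|expR (- (a * x)) * H x|)).
  by apply: integrable_scale => //; exact: integrable_normr.
apply: (integrable_le _ _ iN) => //.
  exact: measurable_funS mH.
move=> x /=; rewrite in_itv/= => /andP[x0 xt].
rewrite normrM mulrA ler_peMl// (ger0_norm (expR_ge0 _)) -expRD -expR0 ler_expR.
by rewrite -mulrBr mulr_ge0// subr_ge0.
Qed.

Lemma right_continuous_int0 H (s t : R) : s < t ->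
  mu.-integrable `]s, t] (EFin \o H) -> H x @[x --> s^'+] --> H s ->
  (forall u, s < u -> u <= t -> (\int[mu]_(x in `]s, u]) H x)%R = 0) -> H s = 0.
Proof.
move=> st iH cH H0.
apply/eqP; rewrite -normr_le0; apply/ler_addgt0Pr => e e0; rewrite add0r.
have [u [su ut Hu]] : exists u, [/\ s < u, u <= t & forall x, s < x <= u -> `|H s - H x| <= e].
  move/cvgrPdist_le : cH => /(_ e e0); rewrite /at_right near_withinE.
  case=> r /= r0 Hr; exists (Num.min t (s + r / 2)); split.
  - by rewrite lt_min st ltrDl divr_gt0.
  - by rewrite ge_min lexx.
  - move=> x /andP[sx]; rewrite le_min => /andP[xt xr].
    apply: Hr => //=; rewrite ltr_distlC; apply/andP; split; lra.
have iHu : mu.-integrable `]s, u] (EFin \o H).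
  by apply: integrableS iH => // x /=; rewrite !in_itv/= => /andP[-> /=] /le_trans; apply.
have muE : fine (mu `]s, u]%classic) = u - s.
  by rewrite lebesgue_measure_itv/= lte_fin su -EFinB.
have ic (c : R) : mu.-integrable `]s, u] (EFin \o cst c).
  have : mu.-integrable `[s, u] (EFin \o cst c).
    apply: continuous_compact_integrable; first exact: segment_compact.
    by apply: continuous_subspaceT => x; exact: cst_continuous.
  by apply: integrableS => //; exact: subset_itv_oc_cc.
have : `|(\int[mu]_(x in `]s, u]) (H s - H x))%R| <= (\int[mu]_(x in `]s, u]) e)%R.
  apply: Rintegral_norm_le => //.
    exact: (integrableB _ (ic (H s)) iHu).
  exact: ic.
rewrite (RintegralB _ (ic (H s)) iHu)// H0// subr0 !Rintegral_cst// muE normrM.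
by rewrite (gtr0_norm (_ : 0 < u - s)) ?subr_gt0// ler_pM2r ?subr_gt0.
Qed.

(** Initial value theorem: [k exp (- k (x - tau)) dx] concentrates at [tau], so
    [k exp (k tau)] times the transform at [k] tends to [H tau]. *)
Lemma laplace_initial_value0 H (a0 tau : R) (w : nat -> R) :
  measurable_fun `[(0:R), +oo[ H -> 0 <= a0 -> laplace_integrable H a0 -> 0 <= tau ->
  (forall x, 0 <= x -> x < tau -> H x = 0) ->
  H x @[x --> tau^'+] --> H tau ->
  (forall k : nat, a0 <= k%:R ->
     `|k%:R * laplace H k%:R| <= w k * expR (- (k%:R * tau))) ->
  w k @[k --> \oo] --> (0 : R) ->
  H tau = 0.
Proof.
move=> mH a00 iH tau0 H0 cH Hw w0.
pose a1 := Num.max a0 1.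
have a11 : 1 <= a1 by rewrite le_max lexx orbT.
have a10 : 0 < a1 by rewrite (lt_le_trans _ a11).
have iH1 : laplace_integrable H a1.
  by apply: (laplace_integrableW mH _ iH); rewrite le_max lexx.
have sD : `[tau, +oo[ `<=` (`[0%R, +oo[%classic : set R).
  by move=> x /=; rewrite !in_itv/= !andbT; apply: le_trans.
have iHt k : a1 <= k -> mu.-integrable `[tau, +oo[ (EFin \o (fun x => expR (- (k * x)) * H x)).
  move=> ak; have : laplace_integrable H k by exact: laplace_integrableW iH1.
  exact: integrableS.
have iD k : a1 <= k -> mu.-integrable `[tau, +oo[
    (EFin \o (fun x => expR (- (k * x)) * `|H x - H tau|)).
  move=> ak; have k0 : 0 < k by exact: lt_le_trans ak.
  have i1 : mu.-integrable `[tau, +oo[ (EFin \o (fun x => H tau * expR (- (k * x)))).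
    by apply: integrable_scale => //; exact: integrable_expR_tail.
  have := integrable_norm (integrableB _ (iHt k ak) i1).
  move=> /(_ (measurable_itv _)); apply: eq_integrable => // x _ /=.
  by rewrite mulrC -mulrBl normrM (ger0_norm (expR_ge0 _)) mulrC mulrC.
pose J := (\int[mu]_(x in `[tau, +oo[) (expR (- (a1 * x)) * `|H x - H tau|))%R.
have J0 : 0 <= J by apply: Rintegral_ge0 => x _; rewrite mulr_ge0 ?expR_ge0.
apply/eqP; rewrite -normr_le0; apply/ler_addgt0Pr => e e0; rewrite add0r.
have [r r0 Hr] : exists2 r, 0 < r & forall x, tau <= x <= tau + r -> `|H x - H tau| <= e.
  move/cvgrPdist_le : cH => /(_ e e0); rewrite /at_right near_withinE.
  case=> r /= r0 Hr; exists (r / 2); first by rewrite divr_gt0.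
  move=> x /andP[]; rewrite le_eqVlt => /predU1P[<- _|tx xr].
    by rewrite subrr normr0 ltW.
  by rewrite distrC; apply: Hr => //=; rewrite ltr_distlC; apply/andP; split; lra.
(* On [tau, tau + r] the function is within [e] of [H tau]; beyond, the extra factor [exp (- k r)] beats [k]. *)
have main k : a1 <= k%:R -> `|H tau| <= w k + (e + k%:R * expR (- (k%:R * r)) * (expR (a1 * (tau + r)) * J)).
  move=> ak; have k0 : 0 < k%:R :> R by exact: lt_le_trans ak.
  have a0k : a0 <= k%:R by rewrite (le_trans _ ak)// le_max lexx.
  rewrite -(@ler_pM2r _ (expR (- (k%:R * tau)))) ?expR_gt0// mulrDl.
  have -> : `|H tau| * expR (- (k%:R * tau)) =
      `|(\int[mu]_(x in `[tau, +oo[) (k%:R * expR (- (k%:R * x)) * H tau))%R|.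
    rewrite RintegralZr//; last by apply: integrable_scale => //; exact: integrable_expR_tail.
    by rewrite /Rintegral integral_expR_tail//= normrM (ger0_norm (expR_ge0 _)) mulrC.
  have klap : k%:R * laplace H k%:R =
      (\int[mu]_(x in `[tau, +oo[) (k%:R * (expR (- (k%:R * x)) * H x)))%R.
    rewrite RintegralZl//; last exact: iHt.
    congr (_ * _); transitivity (\int[mu]_(x in `[0%R, +oo[)
        (((fun x => expR (- (k%:R * x)) * H x) \_ `[tau, +oo[) x))%R.
      apply: eq_Rintegral => x; rewrite inE/= in_itv/= andbT => x0.
      rewrite patchE mem_setE in_itv/= andbT; have [//|xt] := leP tau x.
      by rewrite H0// mulr0.
    by rewrite -Rintegral_mkcondr setIC (setIidl sD).
  have i1 : mu.-integrable `[tau, +oo[ (EFin \o (fun x => k%:R * expR (- (k%:R * x)) * H tau)).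
    have : mu.-integrable `[tau, +oo[ (EFin \o (fun x => (H tau * k%:R) * expR (- (k%:R * x)))).
      by apply: integrable_scale => //; exact: integrable_expR_tail.
    by apply: eq_integrable => // x _ /=; congr EFin; ring.
  have i2 : mu.-integrable `[tau, +oo[ (EFin \o (fun x => k%:R * (expR (- (k%:R * x)) * H x))).
    by apply: integrable_scale => //; exact: iHt.
  have i3 : mu.-integrable `[tau, +oo[ (EFin \o (fun x => k%:R * expR (- (k%:R * x)))).
    by apply: integrable_scale => //; exact: integrable_expR_tail.
  pose c := k%:R * expR (- (k%:R * r)) * expR (a1 * (tau + r)) * expR (- (k%:R * tau)).
  have i4 : mu.-integrable `[tau, +oo[
      (EFin \o (fun x => e * (k%:R * expR (- (k%:R * x))) + c * (expR (- (a1 * x)) * `|H x - H tau|))).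
    apply: (@integrableD _ _ _ mu _ _ (EFin \o (fun x => e * (k%:R * expR (- (k%:R * x)))))
      (EFin \o (fun x => c * (expR (- (a1 * x)) * `|H x - H tau|)))) => //; apply: integrable_scale => //.
    exact: iD.
  have -> : (\int[mu]_(x in `[tau, +oo[) (k%:R * expR (- (k%:R * x)) * H tau))%R =
      k%:R * laplace H k%:R - (\int[mu]_(x in `[tau, +oo[)
        (k%:R * (expR (- (k%:R * x)) * H x) - k%:R * expR (- (k%:R * x)) * H tau))%R.
    by rewrite (RintegralB _ i2 i1)// klap subKr.
  rewrite (le_trans (ler_normB _ _))// lerD ?Hw//.
  have -> : (e + k%:R * expR (- (k%:R * r)) * (expR (a1 * (tau + r)) * J)) * expR (- (k%:R * tau)) =
     (\int[mu]_(x in `[tau, +oo[) (e * (k%:R * expR (- (k%:R * x))) + c * (expR (- (a1 * x)) * `|H x - H tau|)))%R.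
    rewrite RintegralD//; last 2 first.
    - exact: integrable_scale.
    - by apply: integrable_scale => //; exact: iD.
    have -> : (\int[mu]_(x in `[tau, +oo[) (e * (k%:R * expR (- (k%:R * x)))))%R =
        e * expR (- (k%:R * tau)).
      by rewrite RintegralZl// /Rintegral integral_expR_tail.
    by rewrite RintegralZl//; [rewrite -/J /c; ring|exact: iD].
  apply: Rintegral_norm_le => //; first exact: (integrableB _ i2 i1).
  move=> x /=; rewrite in_itv/= andbT => taux.
  rewrite mulrA -mulrBr normrM ger0_norm ?mulr_ge0 ?expR_ge0//.
  have [xr|rx] := leP x (tau + r).
    rewrite [leRHS]addrC ler_wpDl//; last by rewrite mulrC ler_wpM2r ?mulr_ge0 ?expR_ge0// Hr// taux.
    by rewrite /c !mulr_ge0 ?expR_ge0.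
  rewrite ler_wpDl//; first by rewrite !mulr_ge0 ?expR_ge0 ?ltW.
  rewrite mulrA ler_wpM2r// /c -!mulrA ler_wpM2l// -!expRD ler_expR.
  have : 0 <= (k%:R - a1) * (x - (tau + r)) by rewrite mulr_ge0 ?subr_ge0// ltW.
  lra.
have cv : w k + (e + k%:R * expR (- (k%:R * r)) * (expR (a1 * (tau + r)) * J)) @[k --> \oo] --> e.
  rewrite -[X in _ --> X]add0r; apply: cvgD => //.
  rewrite -[X in _ --> X]addr0; apply: cvgD; first exact: cvg_cst.
  rewrite -[X in _ --> X](mul0r (expR (a1 * (tau + r)) * J)); apply: cvgMl.
  apply: (@squeeze_cvgr _ _ _ _ (cst 0) (fun n => (2 / r) * expR (- (n%:R * (r / 2))))).
  - apply: nearW => n /=; rewrite mulr_ge0 ?expR_ge0//=.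
    have -> : - (n%:R * r) = - (n%:R * (r / 2)) + - (n%:R * (r / 2)) by field.
    rewrite expRD mulrA ler_wpM2r ?expR_ge0// expRN ler_pdivrMr ?expR_gt0//.
    have := expR_ge1Dx (n%:R * (r / 2)) => h.
    have nE : n%:R = 2 / r * (n%:R * (r / 2)) by field; rewrite gt_eqF.
    rewrite {1}nE ler_wpM2l//; first by rewrite divr_ge0// ltW.
    by rewrite (le_trans _ h)// lerDr.
  - exact: cvg_cst.
  - rewrite -[X in _ --> X](mulr0 (2 / r)); apply: cvgMr; apply: cvg_expRN_nat.
    by rewrite divr_gt0.
apply: (cvgr_to_ge cv); near=> k; apply: main.
near: k; exact: nbhs_infty_ger.
Unshelve. all: by end_near. Qed.

End exponential_tails.

Section prefix_uniqueness.
Context (R : realType).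
Local Notation mu := (@lebesgue_measure R).

(** On [0, tau[ the integrals of [H] over all initial intervals vanish, and [H]
    is right-continuous. The endpoint [tau] is out of reach of this argument;
    there the initial value theorem applies, which is why [w] must tend to 0. *)
Lemma laplace_small_eq0 (H : R -> R) (a0 C tau : R) (w : nat -> R) :
  measurable_fun `[(0:R), +oo[ H -> 1 <= a0 -> laplace_integrable H a0 ->
  (forall x, 0 <= x -> H y @[y --> x^'+] --> H x) ->
  (forall k : nat, a0 <= k%:R ->
     `|k%:R * laplace H k%:R| <= w k * expR (- (k%:R * tau))) ->
  (forall k : nat, a0 <= k%:R -> w k <= C) ->
  w k @[k --> \oo] --> (0 : R) -> 0 <= tau ->
  forall x, 0 <= x -> x <= tau -> H x = 0.
Proof.
move=> mH a01 iH cH Hw wC w0 tau0.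
have a00 : 0 <= a0 by rewrite (le_trans _ a01).
have HC k : a0 <= k%:R -> `|laplace H k%:R| <= C * expR (- (k%:R * tau)).
  move=> ak; have k1 : 1 <= k%:R :> R by rewrite (le_trans a01).
  apply: (@le_trans _ _ `|k%:R * laplace H k%:R|).
    by rewrite normrM ler_peMl// normr_nat.
  by rewrite (le_trans (Hw k ak))// ler_wpM2r ?expR_ge0// wC.
have int0 t : 0 <= t -> t < tau -> (\int[mu]_(x in `[0%R, t]) H x)%R = 0.
  by move=> t0 tt; exact: (Rintegral_laplace_small0 mH a00 iH HC t0 tt).
have Hlt x : 0 <= x -> x < tau -> H x = 0.
  move=> x0 xtau; pose t := (x + tau) / 2.
  have xt : x < t by rewrite /t; lra.
  have tt : t < tau by rewrite /t; lra.
  have iHt u : mu.-integrable `[0, u] (EFin \o H) by exact: laplace_integrable_loc iH.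
  apply: (right_continuous_int0 xt) => //.
  - by apply: integrableS (iHt t) => //; apply: subset_itvr; rewrite bnd_simp.
  - exact: cH.
  - move=> u xu ut.
    have ux : (BRight x <= BRight u)%O by rewrite bnd_simp ltW.
    rewrite -(Rintegral_itvB (iHt u) _ ux) ?bnd_simp//.
    by rewrite !int0 ?subrr// ?(le_trans x0 (ltW xu))// (le_lt_trans ut).
move=> x x0; rewrite le_eqVlt => /predU1P[->|]; last exact: Hlt.
exact: (laplace_initial_value0 mH a00 iH tau0 Hlt (cH _ tau0) Hw w0).
Qed.

End prefix_uniqueness.

(** * Inversion of the Kella-Whitt identity *)

Section weighted_distribution.
Context (R : realType) d (S : measurableType d) (m : {sigma_finite_measure set S -> \bar R}).
Variables (k Y : S -> R).
Hypotheses (mk : measurable_fun setT k) (mY : measurable_fun setT Y).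
Hypotheses (k0 : forall s, 0 <= k s) (Y0 : forall s, 0 <= Y s).
Hypothesis ik : m.-integrable setT (EFin \o k).
Local Notation mu := (@lebesgue_measure R).

(** Distribution function of [Y] under the measure of density [k]. *)
Definition weighted_cdf (x : R) : R := (\int[m]_s (k s * (Y s <= x)%R%:R))%R.

Lemma integrable_weight (g : S -> R) (c : R) : measurable_fun setT g ->
  (forall s, `|g s| <= c) -> m.-integrable setT (EFin \o (fun s => k s * g s)).
Proof.
move=> mg gc; have i1 : m.-integrable setT (EFin \o (fun s => c * k s)).
  exact: integrable_scale.
apply: (integrable_le _ _ i1) => //; first exact: measurable_funM.
by move=> s _; rewrite normrM mulrC (ger0_norm (k0 s)) ler_wpM2r.
Qed.

Lemma measurable_leR (x : R) : measurable_fun setT (fun s => (Y s <= x)%R%:R : R).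
Proof.
rewrite (_ : (fun s => _) = \1_(Y @^-1` `]-oo, x])).
  apply: measurable_indic; rewrite -[X in measurable X]setTI.
  exact: mY.
apply/funext => s; rewrite indicE; congr (nat_of_bool _)%:R.
by apply/idP/idP; rewrite inE/= in_itv/=.
Qed.

Lemma bool_norm_le1 (b : bool) : `|b%:R : R| <= 1.
Proof. by case: b; rewrite ?normr1 ?normr0. Qed.

Lemma integrable_weighted_cdf x : m.-integrable setT (EFin \o (fun s => k s * (Y s <= x)%R%:R)).
Proof. by apply: (integrable_weight (c := 1)) => [|s]; [exact: measurable_leR|exact: bool_norm_le1]. Qed.

Lemma weighted_cdf_ge0 x : 0 <= weighted_cdf x.
Proof. by apply: Rintegral_ge0 => s _; rewrite mulr_ge0. Qed.

Lemma weighted_cdf_homo : {homo weighted_cdf : x y / x <= y}.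
Proof.
move=> x y xy; apply: le_Rintegral => //; [exact: integrable_weighted_cdf|exact: integrable_weighted_cdf|].
move=> s _; rewrite ler_wpM2l// ler_nat; case: (leP (Y s) x) => //= h.
by rewrite (le_trans h xy).
Qed.

Lemma measurable_weighted_cdf D : measurable D -> measurable_fun D weighted_cdf.
Proof. by move=> mD; apply: nondecreasing_measurable => //; exact: weighted_cdf_homo. Qed.

Lemma weighted_cdf_right_continuous x : weighted_cdf y @[y --> x^'+] --> weighted_cdf x.
Proof.
have [||||_ cv] := @Rintegral_dominated_cvg _ _ _ m setT measurableT
  (fun n s => k s * (Y s <= x + n.+1%:R^-1)%R%:R) (fun s => k s * (Y s <= x)%R%:R) k.
- by move=> n; apply: measurable_funM => //; exact: measurable_leR.
- move=> s _; apply: cvgMr; have [Yx|xY] := leP (Y s) x.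
    apply: cvg_near_cst; apply: nearW => n.
    by rewrite (le_trans Yx)// lerDl invr_ge0.
  apply: cvg_near_cst; near=> n.
  have /negbTE -> // : ~~ (Y s <= x + n.+1%:R^-1).
  rewrite -ltNge -ltrBrDl invf_plt ?posrE ?subr_gt0//.
  rewrite (lt_le_trans (y := n%:R))//; last by rewrite ler_nat.
  by near: n; exact: nbhs_infty_gtr.
- exact: ik.
- by move=> n s _; rewrite normrM (ger0_norm (k0 s)) ler_piMr// bool_norm_le1.
apply/cvgrPdist_le => e e0.
move/cvgrPdist_le : cv => /(_ e e0)[N _ /(_ N (leqnn N))] /= hN.
near=> y; have xy : x < y by near: y; exact: nbhs_right_gt.
rewrite distrC ger0_norm ?subr_ge0 ?weighted_cdf_homo// ?(ltW xy)//.
move: hN; rewrite distrC => /ler_normlP[_ hN]; apply: le_trans hN.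
rewrite lerD2r; apply: weighted_cdf_homo.
by near: y; apply: nbhs_right_le; rewrite ltrDl invr_gt0.
Unshelve. all: by end_near. Qed.

Lemma integrable_weight_exp (a : R) : 0 <= a ->
  m.-integrable setT (EFin \o (fun s => k s * expR (- (a * Y s)))).
Proof.
move=> a0; apply: (integrable_weight (c := 1)) => [|s].
  by apply: (measurableT_comp (f := fun x => expR (- (a * x)))) => //; exact: measurable_expRNM.
by rewrite ger0_norm ?expR_ge0// -expR0 ler_expR oppr_le0 mulr_ge0.
Qed.

(** Tonelli's theorem, since [exp (- a Y) / a] is the integral of [exp (- a x)]
    over [x >= Y]. *)
Lemma laplace_weighted_cdfE (a : R) : 0 < a ->
  (\int[mu]_(x in `[0%R, +oo[) (expR (- (a * x)) * weighted_cdf x)%:E)%E =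
  (a^-1 * (\int[m]_s (k s * expR (- (a * Y s))))%R)%:E.
Proof.
move=> a0.
pose f (z : measurableTypeR R * S) := ((expR (- (a * z.1)) * (0 <= z.1)%R%:R) * (k z.2 * (Y z.2 <= z.1)%R%:R))%:E.
have mf : measurable_fun setT f.
  apply/measurable_EFinP; apply: measurable_funM; apply: measurable_funM.
  - by apply: (measurableT_comp (f := fun x => expR (- (a * x)))) => //; exact: measurable_expRNM.
  - rewrite (_ : (fun _ => _) = fun z => \1_`[0, +oo[ z.1).
      apply: measurableT_comp => //; exact: measurable_indic.
    by apply/funext => z; rewrite indicE mem_setE in_itv/= andbT.
  - exact: measurableT_comp.
  - rewrite (_ : (fun _ => _) = fun z => \1_`]-oo, 0] (Y z.2 - z.1)).
      apply: measurableT_comp; first exact: measurable_indic.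
      by apply: measurable_funB => //; exact: measurableT_comp.
    by apply/funext => z; rewrite indicE mem_setE in_itv/= subr_le0.
have f0 z : (0 <= f z)%E by rewrite lee_fin !mulr_ge0// expR_ge0.
transitivity (\int[mu]_x \int[m]_s f (x, s))%E.
  rewrite integral_mkcond; apply: eq_integral => x _.
  rewrite patchE mem_setE in_itv/= andbT; case: ifPn => x0; last first.
    by rewrite integral0_eq// => s _; rewrite /f/= (negbTE x0) mulr0 mul0r.
  rewrite /f/= x0 mulr1.
  under eq_integral do rewrite EFinM.
  rewrite integralZl//; last exact: integrable_weighted_cdf.
  by rewrite EFinM /weighted_cdf EFin_Rintegral//; exact: integrable_weighted_cdf.
rewrite (fubini_tonelli (m1 := mu) (m2 := m) f mf f0).
have iw := integrable_weight_exp (ltW a0).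
rewrite EFinM EFin_Rintegral// -integralZl//.
apply: eq_integral => s _.
transitivity (\int[mu]_(x in `[Y s, +oo[) ((k s * a^-1)%:E * (a * expR (- (a * x)))%:E))%E.
  rewrite [RHS]integral_mkcond; apply: eq_integral => x _.
  rewrite patchE mem_setE in_itv/= andbT /f/=.
  case: ifPn => Yx; last by rewrite !mulr0.
  by rewrite (le_trans (Y0 s) Yx) !mulr1 -EFinM; congr EFin; field; rewrite gt_eqF.
rewrite ge0_integralZl//.
- by rewrite integral_expR_tail// -!EFinM /=; congr EFin; ring.
- by apply/measurable_EFinP; apply: measurable_funM => //; exact: measurable_expRNM.
- by move=> x _; rewrite lee_fin mulr_ge0 ?expR_ge0// ltW.
- by rewrite lee_fin mulr_ge0// invr_ge0 ltW.
Qed.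

Lemma laplace_integrable_weighted_cdf (a : R) : 0 < a -> laplace_integrable weighted_cdf a.
Proof.
move=> a0; apply/integrableP; split.
  apply/measurable_EFinP; apply: measurable_funM; last exact: measurable_weighted_cdf.
  exact: measurable_expRNM.
under eq_integral => x _ do rewrite gee0_abs ?lee_fin ?mulr_ge0 ?expR_ge0 ?weighted_cdf_ge0//.
by rewrite laplace_weighted_cdfE// ltry.
Qed.

Lemma laplace_weighted_cdf (a : R) : 0 < a ->
  a * laplace weighted_cdf a = (\int[m]_s (k s * expR (- (a * Y s))))%R.
Proof.
by move=> a0; rewrite /laplace /Rintegral laplace_weighted_cdfE//= mulrA mulfV ?gt_eqF// mul1r.
Qed.

End weighted_distribution.

Section laplace_decay.
Context (R : realType).
Local Notation mu := (@lebesgue_measure R).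

Lemma laplace_integrable_fin_num (H : R -> R) (a r : R) :
  measurable_fun `[(0:R), +oo[ H ->
  (\int[mu]_(x in `[0%R, +oo[) (expR (- (a * x)) * H x)%:E)%E = r%:E ->
  laplace_integrable H a /\ laplace H a = r.
Proof.
move=> mH hr; split; last by rewrite /laplace /Rintegral hr.
have mf : measurable_fun `[(0:R), +oo[ (fun x => expR (- (a * x)) * H x).
  by apply: measurable_funM => //; exact: measurable_expRNM.
apply/integrableP; split; first exact/measurable_EFinP.
rewrite (_ : (fun _ => _) = (fun x => `|expR (- (a * x)) * H x|%:E))//.
by rewrite integral_fin_num_abs// hr.
Qed.

Lemma laplace_norm_le (H : R -> R) (a0 a : R) : measurable_fun `[(0:R), +oo[ H ->
  laplace_integrable H a0 -> a0 <= a ->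
  `|laplace H a| <= (\int[mu]_(x in `[0%R, +oo[) `|expR (- (a0 * x)) * H x|)%R.
Proof.
move=> mH iH aa0; have iHa := laplace_integrableW mH aa0 iH.
apply: Rintegral_norm_le => //; first exact: integrable_normr.
move=> x /=; rewrite in_itv/= andbT => x0.
rewrite !normrM ler_wpM2r// !ger0_norm ?expR_ge0//.
exact: ler_expRNM.
Qed.

Lemma laplace_cvg0 (H : R -> R) (a0 : R) : measurable_fun `[(0:R), +oo[ H ->
  laplace_integrable H a0 ->
  laplace H n%:R @[n --> \oo] --> (0 : R).
Proof.
move=> mH iH; pose N := (Num.truncn `|a0|).+1.
have aN n : a0 <= (n + N)%:R.
  rewrite (le_trans (ler_norm _))// (le_trans (ltW (truncnS_gt _)))//.
  by rewrite ler_nat leq_addl.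
rewrite -(cvg_shiftn N).
have mD : measurable (`[0%R, +oo[%classic : set R) by exact: measurable_itv.
have [|||||_] := @Rintegral_dominated_cvg_ae _ _ _ mu `[0%R, +oo[ mD
  (fun n x => expR (- ((n + N)%:R * x)) * H x) (cst 0)
  (fun x => `|expR (- (a0 * x)) * H x|).
- by move=> n; apply: measurable_funM => //; exact: measurable_expRNM.
- by [].
- exists [set 0]; split => //; first exact: lebesgue_measure_set1.
  move=> x /=; apply: contra_notP => /eqP xn0; rewrite in_itv/= andbT => x0.
  have {xn0}x0 : 0 < x by rewrite lt_neqAle eq_sym xn0.
  rewrite -[X in _ --> X](mul0r (H x)); apply: cvgMl.
  by rewrite (cvg_shiftn N (fun n : nat => expR (- (n%:R * x)))); exact: cvg_expRN_nat.
- exact: integrable_normr.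
- move=> n x /=; rewrite in_itv/= andbT => x0.
  rewrite !normrM ler_wpM2r// !ger0_norm ?expR_ge0//.
  exact: ler_expRNM.
by rewrite Rintegral_cst// mul0r.
Qed.

Lemma within_right_continuous (H : R -> R) x : {within `[0%R, +oo[, continuous H} ->
  0 <= x -> H y @[y --> x^'+] --> H x.
Proof.
move=> /continuous_within_itvcyP[cH cH0].
rewrite le_eqVlt => /predU1P[<-//|x0].
apply: cvg_at_right_filter; apply: cH.
by rewrite in_itv/= x0.
Qed.

End laplace_decay.

Section occupation_identity.
Context (R : realType) d (S : measurableType d) (m : {sigma_finite_measure set S -> \bar R}).
Variables (k Y : S -> R).
Hypotheses (mk : measurable_fun setT k) (mY : measurable_fun setT Y).
Hypotheses (k0 : forall s, 0 <= k s) (Y0 : forall s, 0 <= Y s).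
Hypothesis ik : m.-integrable setT (EFin \o k).
Local Notation mu := (@lebesgue_measure R).
Local Notation F := (weighted_cdf m k Y).

Variables (phi W : R -> R) (q theta tau c l b0 : R).
Hypotheses (q0 : 0 < q) (theta0 : 0 <= theta) (tau0 : 0 <= tau) (c0 : 0 < c).
Hypothesis phic : phi c = q.
Hypothesis phiNp : forall a, b0 < a -> phi a != q + theta.
Hypothesis mW : {within `[0%R, +oo[, continuous W}.
Hypothesis WE : forall a, b0 < a ->
  (\int[mu]_(x in `[0%R, +oo[) (expR (- (a * x)) * W x)%:E)%E =
  ((phi a - (q + theta))^-1)%:E.
Hypothesis kYE : forall a, 0 < a ->
  (phi a - q) * (\int[m]_s (k s * expR (- (a * Y s))))%R
  - theta * (\int[m]_s (k s * expR (- (a * Y s)) * (Y s <= tau)%R%:R))%R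
  = a * l - expR (- (a * tau)).
Hypothesis kE :
  q * (\int[m]_s k s)%R + theta * (\int[m]_s (k s * (Y s <= tau)%R%:R))%R = 1.

Lemma measurable_scale : measurable_fun `[(0:R), +oo[ W.
Proof. exact: subspace_continuous_measurable_fun. Qed.

Let M := (\int[m]_s k s)%R.

Lemma integrable_weight_exp_le (a : R) : 0 <= a -> m.-integrable setT
  (EFin \o (fun s => k s * expR (- (a * Y s)) * (Y s <= tau)%R%:R)).
Proof.
move=> a0; have : m.-integrable setT
    (EFin \o (fun s => k s * (expR (- (a * Y s)) * (Y s <= tau)%R%:R))).
  apply: (integrable_weight mk k0 ik (c := 1)).
    apply: measurable_funM; last exact: measurable_leR.
    by apply: (measurableT_comp (f := fun x => expR (- (a * x)))) => //; exact: measurable_expRNM.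
  move=> s; rewrite normrM -[leRHS]mulr1 ler_pM// ?bool_norm_le1//.
  by rewrite ger0_norm ?expR_ge0// -expR0 ler_expR oppr_le0 mulr_ge0.
by apply: eq_integrable => // s _ /=; rewrite mulrA.
Qed.

(** Splitting [nu(exp (- a .))] at [tau] turns the Kella-Whitt identity into
    [(phi a - (q + theta)) nu(exp (- a .)) = a l - exp (- a tau) - theta N], where
    [N <= M exp (- a tau)] is the part above [tau]. Dividing by
    [phi a - (q + theta)] makes the transform of the scale function appear. *)
Lemma laplace_defect (a : R) : 0 < a -> b0 < a ->
  `|a * laplace (fun x => l * W x - F x) a| <=
    `|laplace W a| * (1 + theta * M) * expR (- (a * tau)).
Proof.
move=> a0 ba.
have [iW lW] := laplace_integrable_fin_num measurable_scale (WE ba).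
have iF : laplace_integrable F a by exact: laplace_integrable_weighted_cdf.
have -> : laplace (fun x => l * W x - F x) a = l * laplace W a - laplace F a.
  rewrite /laplace -RintegralZl// -RintegralB//; last exact: integrable_scale.
  by apply: eq_Rintegral => x _; ring.
rewrite mulrBr laplace_weighted_cdf// lW.
have kYE_ := kYE a0.
set I := (\int[m]_s (k s * expR (- (a * Y s))))%R in kYE_ *.
pose N := (\int[m]_s (k s * expR (- (a * Y s)) * (tau < Y s)%R%:R))%R.
have p0 : phi a - (q + theta) != 0 by rewrite subr_eq0 phiNp.
have iI : m.-integrable setT (EFin \o (fun s => k s * expR (- (a * Y s)))).
  by apply: integrable_weight_exp => //; exact: ltW.
have iL := integrable_weight_exp_le (ltW a0).
have iN : m.-integrable setT (EFin \o (fun s => k s * expR (- (a * Y s)) * (tau < Y s)%R%:R)).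
  have := integrableB measurableT iI iL; apply: eq_integrable => // s _ /=.
  by rewrite -EFinD; congr EFin; case: leP => _; rewrite /= ?mulr1 ?mulr0 ?subrr ?subr0.
set L := (\int[m]_s (k s * expR (- (a * Y s)) * (Y s <= tau)%R%:R))%R in kYE_.
have IE : I = L + N.
  rewrite -RintegralD//; apply: eq_Rintegral => s _.
  by case: leP => _; rewrite ?mulr1 ?mulr0 ?addr0 ?add0r.
have NM : 0 <= N <= M * expR (- (a * tau)).
  apply/andP; split; first by apply: Rintegral_ge0 => s _; rewrite !mulr_ge0 ?expR_ge0.
  rewrite mulrC /M -RintegralZl//; apply: le_Rintegral => //; first exact: integrable_scale.
  move=> s _; rewrite -mulrA mulrC; case: ltP => /= h; last first.
    by rewrite mulr0 mul0r mulr_ge0 ?expR_ge0.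
  by rewrite mulr1 ler_wpM2r// ler_expR lerN2 ler_wpM2l ?ltW.
have key : (phi a - (q + theta)) * I = a * l - expR (- (a * tau)) - theta * N.
  by rewrite -kYE_ IE; ring.
have -> : a * (l * (phi a - (q + theta))^-1) - I =
   (phi a - (q + theta))^-1 * (expR (- (a * tau)) + theta * N).
  have -> : I = (phi a - (q + theta))^-1 * (a * l - expR (- (a * tau)) - theta * N).
    by rewrite -key mulKf.
  by ring.
rewrite normrM -mulrA ler_wpM2l// ger0_norm; last first.
  by rewrite addr_ge0 ?expR_ge0// mulr_ge0//; case/andP: NM.
rewrite mulrDl mul1r lerD2l -mulrA ler_wpM2l//; by case/andP: NM.
Qed.

(** The decay required by [laplace_small_eq0] comes from [laplace_defect], with
    [w k] proportional to the transform of [W] at [k], which tends to 0. *)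
Lemma weighted_cdf_scale x : 0 <= x -> x <= tau -> F x = l * W x.
Proof.
move=> x0 xtau; apply/eqP; rewrite eq_sym -subr_eq0; apply/eqP.
pose a0 := Num.max 1 (b0 + 1).
have a01 : 1 <= a0 by rewrite le_max lexx.
have a00 : 0 < a0 by exact: lt_le_trans a01.
have ba : b0 < a0 by rewrite lt_max [X in _ || X]ltrDl ltr01 orbT.
have [iW _] := laplace_integrable_fin_num measurable_scale (WE ba).
pose J := (\int[mu]_(x in `[0%R, +oo[) `|expR (- (a0 * x)) * W x|)%R.
have M1 : 0 <= 1 + theta * M.
  by rewrite addr_ge0// mulr_ge0//; apply: Rintegral_ge0.
have mF : measurable_fun `[(0:R), +oo[ F by exact: measurable_weighted_cdf.
have iF : laplace_integrable F a0 by exact: laplace_integrable_weighted_cdf.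
apply: (@laplace_small_eq0 R (fun x => l * W x - F x) a0 (J * (1 + theta * M)) tau
  (fun n => `|laplace W n%:R| * (1 + theta * M))) => //.
- by apply: measurable_funB => //; apply: measurable_funM => //; exact: measurable_scale.
- have i1 : mu.-integrable `[(0:R), +oo[ (EFin \o (fun x => l * (expR (- (a0 * x)) * W x))).
    exact: integrable_scale.
  have := integrableB _ i1 iF => /(_ (measurable_itv _)).
  by apply: eq_integrable => // y _ /=; rewrite -EFinB; congr EFin; ring.
- move=> y y0; apply: cvgB; last exact: weighted_cdf_right_continuous.
  by apply: cvgMr; exact: within_right_continuous.
- move=> n an; apply: laplace_defect; first exact: lt_le_trans an.
  exact: lt_le_trans an.
- move=> n an; rewrite ler_wpM2r//; exact: (laplace_norm_le measurable_scale iW).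
- rewrite -[X in _ --> X](mul0r (1 + theta * M)); apply: cvgMl.
  by rewrite -[X in _ --> X](@normr0 _ R); apply: cvg_norm; exact: (laplace_cvg0 measurable_scale iW).
Qed.

(** At the argument [c], where [phi c = q], the Kella-Whitt identity reduces to
    [- theta nu(exp (- c .); [0, tau]) = c l - exp (- c tau)]. With [F = l W] on
    [0, tau] and an integration by parts, here done by computing the Laplace
    transform of the distribution function stopped at [tau], this is a linear
    equation for [l]. *)
Lemma occupation_mass_formula :
  M = q^-1 * (c * (1 + theta * (\int[mu]_(y in `[0%R, tau]) (expR (- (c * y)) * W y))%R) /
    (theta * (expR (- (c * tau)) * W tau) +
     c * (1 + theta * (\int[mu]_(y in `[0%R, tau]) (expR (- (c * y)) * W y))%R))).
Proof.
set V := (\int[mu]_(y in `[0%R, tau]) (expR (- (c * y)) * W y))%R.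
pose k' s := k s * (Y s <= tau)%R%:R.
have mk' : measurable_fun setT k' by apply: measurable_funM => //; exact: measurable_leR.
have k'0 s : 0 <= k' s by rewrite mulr_ge0.
have ik' : m.-integrable setT (EFin \o k') by exact: integrable_weighted_cdf.
have F'E x : weighted_cdf m k' Y x = F (Num.min x tau).
  apply: eq_Rintegral => s _; rewrite /k' -mulrA; congr (_ * _).
  by rewrite le_min; case: (Y s <= tau); case: (Y s <= x); rewrite /= ?mulr1 ?mulr0 ?mul0r.
have e1 : (\int[m]_s (k s * expR (- (c * Y s)) * (Y s <= tau)%R%:R))%R =
    l * (c * V + expR (- (c * tau)) * W tau).
  have := laplace_weighted_cdf mk' mY k'0 Y0 ik' c0.
  have -> : (\int[m]_s (k' s * expR (- (c * Y s))))%R =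
      (\int[m]_s (k s * expR (- (c * Y s)) * (Y s <= tau)%R%:R))%R.
    by apply: eq_Rintegral => s _; rewrite /k'; ring.
  move=> <-; rewrite /laplace.
  have iF' : laplace_integrable (weighted_cdf m k' Y) c by exact: laplace_integrable_weighted_cdf.
  have t1 : (BLeft 0 <= BRight tau)%O by rewrite bnd_simp.
  have t2 : (BRight tau <= BInfty R false)%O by [].
  rewrite -[in LHS](subrK (\int[mu]_(x in `[0%R, tau]) (expR (- (c * x)) * weighted_cdf m k' Y x))%R
    (\int[mu]_(x in `[0%R, +oo[) (expR (- (c * x)) * weighted_cdf m k' Y x))%R).
  rewrite (Rintegral_itvB iF' t1 t2).
  have -> : (\int[mu]_(x in `[0%R, tau]) (expR (- (c * x)) * weighted_cdf m k' Y x))%R = l * V.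
    rewrite /V -RintegralZl//; last first.
      have ba : b0 < Num.max 1 (b0 + 1) by rewrite lt_max [X in _ || X]ltrDl ltr01 orbT.
      have [iW _] := laplace_integrable_fin_num measurable_scale (WE ba).
      have iWt : mu.-integrable `[(0:R), tau] (EFin \o W).
        apply: (laplace_integrable_loc _ measurable_scale _ iW).
        by rewrite (le_trans ler01)// le_max lexx.
      have iWn : mu.-integrable `[(0:R), tau] (EFin \o (fun x => `|W x|)).
        exact: integrable_normr.
      apply: (integrable_le _ _ iWn) => //.
        apply: measurable_funM; first exact: measurable_expRNM.
        apply: measurable_funS measurable_scale => //.
        by move=> x /=; rewrite !in_itv/= andbT => /andP[].
      move=> x /=; rewrite in_itv/= => /andP[x0 _].
      rewrite normrM ler_piMl// ger0_norm ?expR_ge0// -expR0 ler_expR oppr_le0.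
      by rewrite mulr_ge0// ltW.
    apply: eq_Rintegral => x; rewrite inE/= in_itv/= => /andP[x0 xt].
    by rewrite F'E min_l// weighted_cdf_scale//; ring.
  have -> : (\int[mu]_(x in `]tau, +oo[) (expR (- (c * x)) * weighted_cdf m k' Y x))%R =
      l * W tau * (c^-1 * expR (- (c * tau))).
    have itail := integrable_expR_tail tau c0.
    have itail' : mu.-integrable `]tau, +oo[ (EFin \o (fun x => expR (- (c * x)))).
      by apply: integrableS itail => //; apply: subset_itvr; rewrite bnd_simp.
    rewrite -Rintegral_expR_tail// -Rintegral_itv_obnd_cbnd// -RintegralZl//.
    apply: eq_Rintegral => x; rewrite inE/= in_itv/= andbT => /ltW xt.
    by rewrite F'E min_r// weighted_cdf_scale//; ring.
  by field; rewrite gt_eqF.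
have Ftau : (\int[m]_s (k s * (Y s <= tau)%R%:R))%R = l * W tau by rewrite -weighted_cdf_scale.
have := kYE c0; rewrite phic subrr mul0r sub0r e1 => h1.
have := kE; rewrite -/M Ftau => h2.
set E := expR (- (c * tau)) in h1 *; set Wt := W tau in h1 h2 *.
have E0 : 0 < E by exact: expR_gt0.
have h3 : l * (theta * (E * Wt) + c * (1 + theta * V)) = E by lra.
have d0 : theta * (E * Wt) + c * (1 + theta * V) != 0.
  by apply: contraTneq E0 => d0; rewrite -h3 d0 mulr0 ltxx.
have l0 : l = E / (theta * (E * Wt) + c * (1 + theta * V)).
  by apply: (mulIf d0); rewrite divfK.
rewrite l0 in h2.
have -> : M = q^-1 * (1 - theta * (E / (theta * (E * Wt) + c * (1 + theta * V)) * Wt)).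
  by rewrite -[X in _ * (X - _)]h2 addrK mulKf ?gt_eqF.
by field; apply/andP; split; [exact: d0|rewrite gt_eqF].
Qed.
End occupation_identity.

(** * Reflected paths and their discretization *)

Section cadlag_paths.
Context (R : realType).
Implicit Types (x : R -> R) (t u e : R).

Lemma cadlag_local x u e : cadlag x -> 0 <= u -> 0 < e ->
  exists2 r, 0 < r & (forall y, u <= y -> y < u + r -> `|x y - x u| <= e) /\
    (forall y, 0 <= y -> u - r < y -> y < u -> `|x y - lim (x s @[s --> u^'-])| <= e).
Proof.
move=> [cr cl] u0 e0.
have /cvgrPdist_le/(_ e e0) := cr u u0.
rewrite /at_right near_withinE => -[r1 /= r10 h1].
have [r2 r20 h2] : exists2 r2, 0 < r2 &
    forall y, 0 <= y -> u - r2 < y -> y < u -> `|x y - lim (x s @[s --> u^'-])| <= e.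
  move: u0; rewrite le_eqVlt => /predU1P[<-|u0].
    by exists 1 => // y y0 _; rewrite ltNge y0.
  have /cvgrPdist_le/(_ e e0) : x s @[s --> u^'-] --> lim (x s @[s --> u^'-]) by exact: cl.
  rewrite /at_left near_withinE => -[r2 /= r20 h2].
  exists r2 => // y y0 uy yu; rewrite distrC; apply: h2 => //=.
  by rewrite gtr0_norm ?subr_gt0//; lra.
exists (Num.min r1 r2); first by rewrite lt_min r10.
split=> y.
  rewrite le_eqVlt => /predU1P[<- _|uy]; first by rewrite subrr normr0 ltW.
  rewrite -ltrBlDl lt_min => /andP[yr _]; rewrite distrC; apply: h1 => //=.
  by rewrite distrC gtr0_norm ?subr_gt0.
move=> y0 uy yu; apply: h2 => //; apply: le_lt_trans uy.
by rewrite lerB// ge_min lexx orbT.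
Qed.

Lemma cadlag_bounded x t : cadlag x -> exists M, forall s, 0 <= s -> s <= t -> `|x s| <= M.
Proof.
move=> cx.
have /compact_near_coveringP := @segment_compact R 0 t.
move=> /(_ nat \oo (fun n s => 0 <= s -> `|x s| <= n%:R)) [|n _ /(_ n (leqnn n)) H].
  move=> u /=; rewrite in_itv/= => /andP[u0 ut].
  have [r r0 [hr hl]] := cadlag_local cx u0 (@ltr01 R).
  set l := lim _ in hl.
  exists ([set y | u - r < y < u + r], [set n | `|x u| + `|l| + 1 <= n%:R]) => /=.
    split; last exact: nbhs_infty_ger.
    exists r => //= y /=; rewrite ltr_distlC => /andP[h1 h2]; apply/andP; split; lra.
  move=> [y n] /= [/andP[yl yr] hn] y0.
  have := ler_normD (x y - x u) (x u); rewrite subrK.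
  have := ler_normD (x y - l) l; rewrite subrK.
  have := normr_ge0 (x u); have := normr_ge0 l.
  have [uy|yu] := leP u y; first by have := hr y uy yr; lra.
  by have := hl y y0 yl yu; lra.
exists n%:R => s s0 st; apply: H => //=.
by rewrite in_itv/= s0.
Qed.

(** Near a point [u] of [0, 1] a short grid interval either lies on one side of
    [u], where the path hardly varies, or contains [u], and then the increment is
    close to the jump at [u], which is nonnegative. Compactness makes this
    uniform in [u]. *)
Lemma cadlag_grid_increments x (e : R) : cadlag x -> 0 < e ->
  (forall t, 0 < t -> t <= 1 -> lim (x s @[s --> t^'-]) <= x t) ->
  \forall n \near \oo, forall s : R, 0 <= s -> s + n.+1%:R^-1 <= 1 ->
    x s - x (s + n.+1%:R^-1) <= e.
Proof.
move=> cx e0 nj.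
have /compact_near_coveringP := @segment_compact R 0 1.
move=> /(_ nat \oo (fun n s => 0 <= s -> s + n.+1%:R^-1 <= 1 ->
    x s - x (s + n.+1%:R^-1) <= e)) [|N _ H]; last first.
  exists N => // n /= Nn s s0 s1; apply: (H n Nn) => //=.
  by rewrite in_itv/= s0 (le_trans _ s1)// lerDl invr_ge0.
move=> u /=; rewrite in_itv/= => /andP[u0 u1].
have e40 : 0 < e / 4 by rewrite divr_gt0.
have [r r0 [hr hl]] := cadlag_local cx u0 e40.
set l := lim _ in hl.
exists ([set y | u - r / 2 < y < u + r / 2], [set n | n.+1%:R^-1 < r / 2]) => /=.
  split.
    exists (r / 2); first by rewrite /= divr_gt0.
    by move=> y /=; rewrite ltr_distlC.
  near=> n => /=; rewrite invf_plt ?posrE ?divr_gt0//.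
  rewrite (lt_le_trans (y := n%:R)) ?ler_nat//.
  by near: n; exact: nbhs_infty_gtr.
move=> [y n] /= [/andP[yl yr] hn] y0 y1.
have h0 : 0 < n.+1%:R^-1 :> R by rewrite invr_gt0.
set h := n.+1%:R^-1 in h0 hn y1 *.
have [uy|yu] := leP u y.
  have := hr y uy ltac:(lra); have := hr (y + h) ltac:(lra) ltac:(lra).
  by move=> /ler_normlP[a b] /ler_normlP[c d]; lra.
have [uy|yu'] := leP u (y + h).
  have := nj u ltac:(lra) u1; rewrite -/l.
  have := hr (y + h) uy ltac:(lra); have := hl y y0 ltac:(lra) yu.
  by move=> /ler_normlP[a b] /ler_normlP[c d]; lra.
have := hl y y0 ltac:(lra) yu; have := hl (y + h) ltac:(lra) ltac:(lra) yu'.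
by move=> /ler_normlP[a b] /ler_normlP[c d]; lra.
Unshelve. all: by end_near. Qed.

End cadlag_paths.

Section grids.
Context (R : realType).
Implicit Types (x : R -> R) (t u e : R) (n : nat).

(** Index of the first point of the grid of mesh [1 / n.+1] strictly after [t]:
    the grid times converge to [t] from the right, where cadlag paths are
    continuous. *)
Definition grid_index n t : nat := (Num.truncn (t * n.+1%:R)).+1.

#[global] Arguments grid_index : simpl never.

Definition grid_time n t : R := (grid_index n t)%:R / n.+1%:R.

Lemma grid_time_gt n t : t < grid_time n t.
Proof. by rewrite /grid_time ltr_pdivlMr// truncnS_gt. Qed.

Lemma grid_time_le n t : 0 <= t -> grid_time n t <= t + n.+1%:R^-1.
Proof.
move=> t0; rewrite /grid_time ler_pdivrMr// mulrDl mulVf//.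
by rewrite /grid_index -[leLHS]natr1 lerD2r truncn_le mulr_ge0.
Qed.

Lemma grid_index_interval n t (i : nat) : 0 <= t ->
  i%:R / n.+1%:R <= t -> t < i.+1%:R / n.+1%:R -> grid_index n t = i.+1.
Proof.
move=> t0; rewrite ler_pdivrMr// ltr_pdivlMr// => h1 h2.
by congr S; apply: truncn_def; rewrite h1.
Qed.

Lemma measurable_grid_index n k : measurable (grid_index n @^-1` [set k]).
Proof.
have E : grid_index n @^-1` [set k] =
    [set t : R | grid_index n t == k].
  by apply/seteqP; split=> t /= /eqP.
rewrite E; case: k {E} => [|k].
  by rewrite (_ : [set _ | _] = set0)//; apply/seteqP; split=> t.
have mM : measurable_fun setT (fun t : R => t * n.+1%:R) by exact: measurable_funM.
rewrite /grid_index; under eq_set do rewrite eqSS.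
have [k0|k0] := posnP k.
  rewrite k0 (_ : [set _ | _] = (fun t : R => t * n.+1%:R) @^-1` `]-oo, 1[).
    by rewrite -[X in measurable X]setTI; apply: mM.
  apply/seteqP; split=> t /=; rewrite in_itv/= ltNge.
    by move=> /eqP/truncn0Pn.
  by move=> /truncn0Pn ->.
rewrite (_ : [set _ | _] = (fun t : R => t * n.+1%:R) @^-1` `[k%:R, k.+1%:R[).
  by rewrite -[X in measurable X]setTI; apply: mM.
apply/seteqP; split=> t /=; rewrite in_itv/=.
  move=> /eqP tk; have t1 : 1 <= t * n.+1%:R by rewrite -truncn_gt0 tk.
  by rewrite -tk truncn_itv// (le_trans ler01).
by move=> /truncn_def ->.
Qed.

Lemma cvg_invSn : (n.+1%:R^-1 : R) @[n --> \oo] --> (0 : R).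
Proof. exact: cvg_harmonic. Qed.

Lemma cvg_grid_time t : 0 <= t -> grid_time n t @[n --> \oo] --> t.
Proof.
move=> t0; apply: (@squeeze_cvgr _ _ _ _ (cst t) (fun n => t + n.+1%:R^-1)).
- by apply: nearW => n /=; rewrite ltW ?grid_time_gt// grid_time_le.
- exact: cvg_cst.
- by rewrite -[X in _ --> X]addr0; apply: cvgD; [exact: cvg_cst|exact: cvg_invSn].
Qed.

Lemma cvg_grid x t : x s @[s --> t^'+] --> x t -> 0 <= t ->
  x (grid_time n t) @[n --> \oo] --> x t.
Proof.
move=> /cvg_at_rightP cx t0; apply: (cx (grid_time ^~ t)); split.
- by move=> n; exact: grid_time_gt.
- exact: cvg_grid_time.
Qed.

End grids.

Section lindley.
Context (R : realType).
Variables (h : R) (f : R -> R).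

(** One step of the random walk reflected at 0, with the Riemann sum of [f]
    along the walk as second component. *)
Definition lindley_step (z : (R * R) * R) : R * R :=
  let y := Num.max (z.1.1 + z.2) 0 in (y, z.1.2 + h * f y).

Fixpoint lindley (tau : R) (xi : nat -> R) (i : nat) : R * R :=
  if i is j.+1 then lindley_step (lindley tau xi j, xi j) else (tau, 0).

Definition running_max (tau : R) (s : nat -> R) (i : nat) : R :=
  iteri i (fun j m => Num.max m (- s j.+1)) tau.

Lemma running_max_le tau s i b :
  (running_max tau s i <= b) <-> tau <= b /\ (forall j, (j < i)%N -> - s j.+1 <= b).
Proof.
elim: i => [|i IH] /=; first by split=> [h0|[]].
rewrite ge_max; split.
  move=> /andP[/IH[h0 h1] h2]; split=> // j; rewrite ltnS leq_eqVlt => /predU1P[->//|].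
  exact: h1.
move=> [h0 h1]; apply/andP; split; last exact: h1.
by apply/IH; split=> // j ji; apply: h1; rewrite (ltn_trans ji).
Qed.

(** Discrete form of the Skorokhod reflection formula. *)
Lemma lindleyE tau xi s i : 0 <= tau -> s 0%N = 0 -> (forall j, xi j = s j.+1 - s j) ->
  (lindley tau xi i).1 = s i + running_max tau s i.
Proof.
move=> tau0 s0 xiE; elim: i => [|i IH] /=; first by rewrite s0 add0r.
rewrite IH xiE -[X in Num.max _ X](subrr (s i.+1)).
have -> : s i + running_max tau s i + (s i.+1 - s i) = s i.+1 + running_max tau s i by ring.
by rewrite [in RHS]addr_maxr.
Qed.

Lemma lindley_ge0 tau xi i : 0 <= tau -> 0 <= (lindley tau xi i).1.
Proof. by move=> tau0; case: i => [//|i] /=; rewrite le_max lexx orbT. Qed.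

Lemma lindley2S tau xi i :
  (lindley tau xi i.+1).2 = (lindley tau xi i).2 + h * f (lindley tau xi i.+1).1.
Proof. by []. Qed.

End lindley.

Section selection.
Context d d' (T : measurableType d) (U : measurableType d').

Lemma measurable_fun_select (i : T -> nat) (F : nat -> T -> U) :
  (forall k, measurable (i @^-1` [set k])) ->
  (forall k, measurable_fun setT (F k)) ->
  measurable_fun setT (fun z => F (i z) z).
Proof.
move=> mi mF _ Y mY; rewrite setTI.
have -> : (fun z => F (i z) z) @^-1` Y = \bigcup_k (i @^-1` [set k] `&` F k @^-1` Y).
  apply/seteqP; split=> [z /= Fz|z [k _ [/= <-]]//].
  by exists (i z).
apply: bigcupT_measurable => k; apply: measurableI => //.
by rewrite -[X in measurable X]setTI; exact: mF.
Qed.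

End selection.

Section reflected_path.
Context (R : realType).
Implicit Types (x : R -> R) (t u e tau : R) (n : nat).

Definition reflected_path x tau t : R :=
  x t + Num.max tau (sup [set - x s | s in `[0, t]]).

Definition grid_increment x n (j : nat) : R := x (j.+1%:R / n.+1%:R) - x (j%:R / n.+1%:R).

Definition grid_state x (f : R -> R) tau n t : R * R :=
  lindley n.+1%:R^-1 f tau (grid_increment x n) (grid_index n t).

#[global] Arguments grid_state : simpl never.

(** A time [u] where [- x] almost attains its supremum is approximated from the
    right by the grid, so the maximum over the grid reaches the supremum in the
    limit. *)
Lemma cvg_grid_state1 x f tau t : cadlag x -> x 0 = 0 -> 0 <= tau -> 0 <= t ->
  (grid_state x f tau n t).1 @[n --> \oo] --> reflected_path x tau t.
Proof.
move=> cx x00 tau0 t0.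
pose s n (j : nat) := x (j%:R / n.+1%:R).
have -> : (fun n => (grid_state x f tau n t).1) =
    (fun n => x (grid_time n t) + running_max tau (s n) (grid_index n t)).
  apply/funext => n; rewrite /grid_state (lindleyE _ _ _ tau0 (s := s n))//.
  by rewrite /s mul0r.
have cxr u : 0 <= u -> x (grid_time n u) @[n --> \oo] --> x u.
  by move=> u0; apply: cvg_grid => //; exact: cx.1.
apply: cvgD; first exact: cxr.
set E := [set - x s | s in `[0, t]].
have [M HM] := cadlag_bounded t cx.
have supE : has_sup E.
  split; first by exists (- x 0), 0 => //=; rewrite in_itv/= lexx.
  exists M => _ [u /= + <-]; rewrite in_itv/= => /andP[u0 ut].
  by have /ler_normlP[] := HM u u0 ut.
have leE u : 0 <= u -> u <= t -> - x u <= sup E.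
  move=> u0 ut; apply: ub_le_sup; first exact: supE.2.
  by exists u => //=; rewrite in_itv/= u0.
apply/cvgrPdist_le => e e0.
have [u [u0 ut Hu]] : exists u, [/\ 0 <= u, u <= t & sup E - e / 2 < - x u].
  have [_ [u /= + <-]] := sup_adherent (divr_gt0 e0 (@ltr0n _ 2)) supE.
  by rewrite in_itv/= => /andP[u0 ut] ?; exists u.
have e20 : 0 < e / 2 by rewrite divr_gt0.
near=> n.
have ht : `|x t - x (grid_time n t)| <= e / 2.
  by near: n; have /cvgrPdist_le := cxr t t0; exact.
have hu : `|x u - x (grid_time n u)| <= e / 2.
  by near: n; have /cvgrPdist_le := cxr u u0; exact.
move: ht hu => /ler_normlP[ht1 ht2] /ler_normlP[hu1 hu2].
have ub : running_max tau (s n) (grid_index n t) <= Num.max tau (sup E) + e.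
  apply/running_max_le; split; first by rewrite ler_wpDr ?(ltW e0)// le_max lexx.
  move=> j; rewrite ltnS leq_eqVlt => /predU1P[->|jt].
    have := leE t t0 (lexx t); rewrite -/(grid_index n t) -/(grid_time n t) /s.
    have : sup E <= Num.max tau (sup E) by rewrite le_max lexx orbT.
    rewrite -/(grid_time n t); lra.
  rewrite ler_wpDr ?(ltW e0)// le_max; apply/orP; right; apply: leE.
    by rewrite mulr_ge0.
  by rewrite ler_pdivrMr// -truncn_ge_nat ?mulr_ge0.
have [lb1 lb2] := (running_max_le tau (s n) (grid_index n t) _).1 (lexx _).
have lb : Num.max tau (sup E) - e <= running_max tau (s n) (grid_index n t).
  rewrite lerBlDr ge_max; apply/andP; split; first by rewrite ler_wpDr ?(ltW e0).
  have := lb2 (grid_index n u).-1; rewrite /= ltnS => /(_ _) h.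
  have := h (le_truncn _); rewrite -/(grid_index n u) /s -/(grid_time n u).
  have tn : u * n.+1%:R <= t * n.+1%:R by rewrite ler_wpM2r.
  by move=> /(_ tn); lra.
by apply/ler_normlP; split; lra.
Unshelve. all: by end_near. Qed.

Lemma Rintegral_cst_itv (a b c : R) (l r : bool) : a < b ->
  (\int[lebesgue_measure]_(s in [set` Interval (BSide l a) (BSide r b)]) c)%R = c * (b - a).
Proof.
move=> ab; rewrite Rintegral_cst//; congr (_ * _).
have -> : b - a = fine (b%:E - a%:E) by rewrite -EFinB.
congr fine; have := @lebesgue_measure_itv R (Interval (BSide l a) (BSide r b)).
by rewrite /= lte_fin ab.
Qed.

Lemma integrable_bounded_itv (F : R -> R) (a b c : R) : measurable_fun setT F ->
  (forall s, `|F s| <= c) -> lebesgue_measure.-integrable `[a, b] (EFin \o F).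
Proof.
move=> mF Fc.
have ic : lebesgue_measure.-integrable `[a, b] (EFin \o cst c).
  apply: continuous_compact_integrable; first exact: segment_compact.
  by apply: continuous_subspaceT => y; exact: cst_continuous.
by apply: (integrable_le _ _ ic) => //; exact: measurable_funTS.
Qed.

Lemma measurable_grid_state x (f : R -> R) tau n : measurable_fun setT f ->
  measurable_fun setT (fun s => f (grid_state x f tau n s).1).
Proof.
move=> mf; apply: (measurable_fun_select (i := grid_index n)
  (F := fun k _ => f (lindley n.+1%:R^-1 f tau (grid_increment x n) k).1)) => //.
exact: measurable_grid_index.
Qed.

Lemma unit_norm_le1 (f : R -> R) y : (forall y, 0 <= f y <= 1) -> `|f y| <= 1.
Proof. by move=> /(_ y)/andP[h0 h1]; rewrite ger0_norm. Qed.

(** The accumulated cost is the integral of a step function of time, so that its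
    limit can be taken by dominated convergence. *)
Lemma grid_state2E x (f : R -> R) tau n (i : nat) :
  (forall y, 0 <= f y <= 1) -> measurable_fun setT f ->
  (lindley n.+1%:R^-1 f tau (grid_increment x n) i).2 =
  (\int[lebesgue_measure]_(s in `[0%R, (i%:R / n.+1%:R : R)[) f (grid_state x f tau n s).1)%R.
Proof.
move=> f01 mf; elim: i => [|i IH].
  by rewrite mul0r set_itvco0 Rintegral_set0.
rewrite lindley2S.
have mF := measurable_grid_state x tau n mf.
have ab : (i%:R / n.+1%:R : R) <= i.+1%:R / n.+1%:R by rewrite ler_wpM2r// ler_nat.
have i0 : 0 <= (i%:R / n.+1%:R : R) by rewrite mulr_ge0.
have ibig := integrable_bounded_itv 0 (i.+1%:R / n.+1%:R) mF (fun s => unit_norm_le1 _ f01).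
rewrite IH (@itv_bndbnd_setU _ _ (BLeft 0) (BLeft (i%:R / n.+1%:R)) (BLeft (i.+1%:R / n.+1%:R))) ?bnd_simp//.
rewrite Rintegral_setU//.
- congr (_ + _); transitivity (\int[lebesgue_measure]_(s in `[(i%:R / n.+1%:R : R), (i.+1%:R / n.+1%:R)[)
      f (lindley n.+1%:R^-1 f tau (grid_increment x n) i.+1).1)%R.
    rewrite Rintegral_cst_itv ?ltr_pM2r ?invr_gt0// ?ltr_nat// mulrC; congr (_ * _).
    by rewrite -mulrBl -natrB// subSnn mul1r.
  apply: eq_Rintegral => s /set_mem si.
  have /andP[h1 h2] : (i%:R / n.+1%:R <= s) && (s < i.+1%:R / n.+1%:R).
    by move: si; rewrite /= in_itv.
  by rewrite /grid_state (grid_index_interval _ h1 h2)// (le_trans i0).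
- apply: integrableS ibig => //.
    by apply: measurableU.
  move=> s /= []; rewrite !in_itv/= => /andP[h1 h2].
    by rewrite h1 (le_trans (ltW h2) ab).
  by rewrite (le_trans i0 h1) (ltW h2).
- apply/disj_setPS => s [/=]; rewrite !in_itv/= => /andP[_ h1] /andP[h2 _].
  by move: (lt_le_trans h1 h2); rewrite ltxx.
Qed.

Lemma cvg_grid_state2 x (f : R -> R) tau t : (forall y, 0 <= f y <= 1) -> continuous f ->
  cadlag x -> x 0 = 0 -> 0 <= tau -> 0 <= t ->
  (grid_state x f tau n t).2 @[n --> \oo] -->
  (\int[lebesgue_measure]_(s in `[0%R, t]) f (reflected_path x tau s))%R.
Proof.
move=> f01 cf cx x0 tau0 t0.
have mf : measurable_fun setT f by exact: continuous_measurable_fun.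
have mF n := measurable_grid_state x tau n mf.
have fn s : `|f s| <= 1 := unit_norm_le1 s f01.
have iF n b := integrable_bounded_itv 0 b (mF n) (fun s => fn _).
have [||||_ cv] := @Rintegral_dominated_cvg _ _ _ lebesgue_measure `[0%R, t] (measurable_itv _)
  (fun n s => f (grid_state x f tau n s).1) (fun s => f (reflected_path x tau s)) (cst 1).
- by move=> n; apply: measurable_funTS; exact: mF.
- move=> s /=; rewrite in_itv/= => /andP[s0 _].
  apply: (@cvg_comp _ _ _ (fun n => (grid_state x f tau n s).1) f _ (nbhs (reflected_path x tau s))).
    exact: cvg_grid_state1.
  exact: cf.
- by apply: (@integrable_bounded_itv (cst 1) 0 t 1) => // s; rewrite normr1.
- by move=> n s _; exact: fn.
apply/cvgrPdist_le => e e0.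
have e20 : 0 < e / 2 by rewrite divr_gt0.
near=> n.
have h1 : `|(\int[lebesgue_measure]_(s in `[0%R, t]) f (reflected_path x tau s))%R -
  (\int[lebesgue_measure]_(s in `[0%R, t]) f (grid_state x f tau n s).1)%R| <= e / 2.
  by near: n; have /cvgrPdist_le := cv; exact.
have hn : n.+1%:R^-1 <= e / 2.
  by near: n; have /cvgrPdist_le/(_ _ e20) := @cvg_invSn R;
    apply: filterS => n; rewrite sub0r normrN ger0_norm.
have tg := grid_time_gt n t.
rewrite {1}/grid_state grid_state2E// -/(grid_time n t).
rewrite (@itv_bndbnd_setU _ _ (BLeft 0) (BRight t) (BLeft (grid_time n t))) ?bnd_simp//.
have irem : lebesgue_measure.-integrable `]t, grid_time n t[ (EFin \o (fun s => f (grid_state x f tau n s).1)).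
  apply: integrableS (iF n (grid_time n t)) => //.
  by move=> s /=; rewrite !in_itv/= => /andP[a b]; apply/andP; split; lra.
have ione : lebesgue_measure.-integrable `]t, grid_time n t[ (EFin \o cst 1).
  apply: integrableS (@integrable_bounded_itv (cst 1) 0 (grid_time n t) 1 _ _) => //.
    by move=> s /=; rewrite !in_itv/= => /andP[a b]; apply/andP; split; lra.
  by move=> s; rewrite normr1.
have h2 : `|(\int[lebesgue_measure]_(s in `]t, grid_time n t[) f (grid_state x f tau n s).1)%R| <= n.+1%:R^-1.
  apply: (@le_trans _ _ (\int[lebesgue_measure]_(s in `]t, grid_time n t[) (cst 1 s))%R).
    by apply: Rintegral_norm_le => // s _; exact: fn.
  rewrite Rintegral_cst_itv// mul1r.
  by rewrite lerBlDl grid_time_le.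
rewrite Rintegral_setU//.
- by rewrite opprD addrA (le_trans (ler_normB _ _))// (splitr e) lerD// (le_trans h2).
- apply: integrableS (iF n (grid_time n t)) => //; first exact: measurableU.
  move=> s /= []; rewrite !in_itv/= => /andP[a b].
    by rewrite a (le_trans b (ltW tg)).
  by rewrite (le_trans t0 (ltW a)) (ltW b).
- apply/disj_setPS => s [/=]; rewrite !in_itv/= => /andP[_ a] /andP[b _].
  by move: (lt_le_trans b a); rewrite ltxx.
Unshelve. all: by end_near. Qed.

End reflected_path.

(** * Independence along a Markov recursion *)

Section markov_recursion.
Context (R : realType) d (T : measurableType d) (P : probability T R).
Context d' (E : measurableType d').
Variable xi : nat -> {mfun T >-> R}.
Variables (step : E * R -> E) (z0 : E).
Hypothesis mstep : measurable_fun setT step.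

Fixpoint chain (i : nat) : T -> E :=
  if i is j.+1 then fun w => step (chain j w, xi j w) else fun=> z0.

Lemma measurable_chain i : measurable_fun setT (chain i).
Proof.
elim: i => [|i IH] /=; first exact: measurable_cst.
by apply: measurableT_comp => //; apply: measurable_fun_pair.
Qed.

Definition box (B : nat -> set R) (i N : nat) : set T :=
  [set w | forall j, (i <= j < N)%N -> B j (xi j w)].

Lemma box_recl B i N : (i < N)%N -> box B i N = xi i @^-1` B i `&` box B i.+1 N.
Proof.
move=> iN; apply/seteqP; split=> [w H|w [Hi H] j].
  by split=> [|j /andP[ij jN]]; apply: H; rewrite ?leqnn// (ltnW ij).
move=> /andP[]; rewrite leq_eqVlt => /predU1P[<- //|ij jN].
by apply: H; rewrite ij.
Qed.

Lemma box_nil B i : box B i i = setT.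
Proof. by apply/seteqP; split=> w // _ j /andP[ij ji]; move: (leq_ltn_trans ij ji); rewrite ltnn. Qed.

Lemma measurable_box B i N : (forall j, measurable (B j)) -> measurable (box B i N).
Proof.
move=> mB; rewrite (_ : box B i N =
    \bigcap_j (if (i <= j < N)%N then xi j @^-1` B j else setT)).
  apply: bigcapT_measurable => j; case: ifPn => // _.
  by rewrite -[X in measurable X]setTI; exact: measurable_funP.
apply/seteqP; split=> w H j; first by move=> _; case: ifPn => // ij; exact: H.
by move=> ij; have := H j I; rewrite ij.
Qed.

Hypothesis xi_indep : forall (B : nat -> set R) N, (forall j, measurable (B j)) ->
  P (box B 0 N) = (\prod_(0 <= j < N) P (xi j @^-1` B j))%E.

(** Strengthened to boxes of future inputs so that induction applies: the next
    state is a function of the present state and input, and two finite measures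
    on the product agree once they agree on rectangles. *)
Lemma chain_box_indep i N (A : set E) (B : nat -> set R) : (i <= N)%N ->
  measurable A -> (forall j, measurable (B j)) ->
  P (chain i @^-1` A `&` box B i N) =
  (P (chain i @^-1` A) * \prod_(i <= j < N) P (xi j @^-1` B j))%E.
Proof.
elim: i N A B => [|i IH] N A B iN mA mB /=.
  have [zA|zA] := pselect (A z0).
    rewrite (_ : (fun=> z0) @^-1` A = setT); last by apply/seteqP; split.
    by rewrite setTI probability_setT mul1e xi_indep.
  rewrite (_ : (fun=> z0) @^-1` A = set0); last by apply/seteqP; split.
  by rewrite set0I measure0 mul0e.
pose pr w := (chain i w, xi i w).
have mpr : measurable_fun setT pr.
  by apply: measurable_fun_pair => //; exact: measurable_chain.
have mF : measurable (box B i.+1 N) by exact: measurable_box.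
pose p := fine (\prod_(i.+1 <= j < N) P (xi j @^-1` B j))%E.
have mxi j (C : set R) : measurable C -> measurable (xi j @^-1` C).
  by move=> mC; rewrite -[X in measurable X]setTI; exact: measurable_funP.
have pE : (\prod_(i.+1 <= j < N) P (xi j @^-1` B j))%E = p%:E.
  by rewrite fineK// prode_fin_num// => j _; rewrite fin_num_measure//; exact: mxi.
have p0 : 0 <= p by rewrite fine_ge0// prode_ge0.
have ext C : measurable C -> P (pr @^-1` C `&` box B i.+1 N) = (p%:E * P (pr @^-1` C))%E.
  move=> mC.
  pose m1 : {measure set (E * R) -> \bar R} := pushforward (mrestr P mF) pr.
  pose m2 : {measure set (E * R) -> \bar R} := mscale (NngNum p0) (pushforward P pr).
  suff : m1 mpr C = m2 mpr C by [].
  pose G : set (set (E * R)) := [set A `*` B | A in measurable & B in measurable].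
  apply: (measure_unique G (fun=> setT)) => //.
  - exact: measurable_prod_measurableType.
  - move=> _ _ [A1 mA1 [B1 mB1 <-]] [A2 mA2 [B2 mB2 <-]].
    rewrite -setXI; exists (A1 `&` A2); first exact: measurableI.
    by exists (B1 `&` B2) => //; exact: measurableI.
  - by move=> _; exists setT => //; exists setT => //; rewrite setXTT.
  - by rewrite bigcup_const//; exists 0%N.
  - move=> _ [A1 mA1 [B1 mB1 <-]].
    pose B' j := if j == i then B1 else B j.
    have mB' j : measurable (B' j) by rewrite /B'; case: ifP.
    have e1 : pr @^-1` (A1 `*` B1) = chain i @^-1` A1 `&` box B' i i.+1.
      rewrite box_recl// box_nil setIT /B' eqxx.
      by apply/seteqP; split.
    have e2 : pr @^-1` (A1 `*` B1) `&` box B i.+1 N = chain i @^-1` A1 `&` box B' i N.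
      rewrite (box_recl B')// /B' eqxx setIA; congr (_ `&` _).
      apply/seteqP; split=> w H j /andP[ij jN]; have := H j; rewrite ij jN /B' gtn_eqF//; exact.
    have q : (\prod_(i.+1 <= j < N) P (xi j @^-1` B' j) = p%:E)%E.
      by rewrite -pE; apply: eq_big_nat => j /andP[ij _]; rewrite /B' gtn_eqF.
    rewrite /m1 /m2 /mscale/= /pushforward/= /mrestr.
    change (P (pr @^-1` (A1 `*` B1) `&` box B i.+1 N) = (p%:E * P (pr @^-1` (A1 `*` B1)))%E).
    rewrite e2 IH// ?(ltnW iN)// big_ltn// q e1 IH// big_nat1.
    by rewrite muleA muleC.
  - move=> _; rewrite /m1 /= /pushforward/= /mrestr.
    change (P (pr @^-1` setT `&` box B i.+1 N) < +oo)%E.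
    rewrite preimage_setT setTI.
    have h1 : (P (box B i.+1 N) <= 1)%E by exact: probability_le1.
    exact: (le_lt_trans h1 (ltry 1)).
change ((fun w => step (chain i w, xi i w)) @^-1` A) with (pr @^-1` (step @^-1` A)).
have mA' : measurable (step @^-1` A).
  by rewrite -[X in measurable X]setTI; exact: mstep.
by rewrite pE (ext _ mA') muleC.
Qed.

Lemma chain_indep i (A : set E) (B : set R) : measurable A -> measurable B ->
  P (chain i @^-1` A `&` xi i @^-1` B) = (P (chain i @^-1` A) * P (xi i @^-1` B))%E.
Proof.
move=> mA mB; have := @chain_box_indep i i.+1 A (fun=> B) (leqnSn i) mA (fun=> mB).
by rewrite box_recl// box_nil setIT big_nat1.
Qed.

Lemma integral_chain_mul i (u : E -> R) (v : R -> R) :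
  measurable_fun setT u -> measurable_fun setT v ->
  (forall z, 0 <= u z) -> (forall y, 0 <= v y) ->
  (\int[P]_w (u (chain i w) * v (xi i w))%:E)%E =
  (\int[P]_w (u (chain i w))%:E * \int[P]_w (v (xi i w))%:E)%E.
Proof.
move=> mu mv u0 v0.
pose mch_mixin := isMeasurableFun.Build _ _ _ _ _ (measurable_chain i).
pose ch : {mfun T >-> E} := HB.pack (chain i) mch_mixin.
have mpr : measurable_fun setT (fun w => (chain i w, xi i w)).
  by apply: measurable_fun_pair => //; exact: measurable_chain.
pose mpr_mixin := isMeasurableFun.Build _ _ _ _ _ mpr.
pose pr : {mfun T >-> (E * R)%type} := HB.pack (fun w => (chain i w, xi i w)) mpr_mixin.
pose f (z : E * R) := ((u z.1) * (v z.2))%:E.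
have mf : measurable_fun setT f.
  apply/measurable_EFinP; apply: measurable_funM; exact: measurableT_comp.
have f0 z : (0 <= f z)%E by rewrite lee_fin mulr_ge0.
transitivity (\int[distribution P pr]_z f z)%E.
  by rewrite ge0_integral_distribution.
rewrite (eq_measure_integral (distribution P ch \x distribution P (xi i))%E); last first.
  move=> C mC _; apply/esym; apply: product_measure_unique => // A B mA mB.
  exact: chain_indep.
rewrite fubini_tonelli1//.
have mvE : measurable_fun setT (EFin \o v) by exact/measurable_EFinP.
have muE : measurable_fun setT (EFin \o u) by exact/measurable_EFinP.
have inner z : fubini_F (distribution P (xi i)) f z =
    ((u z)%:E * \int[P]_w (v (xi i w))%:E)%E.
  rewrite /fubini_F /f/=; under eq_integral do rewrite EFinM.
  rewrite (ge0_integralZl _ measurableT mvE) ?lee_fin//; last first.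
    by move=> y _; rewrite /= lee_fin.
  by congr (_ * _)%E; rewrite ge0_integral_distribution// => y; rewrite /= lee_fin.
under eq_integral do rewrite inner.
rewrite (ge0_integralZr _ measurableT muE); last 2 first.
- by move=> z _; rewrite /= lee_fin.
- by apply: integral_ge0 => w _; rewrite lee_fin.
by congr (_ * _)%E; rewrite ge0_integral_distribution// => y; rewrite /= lee_fin.
Qed.

End markov_recursion.

(** * Exponential bounds and integrals of step functions *)

Section elementary_bounds.
Context (R : realType).
Implicit Types a b c e y : R.

Lemma expRB1_ge a y : a * y <= expR (a * y) - 1.
Proof. by rewrite lerBrDl expR_ge1Dx. Qed.

(** Completing the square in [u = exp (a y) - 1] gives
    [u / a <= e u ^ 2 + 1 / (4 e a ^ 2)], and [u ^ 2 <= exp (2 a y) - 1]. *)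
Lemma expRB1_sqr_le a e y : 0 < a -> 0 < e -> 0 <= y ->
  (expR (a * y) - 1) / a <= e * (expR (2 * a * y) - 1) + (4 * e * a ^+ 2)^-1.
Proof.
move=> a0 e0 y0; have E1 : 1 <= expR (a * y) by rewrite -expR0 ler_expR mulr_ge0// ltW.
have -> : expR (2 * a * y) = expR (a * y) ^+ 2 by rewrite -expRM_natl mulrA.
set E := expR (a * y) in E1 *.
apply: (@le_trans _ _ (e * (E - 1) ^+ 2 + (4 * e * a ^+ 2)^-1)); last first.
  rewrite lerD2r ler_wpM2l//; first exact: ltW.
  nra.
rewrite -subr_ge0.
have -> : e * (E - 1) ^+ 2 + (4 * e * a ^+ 2)^-1 - (E - 1) / a =
    (2 * e * a * (E - 1) - 1) ^+ 2 / (4 * e * a ^+ 2).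
  by field; rewrite !gt_eqF.
by rewrite divr_ge0 ?sqr_ge0// !mulr_ge0// ?ltW// sqr_ge0.
Qed.

(** [(exp (a y) - 1) / a] does not depend on [a] to first order at 0; away
    from 0 the difference is dominated by a small multiple of a larger
    exponential and a constant. *)
Lemma expRB1_compare a b e : 0 < a -> 0 < b -> 0 < e ->
  exists dlt C, [/\ 0 < dlt, 0 <= C & forall y, 0 <= y ->
    `|(expR (a * y) - 1) / a - (expR (b * y) - 1) / b| <=
      e * (expR (2 * (a + b) * y) - 1) + C * (dlt < y)%R%:R].
Proof.
move=> a0 b0 e0; exists (e / 2), ((4 * e * a ^+ 2)^-1 + (4 * e * b ^+ 2)^-1).
split; [by rewrite divr_gt0| |].
  by rewrite addr_ge0// invr_ge0 !mulr_ge0 ?sqr_ge0// ltW.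
have Ca0 : 0 <= (4 * e * a ^+ 2)^-1 by rewrite invr_ge0 !mulr_ge0 ?sqr_ge0// ltW.
have Cb0 : 0 <= (4 * e * b ^+ 2)^-1 by rewrite invr_ge0 !mulr_ge0 ?sqr_ge0// ltW.
move=> y y0.
have ca : expR (2 * a * y) <= expR (2 * (a + b) * y).
  by rewrite ler_expR ler_wpM2r// ler_wpM2l// lerDl ltW.
have cb : expR (2 * b * y) <= expR (2 * (a + b) * y).
  by rewrite ler_expR ler_wpM2r// ler_wpM2l// lerDr ltW.
have pa : 0 <= (expR (a * y) - 1) / a.
  by rewrite divr_ge0 ?(ltW a0)// subr_ge0 -expR0 ler_expR mulr_ge0// ltW.
have pb : 0 <= (expR (b * y) - 1) / b.
  by rewrite divr_ge0 ?(ltW b0)// subr_ge0 -expR0 ler_expR mulr_ge0// ltW.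
(* Away from 0 each quotient is bounded separately. *)
have [ye|ye] := leP y (e / 2); last first.
  rewrite mulr1 /=.
  have := expRB1_sqr_le a0 e0 y0; have := expRB1_sqr_le b0 e0 y0 => hb ha.
  have eca : e * expR (2 * a * y) <= e * expR (2 * (a + b) * y) by rewrite ler_wpM2l// ltW.
  have ecb : e * expR (2 * b * y) <= e * expR (2 * (a + b) * y) by rewrite ler_wpM2l// ltW.
  by apply/ler_normlP; split; lra.
rewrite mulr0 addr0.
have near_y (s : R) : 0 < s -> expR (s * y) <= expR (2 * (a + b) * y) ->
    y <= (expR (s * y) - 1) / s <= y + e / 2 * (expR (2 * (a + b) * y) - 1).
  move=> s0 sc; apply/andP; split.
    by rewrite ler_pdivlMr// mulrC expRB1_ge.
  rewrite ler_pdivrMr//.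
  have := expRB1_le (mulr_ge0 (ltW s0) y0) => h.
  apply: (le_trans h).
  have E1 : 1 <= expR (s * y) by rewrite -expR0 ler_expR mulr_ge0// ltW.
  have h1 : y * (expR (s * y) - 1) <= e / 2 * (expR (2 * (a + b) * y) - 1).
    by apply: ler_pM => //; [rewrite subr_ge0|rewrite lerD2r].
  have : s * (y * (expR (s * y) - 1)) <= s * (e / 2 * (expR (2 * (a + b) * y) - 1)).
    by rewrite ler_wpM2l// ltW.
  lra.
have sa : expR (a * y) <= expR (2 * (a + b) * y).
  by rewrite ler_expR ler_wpM2r//; lra.
have sb : expR (b * y) <= expR (2 * (a + b) * y).
  by rewrite ler_expR ler_wpM2r//; lra.
have /andP[a1 a2] := near_y a a0 sa; have /andP[b1 b2] := near_y b b0 sb.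
have E1 : 1 <= expR (2 * (a + b) * y) by rewrite -expR0 ler_expR !mulr_ge0// addr_ge0// ltW.
have : 0 <= e * (expR (2 * (a + b) * y) - 1) by rewrite mulr_ge0 ?(ltW e0)// subr_ge0.
by move=> h; apply/ler_normlP; split; lra.
Qed.

Lemma cvg_nat_expRB1 (x : nat -> R) (l : R) : x n @[n --> \oo] --> l ->
  n.+1%:R * (expR (x n / n.+1%:R) - 1) @[n --> \oo] --> l.
Proof.
move=> xl; have e1 : x n / n.+1%:R @[n --> \oo] --> (0 : R).
  by rewrite -[X in _ --> X](mulr0 l); apply: cvgM => //; exact: cvg_invSn.
apply: (@squeeze_cvgr _ _ _ _ x (fun n => x n * expR (x n / n.+1%:R))).
- apply: nearW => n /=; have := expR_ge1Dx (x n / n.+1%:R); have := expR_ge1Dx (- (x n / n.+1%:R)).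
  rewrite expRN => h1 h2; apply/andP; split.
    by rewrite mulrC -ler_pdivrMr// lerBrDl.
  have : expR (x n / n.+1%:R) * (1 - x n / n.+1%:R) <= 1.
    by rewrite mulrC -ler_pdivlMr ?expR_gt0// div1r.
  have xE : x n * expR (x n / n.+1%:R) = n.+1%:R * (x n / n.+1%:R * expR (x n / n.+1%:R)).
    by rewrite !mulrA [n.+1%:R * x n]mulrC mulfK.
  move: h1 h2 xE; set X := x n / n.+1%:R => h1 h2 xE h3; rewrite xE ler_wpM2l//.
  by move: h3; rewrite mulrBr mulr1 [X * _]mulrC; set EX := _ * X; lra.
- exact: xl.
- rewrite -[X in _ --> X]mulr1 -{2}expR0; apply: cvgM => //.
  by apply: cvg_comp e1 _; exact: continuous_expR.
Qed.

End elementary_bounds.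

Section half_line.
Context (R : realType).
Local Notation mu := (@lebesgue_measure R).

Lemma ge0_integral_shift (h : R) (f : R -> \bar R) :
  measurable_fun `[h, +oo[ f -> (forall t : R, h <= t -> (0 <= f t)%E) ->
  (\int[mu]_(t in `[h, +oo[) f t = \int[mu]_(t in `[0%R, +oo[) f (t + h)%R)%E.
Proof.
move=> mf f0.
have mphi : measurable_fun [set: measurableTypeR R] (fun t : measurableTypeR R => t + h : measurableTypeR R).
  exact: measurable_funD.
pose nu : {measure set (measurableTypeR R) -> \bar R} :=
  pushforward mu (fun t : measurableTypeR R => t + h : measurableTypeR R).
have mD : measurable (`[h, +oo[%classic : set (measurableTypeR R)) by exact: measurable_itv.
transitivity (\int[nu mphi]_(t in `[h, +oo[) f t)%E.
  apply: eq_measure_integral => A mA _.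
  apply: lebesgue_measure_unique => // X /ocitvP[->|[[a b] /= ab ->]].
    by rewrite !measure0.
  rewrite /nu/= /pushforward/=.
  rewrite (_ : _ @^-1` _ = `](a - h), (b - h)]%classic).
    rewrite !lebesgue_measure_itv/= !lte_fin ltrD2r ab.
    by rewrite -!EFinB; congr EFin; ring.
  by apply/seteqP; split=> t /=; rewrite !in_itv/= ltrBlDr lerBrDr.
rewrite ge0_integral_pushforward//; last first.
  by move=> t; rewrite inE/= in_itv/= andbT; exact: f0.
rewrite (_ : _ @^-1` _ = `[0%R, +oo[%classic)//.
by apply/seteqP; split=> t /=; rewrite !in_itv/= !andbT lerDr.
Qed.

End half_line.

Section iterated_dominated_convergence.
Context (R : realType) d (T : measurableType d) (P : probability T R).
Local Notation mu := (@lebesgue_measure R).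

Lemma Rintegral_prob_cst (c : R) : (\int[P]_w c)%R = c.
Proof.
transitivity (c * fine (P setT)); first exact: Rintegral_cst.
by rewrite probability_setT mulr1.
Qed.

Lemma integral_prob_cst (c : R) : (\int[P]_w c%:E = c%:E)%E.
Proof.
transitivity (c%:E * P setT)%E; first exact: integral_cst.
by rewrite probability_setT mule1.
Qed.

Lemma iterated_dominated_cvg (U_ : nat -> R -> T -> R) (U : R -> T -> R) (C q : R) :
  0 < q ->
  (forall n t, 0 <= t -> measurable_fun setT (U_ n t)) ->
  (forall n, measurable_fun `[(0:R), +oo[ (fun t => \int[P]_w U_ n t w)%R) ->
  (forall n t w, 0 <= t -> `|U_ n t w| <= C * expR (- (q * t))) ->
  (forall t w, 0 <= t -> U_ n t w @[n --> \oo] --> U t w) ->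
  [/\ forall t, 0 <= t -> P.-integrable setT (EFin \o U t),
      mu.-integrable `[(0:R), +oo[ (fun t => (\int[P]_w U t w)%R%:E) &
      (\int[mu]_(t in `[0%R, +oo[) (\int[P]_w U_ n t w))%R @[n --> \oo] -->
      (\int[mu]_(t in `[0%R, +oo[) (\int[P]_w U t w))%R].
Proof.
move=> q0 mU mEU bU cU.
have icst (c : R) : P.-integrable setT (EFin \o cst c) by exact: finite_measure_integrable_cst.
have inner t : 0 <= t -> P.-integrable setT (EFin \o U t) /\
    (\int[P]_w U_ n t w)%R @[n --> \oo] --> (\int[P]_w U t w)%R.
  move=> t0; apply: (@Rintegral_dominated_cvg _ _ _ P setT measurableT
    (fun n => U_ n t) (U t) (cst (C * expR (- (q * t))))) => //.
  - by move=> n; exact: mU.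
  - by move=> w _; exact: cU.
  - by move=> n w _; exact: bU.
have icE : mu.-integrable `[(0:R), +oo[ (EFin \o (fun t => C * expR (- (q * t)))).
  by apply: integrable_scale => //; exact: integrable_expR_tail.
have [|||iEU cv] := @Rintegral_dominated_cvg _ _ _ mu `[0%R, +oo[ (measurable_itv _)
  (fun n t => \int[P]_w U_ n t w)%R (fun t => \int[P]_w U t w)%R
  (fun t => C * expR (- (q * t))) mEU.
- by move=> t /=; rewrite in_itv/= andbT => /inner[].
- exact: icE.
- move=> n t /=; rewrite in_itv/= andbT => t0.
  rewrite -[leRHS]Rintegral_prob_cst.
  apply: Rintegral_norm_le => //.
  - by apply: (integrable_le _ _ (icst (C * expR (- (q * t))))) => // [|w _]; [exact: mU|exact: bU].
  - exact: icst.
  - by move=> w _; exact: bU.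
by split => // t /inner[].
Qed.

End iterated_dominated_convergence.

Section step_integrals.
Context (R : realType).
Local Notation mu := (@lebesgue_measure R).
Variables (q C : R) (n : nat) (s : nat -> R).
Hypotheses (q0 : 0 < q) (s0 : forall i, 0 <= s i).
Hypothesis sC : forall i, s i <= C * expR (- (q * (i%:R / n.+1%:R))).

Lemma step_bound_ge0 : 0 <= C.
Proof. by have := le_trans (s0 0) (sC 0); rewrite pmulr_lge0 ?expR_gt0. Qed.

Lemma measurable_step (r : nat -> nat) :
  measurable_fun setT (fun t : R => s (r (grid_index n t))).
Proof.
apply: (measurable_fun_select (i := grid_index n) (F := fun k _ => s (r k))) => //.
exact: measurable_grid_index.
Qed.

Lemma step_le t : s (grid_index n t) <= C * expR (- (q * t)).
Proof.
rewrite (le_trans (sC _))// ler_wpM2l ?step_bound_ge0// ler_expR lerN2 ler_wpM2l ?ltW//.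
exact: grid_time_gt.
Qed.

Lemma integrable_step :
  mu.-integrable `[(0:R), +oo[ (EFin \o (fun t => s (grid_index n t))).
Proof.
have ic : mu.-integrable `[(0:R), +oo[ (EFin \o (fun t => C * expR (- (q * t)))).
  by apply: integrable_scale => //; exact: integrable_expR_tail.
apply: (integrable_le _ _ ic) => //; first exact: (measurable_funTS (measurable_step id)).
by move=> t _; rewrite ger0_norm// step_le.
Qed.

Lemma step_pred_le t : 0 <= t -> s (grid_index n t).-1 <= C * expR q * expR (- (q * t)).
Proof.
move=> t0; rewrite (le_trans (sC _))// -mulrA ler_wpM2l ?step_bound_ge0// -expRD ler_expR.
have h1 : n.+1%:R^-1 <= 1 :> R by rewrite invf_le1 ?ler1n.
have := grid_time_gt n t; rewrite /grid_time.
have -> : (grid_index n t)%:R / n.+1%:R = (grid_index n t).-1%:R / n.+1%:R + n.+1%:R^-1 :> R.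
  by rewrite -[in LHS](prednK (_ : 0 < grid_index n t)%N)// -natr1 mulrDl mul1r.
set u := _ / _ => h2.
rewrite lerNl opprB lerBlDr -[X in _ + X]mulr1 -mulrDr ler_wpM2l ?(ltW q0)//.
by rewrite (le_trans (ltW h2))// lerD2l.
Qed.

Lemma integrable_step_pred :
  mu.-integrable `[(0:R), +oo[ (EFin \o (fun t => s (grid_index n t).-1)).
Proof.
have ic : mu.-integrable `[(0:R), +oo[ (EFin \o (fun t => C * expR q * expR (- (q * t)))).
  by apply: integrable_scale => //; exact: integrable_expR_tail.
apply: (integrable_le _ _ ic) => //; first exact: (measurable_funTS (measurable_step predn)).
by move=> t /=; rewrite in_itv/= andbT => t0; rewrite ger0_norm// step_pred_le.
Qed.

(** Moving a step function by one mesh width; this plays the role of an index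
    shift in a sum over the grid. *)
Lemma Rintegral_step_pred :
  (\int[mu]_(t in `[0%R, +oo[) s (grid_index n t).-1)%R =
  n.+1%:R^-1 * s 0 + (\int[mu]_(t in `[0%R, +oo[) s (grid_index n t))%R.
Proof.
have h0 : 0 < n.+1%:R^-1 :> R by rewrite invr_gt0.
have t1 : (BLeft (0 : R) <= BRight n.+1%:R^-1)%O by rewrite bnd_simp ltW.
have t2 : (BRight (n.+1%:R^-1 : R) <= BInfty R false)%O by [].
rewrite -[LHS](subrK (\int[mu]_(t in `[0%R, n.+1%:R^-1]) s (grid_index n t).-1)%R).
rewrite (Rintegral_itvB integrable_step_pred t1 t2) addrC; congr (_ + _).
  rewrite -Rintegral_itv_bndo_bndc; last first.
    by apply: integrableS integrable_step_pred => //; apply: subset_itvl; rewrite bnd_simp.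
  transitivity (\int[mu]_(t in `[0%R, (n.+1%:R^-1 : R)[) s 0)%R; last first.
    by rewrite Rintegral_cst_itv// subr0 mulrC.
  apply: eq_Rintegral => t /set_mem ti.
  have /andP[t0 th] : (0 <= t) && (t < n.+1%:R^-1) by move: ti; rewrite /= in_itv.
  by rewrite (grid_index_interval (i := 0) t0)// ?mul0r// div1r.
rewrite Rintegral_itv_obnd_cbnd; last first.
  by apply: integrableS integrable_step_pred => //; apply: subset_itvr; rewrite bnd_simp// ltW.
rewrite /Rintegral ge0_integral_shift; last 2 first.
- by apply/measurable_EFinP; exact: (measurable_funTS (measurable_step predn)).
- by move=> t _; rewrite lee_fin.
congr fine; apply: eq_integral => t /set_mem ti.
have t0 : 0 <= t by move: ti; rewrite /= in_itv/= andbT.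
congr (s _)%:E.
have m0 : 0 <= t * n.+1%:R by rewrite mulr_ge0.
have /andP[k1 k2] := truncn_itv m0.
rewrite (grid_index_interval (i := grid_index n t))//.
- by rewrite addr_ge0// ltW.
- by rewrite ler_pdivrMr// mulrDl mulVf// /grid_index -[leLHS]natr1 lerD2r.
- by rewrite ltr_pdivlMr// mulrDl mulVf// -[ltRHS]natr1 ltrD2r.
Qed.

End step_integrals.

Section step_comparison.
Context (R : realType).
Local Notation mu := (@lebesgue_measure R).
Variables (q : R) (n : nat).
Hypothesis q0 : 0 < q.

Let I (r : nat -> R) : R := (\int[mu]_(t in `[0%R, +oo[) r (grid_index n t).-1)%R.
Let decays (C : R) (r : nat -> R) : Prop :=
  (forall i, 0 <= r i) /\ (forall i, r i <= C * expR (- (q * (i%:R / n.+1%:R)))).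

Lemma Rintegral_step_pred_compare (r1 r2 r3 : nat -> R) (C1 C2 C3 D a b e : R) :
  decays C1 r1 -> decays C2 r2 -> decays C3 r3 -> 0 <= D ->
  (forall i, `|r1 i / a - r2 i / b| <= e * r3 i + D * expR (- (q * (i%:R / n.+1%:R)))) ->
  `|I r1 / a - I r2 / b| <= e * I r3 + D * (expR q / q).
Proof.
move=> [p1 d1] [p2 d2] [p3 d3] D0 H.
have i1 := integrable_step_pred q0 p1 d1.
have i2 := integrable_step_pred q0 p2 d2.
have i3 := integrable_step_pred q0 p3 d3.
pose sE i : R := expR (- (q * (i%:R / n.+1%:R))).
have sE0 i : 0 <= sE i by exact: expR_ge0.
have sE1 i : sE i <= 1 * expR (- (q * (i%:R / n.+1%:R))) by rewrite mul1r.
have iE := integrable_step_pred q0 sE0 sE1.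
have j1 : mu.-integrable `[(0:R), +oo[ (EFin \o (fun t => a^-1 * r1 (grid_index n t).-1)).
  exact: integrable_scale.
have j2 : mu.-integrable `[(0:R), +oo[ (EFin \o (fun t => b^-1 * r2 (grid_index n t).-1)).
  exact: integrable_scale.
have j3 : mu.-integrable `[(0:R), +oo[ (EFin \o (fun t => e * r3 (grid_index n t).-1)).
  exact: integrable_scale.
have jE : mu.-integrable `[(0:R), +oo[ (EFin \o (fun t => D * sE (grid_index n t).-1)).
  exact: integrable_scale.
apply: (@le_trans _ _ (e * I r3 + D * (\int[mu]_(t in `[0%R, +oo[) sE (grid_index n t).-1)%R)).
  rewrite [I r1 / a]mulrC [I r2 / b]mulrC /I -!RintegralZl// -RintegralB// -RintegralD//.
  apply: Rintegral_norm_le => //.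
  - exact: (integrableB _ j1 j2).
  - exact: (integrableD _ j3 jE).
  - by move=> t _; have := H (grid_index n t).-1; rewrite mulrC [X in _ - X]mulrC.
rewrite lerD2l ler_wpM2l//.
have ie0 := integrable_expR_tail 0 q0.
have -> : expR q / q = (\int[mu]_(t in `[0%R, +oo[) (expR q * expR (- (q * t))))%R.
  by rewrite RintegralZl// Rintegral_expR_tail// mulr0 oppr0 expR0 mulr1.
apply: le_Rintegral => //; first exact: integrable_scale.
move=> t /=; rewrite in_itv/= andbT => t0.
by have := step_pred_le q0 sE0 sE1 t0; rewrite mul1r.
Qed.

End step_comparison.

(** * The killed random walk on a grid *)

Section levy_increments.
Context (R : realType) d (T : measurableType d) (P : probability T R).
Variable Y : R -> {RV P >-> R}.
Hypothesis Y0 : forall w, Y 0 w = 0.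
Hypothesis indY : independent_increments Y.
Hypothesis statY : stationary_increments Y.

Lemma measurable_grid_incr n j :
  measurable_fun setT (fun w => grid_increment (fun t => Y t w) n j).
Proof. by apply: measurable_funB; exact: measurable_funP. Qed.

Definition grid_incr n j : {mfun T >-> R} :=
  HB.pack (fun w => grid_increment (fun t => Y t w) n j)
    (isMeasurableFun.Build _ _ _ _ _ (measurable_grid_incr n j)).

Lemma grid_incr_dist n j (B : set R) : measurable B ->
  P (grid_incr n j @^-1` B) = P (Y n.+1%:R^-1 @^-1` B).
Proof.
move=> mB; have := @statY (j%:R / n.+1%:R) (j.+1%:R / n.+1%:R) _ _ B mB.
rewrite -mulrBl -natrB// subSnn mul1r => h.
transitivity (P (increment Y (j%:R / n.+1%:R) (j.+1%:R / n.+1%:R) @^-1` B)) => //.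
rewrite h ?mulr_ge0// ?ler_wpM2r ?ler_nat//.
congr (P _); apply/seteqP; split=> w /=; by rewrite /increment Y0 subr0.
Qed.

Lemma ge0_integral_grid_incr n j (g : R -> R) : measurable_fun setT g ->
  (forall y, 0 <= g y) ->
  (\int[P]_w (g (grid_incr n j w))%:E = \int[P]_w (g (Y n.+1%:R^-1 w))%:E)%E.
Proof.
move=> mg g0; have mgE : measurable_fun setT (EFin \o g) by exact/measurable_EFinP.
have g0E y : (0 <= (EFin \o g) y)%E by rewrite lee_fin.
transitivity (\int[distribution P (grid_incr n j)]_y (EFin \o g) y)%E.
  by rewrite ge0_integral_distribution.
rewrite (eq_measure_integral (distribution P (Y n.+1%:R^-1))).
  by rewrite ge0_integral_distribution.
by move=> A mA _; exact: grid_incr_dist.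
Qed.

Lemma grid_incr_indep n (B : nat -> set R) N : (forall j, measurable (B j)) ->
  P (box (grid_incr n) B 0 N) = (\prod_(0 <= j < N) P (grid_incr n j @^-1` B j))%E.
Proof.
move=> mB; pose t j : R := j%:R / n.+1%:R.
have tmono : {homo t : i j / (i <= j)%N >-> i <= j}.
  by move=> i j ij; rewrite /t ler_wpM2r// ler_nat.
have t0 : 0 <= t 0%N by rewrite /t mul0r.
have := @indY N t t0 tmono (fun i : 'I_N => B i) (fun i => mB i).
rewrite big_mkord => <-; congr (P _).
apply/seteqP; split=> w H.
  by move=> i _; exact: (H i (ltn_ord i)).
by move=> j /= jN; have := H (Ordinal jN) I.
Qed.

End levy_increments.

Section levy_exponent.
Context (R : realType) d (T : measurableType d) (P : probability T R).
Variable Y : R -> {RV P >-> R}.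
Hypothesis Y0 : forall w, Y 0 w = 0.
Hypothesis indY : independent_increments Y.
Hypothesis statY : stationary_increments Y.
Variables (a c : R).
Hypothesis Ya : (\int[P]_w (expR (- (a * Y 1 w)))%:E = (expR c)%:E)%E.

Let step (z : R * R) : R := z.1 + z.2.

Lemma chain_grid_incr n i w : chain (grid_incr Y n) step 0 i w = Y (i%:R / n.+1%:R) w.
Proof.
elim: i => [|i IH] /=; first by rewrite mul0r Y0.
by rewrite IH /step /= /grid_increment addrC subrK.
Qed.

(** By independence and stationarity the moments at the grid points of [0, 1]
    form a geometric progression, whose last term is the moment at time 1. *)
Lemma grid_incr_exp n j :
  (\int[P]_w (expR (- (a * grid_incr Y n j w)))%:E = (expR (c / n.+1%:R))%:E)%E.
Proof.
have me : measurable_fun setT (fun y : R => expR (- (a * y))) by exact: measurable_expRNM.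
have e0 (y : R) : 0 <= expR (- (a * y)) by exact: expR_ge0.
have mstep : measurable_fun setT step by exact: measurable_funD.
have rec i : (\int[P]_w (expR (- (a * Y (i.+1%:R / n.+1%:R) w)))%:E =
    \int[P]_w (expR (- (a * Y (i%:R / n.+1%:R) w)))%:E *
    \int[P]_w (expR (- (a * Y n.+1%:R^-1 w)))%:E)%E.
  rewrite -(ge0_integral_grid_incr Y0 statY n i me e0).
  under [X in (X * _)%E]eq_integral do rewrite -chain_grid_incr.
  rewrite -(@integral_chain_mul R d T P _ R (grid_incr Y n) step 0 mstep (grid_incr_indep indY n) i _ _ me me e0 e0).
  apply: eq_integral => w _; congr EFin; rewrite chain_grid_incr -expRD; congr expR.
  by rewrite /= /grid_increment; ring.
rewrite (ge0_integral_grid_incr Y0 statY n j me e0).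
set v := (\int[P]_w _)%E in rec *.
have v0 : (0 <= v)%E by apply: integral_ge0 => w _; rewrite lee_fin.
have i0 : (\int[P]_w (expR (- (a * Y (0%:R / n.+1%:R) w)))%:E = 1)%E.
  under eq_integral do rewrite mul0r Y0 mulr0 oppr0 expR0.
  exact: integral_prob_cst.
have i1 : (\int[P]_w (expR (- (a * Y (n.+1%:R / n.+1%:R) w)))%:E = (expR c)%:E)%E.
  by under eq_integral do rewrite divff//.
(* An infinite moment at the first grid point would propagate to time 1. *)
case: v v0 rec => [r|_ rec|//]; last first.
  have : forall i, (\int[P]_w (expR (- (a * Y (i.+1%:R / n.+1%:R) w)))%:E = +oo)%E.
    elim=> [|i IH]; first by rewrite rec i0 mul1e.
    by rewrite rec IH mulyy.
  by move=> /(_ n); rewrite i1.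
rewrite lee_fin => r0 rec.
have : forall i, (\int[P]_w (expR (- (a * Y (i%:R / n.+1%:R) w)))%:E = (r ^+ i)%:E)%E.
  elim=> [|i IH]; first by rewrite i0.
  by rewrite rec IH -EFinM exprSr.
move=> /(_ n.+1); rewrite i1 => -[] h; congr EFin.
apply/eqP; rewrite -(@eqrXn2 _ n.+1)// ?expR_ge0// -h -expRM_natl.
by rewrite mulrC divfK.
Qed.

End levy_exponent.

Section discretized_workload.
Context (R : realType) d (T : measurableType d) (P : probability T R).
Variable Y : R -> {RV P >-> R}.
Hypothesis Y0 : forall w, Y 0 w = 0.
Hypothesis indY : independent_increments Y.
Hypothesis statY : stationary_increments Y.
Variable phi : R -> R.
Hypothesis phiE : forall a, 0 <= a ->
  (\int[P]_w (expR (- (a * Y 1 w)))%:E = (expR (phi a))%:E)%E.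
Variables (f : R -> R) (q theta tau : R).
Hypotheses (f01 : forall y, 0 <= f y <= 1) (mf : measurable_fun setT f).
Hypotheses (q0 : 0 < q) (theta0 : 0 <= theta) (tau0 : 0 <= tau).

Definition walk n i w : R * R := lindley n.+1%:R^-1 f tau ((grid_incr Y n)^~ w) i.

Definition killing n i w : R :=
  expR (- (q * (i%:R / n.+1%:R) + theta * (walk n i w).2)).

Definition killed_exp a n i w : R := killing n i w * expR (- (a * (walk n i w).1)).

(** Growth of the regulator during one step. *)
Definition overshoot n i w : R := Num.max 0 (- ((walk n i w).1 + grid_incr Y n i w)).

Definition push_exp a n i w : R := killing n i w * (expR (a * overshoot n i w) - 1).

(** Loss through killing during the step that ends at index [i]. *)
Definition kill_exp a n i w : R :=
  killed_exp a n i w * (expR (n.+1%:R^-1 * (q + theta * f (walk n i w).1)) - 1).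

Lemma walk_chain n i w :
  walk n i w = chain (grid_incr Y n) (lindley_step n.+1%:R^-1 f) (tau, 0) i w.
Proof. by elim: i => [|i IH] //=; rewrite -IH. Qed.

Lemma measurable_lindley_step h : measurable_fun setT (lindley_step h f).
Proof.
have m1 : measurable_fun setT (fun z : (R * R) * R => Num.max (z.1.1 + z.2) 0).
  apply: measurable_maxr => //; apply: measurable_funD => //.
  exact: measurableT_comp.
apply: measurable_fun_pair => //; apply: measurable_funD.
  exact: measurableT_comp.
by apply: measurable_funM => //; exact: measurableT_comp.
Qed.

Lemma measurable_walk n i : measurable_fun setT (walk n i).
Proof.
rewrite (funext (walk_chain n i)); apply: measurable_chain.
exact: measurable_lindley_step.
Qed.

Lemma walk1_ge0 n i w : 0 <= (walk n i w).1.
Proof. exact: lindley_ge0. Qed.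

Lemma walk2_ge0 n i w : 0 <= (walk n i w).2.
Proof.
elim: i => [//|i IH]; rewrite /walk lindley2S addr_ge0// mulr_ge0//.
by have /andP[] := f01 (walk n i.+1 w).1.
Qed.

Lemma measurable_walk1 n i : measurable_fun setT (fun w => (walk n i w).1).
Proof. by apply: measurableT_comp => //; exact: measurable_walk. Qed.

Lemma measurable_walk2 n i : measurable_fun setT (fun w => (walk n i w).2).
Proof. by apply: measurableT_comp => //; exact: measurable_walk. Qed.

Lemma measurable_killing n i : measurable_fun setT (killing n i).
Proof.
apply: measurableT_comp => //; apply: measurableT_comp => //.
by apply: measurable_funD => //; apply: measurable_funM => //; exact: measurable_walk2.
Qed.

Lemma measurable_killed_exp a n i : measurable_fun setT (killed_exp a n i).
Proof.
apply: measurable_funM; first exact: measurable_killing.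
apply: (measurableT_comp (f := fun y : R => expR (- (a * y)))).
  exact: measurable_expRNM.
exact: measurable_walk1.
Qed.

Lemma measurable_kill_exp a n i : measurable_fun setT (kill_exp a n i).
Proof.
apply: measurable_funM; first exact: measurable_killed_exp.
apply: measurable_funB => //; apply: measurableT_comp => //.
apply: measurable_funM => //; apply: measurable_funD => //; apply: measurable_funM => //.
by apply: measurableT_comp => //; exact: measurable_walk1.
Qed.

Lemma killing_ge0 n i w : 0 <= killing n i w. Proof. exact: expR_ge0. Qed.

Lemma killing_le n i w : killing n i w <= expR (- (q * (i%:R / n.+1%:R))).
Proof. by rewrite ler_expR lerN2 lerDl mulr_ge0// walk2_ge0. Qed.

Lemma killed_exp_ge0 a n i w : 0 <= killed_exp a n i w.
Proof. by rewrite mulr_ge0 ?expR_ge0. Qed.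

Lemma killed_exp_le a n i w : 0 <= a ->
  killed_exp a n i w <= expR (- (q * (i%:R / n.+1%:R))).
Proof.
move=> a0; apply: le_trans (killing_le n i w); rewrite ler_piMr ?killing_ge0//.
by rewrite -[leRHS]expR0 ler_expR oppr_le0 mulr_ge0// walk1_ge0.
Qed.

Lemma kill_exp_ge0 a n i w : 0 <= kill_exp a n i w.
Proof.
rewrite mulr_ge0 ?killed_exp_ge0// subr_ge0 -[leLHS]expR0 ler_expR mulr_ge0//.
by rewrite addr_ge0 ?(ltW q0)// mulr_ge0//; have /andP[] := f01 (walk n i w).1.
Qed.

Lemma mesh_le1 n : n.+1%:R^-1 <= 1 :> R.
Proof. by rewrite invf_le1 ?ler1n. Qed.

Lemma kill_rate_bounds n y :
  0 <= n.+1%:R * (expR (n.+1%:R^-1 * (q + theta * f y)) - 1) <=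
  (q + theta) * expR (q + theta).
Proof.
have /andP[fy0 fy1] := f01 y.
have r0 : 0 <= q + theta * f y by rewrite addr_ge0 ?(ltW q0)// mulr_ge0.
have r1 : q + theta * f y <= q + theta by rewrite lerD2l ler_piMr.
have h0 : 0 <= n.+1%:R^-1 :> R by rewrite invr_ge0.
have hr0 : 0 <= n.+1%:R^-1 * (q + theta * f y) by rewrite mulr_ge0.
apply/andP; split.
  by rewrite mulr_ge0// subr_ge0 -[leLHS]expR0 ler_expR.
have := expRB1_le hr0 => h.
apply: (@le_trans _ _ (n.+1%:R * (n.+1%:R^-1 * (q + theta * f y) * expR (n.+1%:R^-1 * (q + theta * f y))))).
  by rewrite ler_wpM2l.
rewrite !mulrA mulfV// mul1r ler_pM ?expR_ge0// ler_expR.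
by rewrite (le_trans _ r1)// ler_piMl// mesh_le1.
Qed.

Lemma integrable_bounded (V : T -> R) (c : R) : measurable_fun setT V ->
  (forall w, `|V w| <= c) -> P.-integrable setT (EFin \o V).
Proof.
move=> mV Vc; have ic : P.-integrable setT (EFin \o cst c).
  exact: finite_measure_integrable_cst.
by apply: (integrable_le _ _ ic) => // w _; exact: Vc.
Qed.

Lemma integrable_killed_exp a n i : 0 <= a -> P.-integrable setT (EFin \o killed_exp a n i).
Proof.
move=> a0; apply: (integrable_bounded (c := expR (- (q * (i%:R / n.+1%:R))))).
  exact: measurable_killed_exp.
by move=> w; rewrite ger0_norm ?killed_exp_ge0// killed_exp_le.
Qed.

Lemma kill_exp_le a n i w : 0 <= a -> n.+1%:R * kill_exp a n i w <=
  (q + theta) * expR (q + theta) * expR (- (q * (i%:R / n.+1%:R))).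
Proof.
move=> a0; rewrite /kill_exp mulrCA mulrC ler_pM ?killed_exp_ge0 ?killed_exp_le//.
  by case/andP: (kill_rate_bounds n (walk n i w).1).
by case/andP: (kill_rate_bounds n (walk n i w).1).
Qed.

Lemma integrable_kill_exp a n i : 0 <= a -> P.-integrable setT (EFin \o kill_exp a n i).
Proof.
move=> a0; apply: (integrable_bounded (c := (q + theta) * expR (q + theta) * expR (- (q * (i%:R / n.+1%:R))))).
  exact: measurable_kill_exp.
move=> w; rewrite ger0_norm ?kill_exp_ge0//; apply: le_trans (kill_exp_le n i w a0).
by rewrite ler_peMl ?kill_exp_ge0// ler1n.
Qed.

Lemma killing_recl n i w : killing n i w =
  killing n i.+1 w * expR (n.+1%:R^-1 * (q + theta * f (walk n i.+1 w).1)).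
Proof.
rewrite /killing -expRD; congr expR; rewrite {2}/walk lindley2S -/(walk n i w) -/(walk n i.+1 w).
by rewrite -natr1; ring.
Qed.

(** With [y] the position before reflection, the step replaces [exp (- a y)] by
    [exp (- a (max y 0))]; the two differ only if [y < 0], and then by
    [exp (a (- y)) - 1]. *)
Lemma push_expE a n i w : push_exp a n i w =
  killed_exp a n i w * expR (- (a * grid_incr Y n i w))
  - killed_exp a n i.+1 w - kill_exp a n i.+1 w.
Proof.
set y := (walk n i w).1 + grid_incr Y n i w.
have w1 : (walk n i.+1 w).1 = Num.max y 0 by [].
have -> : killed_exp a n i w * expR (- (a * grid_incr Y n i w)) =
    killing n i w * expR (- (a * y)).
  by rewrite /killed_exp -mulrA -expRD; congr (_ * expR _); rewrite /y; ring.
have -> : killing n i w * expR (- (a * y)) - killed_exp a n i.+1 w - kill_exp a n i.+1 w =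
    killing n i w * (expR (- (a * y)) - expR (- (a * Num.max y 0))).
  rewrite /kill_exp /killed_exp w1 (killing_recl n i w) w1; ring.
rewrite /push_exp /overshoot -/y; congr (_ * _).
have [y0|y0] := leP 0 y.
  have -> : Num.max 0 (- y) = 0 by apply/max_idPl; rewrite oppr_le0.
  by rewrite mulr0 expR0 !subrr.
have -> : Num.max 0 (- y) = - y by apply/max_idPr; rewrite oppr_ge0 ltW.
by rewrite mulr0 oppr0 expR0 mulrN.
Qed.

(** The state after [i] steps is independent of the next increment. *)
Lemma integral_killed_exp_incr a n i : 0 <= a ->
  (\int[P]_w (killed_exp a n i w * expR (- (a * grid_incr Y n i w)))%:E =
   ((\int[P]_w killed_exp a n i w)%R * expR (phi a / n.+1%:R))%:E)%E.
Proof.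
move=> a0.
pose u (z : R * R) := expR (- (q * (i%:R / n.+1%:R) + theta * z.2)) * expR (- (a * z.1)).
have uE w : u (chain (grid_incr Y n) (lindley_step n.+1%:R^-1 f) (tau, 0) i w) = killed_exp a n i w.
  by rewrite -walk_chain.
under eq_integral do rewrite -uE.
rewrite (@integral_chain_mul R d T P _ (R * R)%type (grid_incr Y n) (lindley_step n.+1%:R^-1 f) (tau, 0)
  (measurable_lindley_step _) (grid_incr_indep indY n) i u (fun y => expR (- (a * y)))).
- rewrite (grid_incr_exp Y0 indY statY (phiE a0)) EFinM; congr (_ * _)%E.
  under eq_integral do rewrite uE.
  by rewrite EFin_Rintegral//; exact: integrable_killed_exp.
- apply: measurable_funM.
    apply: measurableT_comp => //; apply: measurableT_comp => //.
    by apply: measurable_funD => //; apply: measurable_funM => //.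
  by apply: (measurableT_comp (f := fun y : R => expR (- (a * y)))) => //; exact: measurable_expRNM.
- exact: measurable_expRNM.
- by move=> z; rewrite mulr_ge0 ?expR_ge0.
- by move=> y; exact: expR_ge0.
Qed.

Definition mean_exp a n i : R := (\int[P]_w killed_exp a n i w)%R.
Definition mean_push a n i : R := (\int[P]_w push_exp a n i w)%R.
Definition mean_kill a n i : R := (\int[P]_w kill_exp a n i w)%R.

(** The increments may be unbounded below, so integrability of the regulator term
    is itself read off from the one-step identity. *)
Lemma integrable_push_exp a n i : 0 <= a ->
  P.-integrable setT (EFin \o push_exp a n i) /\
  mean_push a n i = mean_exp a n i * expR (phi a / n.+1%:R) - mean_exp a n i.+1 - mean_kill a n i.+1.
Proof.
move=> a0; have i1 := integrable_killed_exp n i.+1 a0; have i2 := integrable_kill_exp n i.+1 a0.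
have i3 : P.-integrable setT (EFin \o (fun w => killed_exp a n i w * expR (- (a * grid_incr Y n i w)))).
  apply/integrableP; split.
    apply/measurable_EFinP; apply: measurable_funM; first exact: measurable_killed_exp.
    by apply: (measurableT_comp (f := fun y : R => expR (- (a * y)))) => //; exact: measurable_expRNM.
  under eq_integral => w _ do rewrite /= ger0_norm ?mulr_ge0 ?killed_exp_ge0 ?expR_ge0//.
  by rewrite integral_killed_exp_incr// ltry.
have i13 := integrableB measurableT i3 i1.
have i123 := integrableB measurableT i13 i2.
have E : push_exp a n i = (fun w => killed_exp a n i w * expR (- (a * grid_incr Y n i w))
  - killed_exp a n i.+1 w - kill_exp a n i.+1 w) by apply/funext => w; exact: push_expE.
split; first by rewrite E.
rewrite /mean_push E (RintegralB measurableT i13 i2)// (RintegralB measurableT i3 i1)//.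
by rewrite {1}/Rintegral integral_killed_exp_incr.
Qed.

Lemma overshoot_ge0 n i w : 0 <= overshoot n i w.
Proof. by rewrite le_max lexx. Qed.

Lemma push_exp_ge0 a n i w : 0 <= a -> 0 <= push_exp a n i w.
Proof.
by move=> a0; rewrite mulr_ge0 ?killing_ge0// subr_ge0 -[leLHS]expR0 ler_expR mulr_ge0 ?overshoot_ge0.
Qed.

Lemma mean_push_ge0 a n i : 0 <= a -> 0 <= mean_push a n i.
Proof. by move=> a0; apply: Rintegral_ge0 => w _; exact: push_exp_ge0. Qed.

Lemma mean_exp_ge0 a n i : 0 <= mean_exp a n i.
Proof. by apply: Rintegral_ge0 => w _; exact: killed_exp_ge0. Qed.

Lemma mean_kill_ge0 a n i : 0 <= mean_kill a n i.
Proof. by apply: Rintegral_ge0 => w _; exact: kill_exp_ge0. Qed.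

Lemma mean_exp_le a n i : 0 <= a -> mean_exp a n i <= 1 * expR (- (q * (i%:R / n.+1%:R))).
Proof.
move=> a0; rewrite mul1r -[leRHS](Rintegral_prob_cst P); apply: le_Rintegral => //.
- exact: integrable_killed_exp.
- exact: finite_measure_integrable_cst.
- by move=> w _; exact: killed_exp_le.
Qed.

End discretized_workload.

(** * The Kella-Whitt identity *)

Section workload_limit.
Context (R : realType) d (T : measurableType d) (P : probability T R).
Local Notation mu := (@lebesgue_measure R).
Variable Y : R -> {RV P >-> R}.
Hypothesis Y0 : forall w, Y 0 w = 0.
Hypothesis cY : forall w, cadlag (fun t => Y t w).
Hypothesis indY : independent_increments Y.
Hypothesis statY : stationary_increments Y.
Variable phi : R -> R.
Hypothesis phiE : forall a, 0 <= a ->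
  (\int[P]_w (expR (- (a * Y 1 w)))%:E = (expR (phi a))%:E)%E.
Hypothesis drops : forall dlt : R, 0 < dlt ->
  n.+1%:R * fine (P [set w | Y n.+1%:R^-1 w < - dlt]) @[n --> \oo] --> (0 : R).
Variables (f : R -> R) (q theta tau : R).
Hypotheses (f01 : forall y, 0 <= f y <= 1) (cf : continuous f).
Hypotheses (q0 : 0 < q) (theta0 : 0 <= theta) (tau0 : 0 <= tau).

Let mf : measurable_fun setT f. Proof. exact: continuous_measurable_fun. Qed.

Local Notation mean_exp := (mean_exp Y f q theta tau).
Local Notation mean_kill := (mean_kill Y f q theta tau).
Local Notation mean_push := (mean_push Y f q theta tau).

Definition workload t w : R := reflected_path (fun s => Y s w) tau t.

(** Discounting and killing at rate [q + theta F] along the path of the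
    workload. *)
Definition weight (F : R -> R) t w : R :=
  expR (- (q * t + theta * (\int[mu]_(s in `[0%R, t]) F (workload s w))%R)).

(** Potential of a time-dependent random quantity: the measure [nu] of the
    Kella-Whitt identity is [g |-> potential (weight F * g(workload))]. *)
Definition potential (U : R -> T -> R) : R :=
  (\int[mu]_(t in `[0%R, +oo[) (\int[P]_w U t w)%R)%R.

(** The terms of the Kella-Whitt identity other than the contribution of the
    regulator; the identity says that this is linear in [a]. *)
Definition boundary_term (F : R -> R) a : R :=
  phi a * potential (fun t w => weight F t w * expR (- (a * workload t w)))
  + expR (- (a * tau))
  - potential (fun t w => weight F t w * expR (- (a * workload t w)) * (q + theta * F (workload t w))).

Let Mk := (q + theta) * expR (q + theta).

Lemma mean_kill_le a n i : 0 <= a -> n.+1%:R * mean_kill a n i <= Mk * expR (- (q * (i%:R / n.+1%:R))).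
Proof.
move=> a0; have ik := integrable_kill_exp Y f01 mf q0 theta0 tau0 n i a0.
rewrite /mean_kill -RintegralZl// -[leRHS](Rintegral_prob_cst P); apply: le_Rintegral => //.
- exact: integrable_scale.
- exact: finite_measure_integrable_cst.
- by move=> w _; exact: kill_exp_le.
Qed.

Lemma mean_push_le a n i : 0 <= a ->
  mean_push a n i <= expR (phi a / n.+1%:R) * expR (- (q * (i%:R / n.+1%:R))).
Proof.
move=> a0; have [_ ->] := integrable_push_exp Y0 indY statY phiE f01 mf q0 theta0 tau0 n i a0.
rewrite -addrA -opprD lerBlDr ler_wpDr ?addr_ge0 ?mean_exp_ge0 ?mean_kill_ge0//.
rewrite mulrC ler_wpM2l ?expR_ge0//.
by have := mean_exp_le Y q f01 mf theta0 tau0 n i a0; rewrite mul1r.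
Qed.

Definition int_exp a n : R := (\int[mu]_(t in `[0%R, +oo[) mean_exp a n (grid_index n t))%R.
Definition int_kill a n : R := (\int[mu]_(t in `[0%R, +oo[) mean_kill a n (grid_index n t))%R.
Definition int_push a n : R := (\int[mu]_(t in `[0%R, +oo[) mean_push a n (grid_index n t).-1)%R.

Lemma mean_exp0 a n : mean_exp a n 0 = expR (- (a * tau)).
Proof.
rewrite -[RHS](Rintegral_prob_cst P); apply: eq_Rintegral => w _.
by rewrite /killed_exp /killing /= mul0r !mulr0 addr0 oppr0 expR0 mul1r.
Qed.

(** Summing the one-step identity over all steps, written as integration over
    time of the step at [grid_index]. *)
Lemma int_pushE a n : 0 <= a -> n.+1%:R * int_push a n =
  expR (phi a / n.+1%:R) * expR (- (a * tau))
  + n.+1%:R * (expR (phi a / n.+1%:R) - 1) * int_exp a n - n.+1%:R * int_kill a n.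
Proof.
move=> a0; set v := expR (phi a / n.+1%:R).
have e0 := mean_exp_ge0 Y f q theta tau a n.
have eC i := mean_exp_le Y q f01 mf theta0 tau0 n i a0.
have k0 := mean_kill_ge0 Y tau f01 q0 theta0 a n.
have kC i : mean_kill a n i <= Mk * expR (- (q * (i%:R / n.+1%:R))).
  by apply: le_trans (mean_kill_le n i a0); rewrite ler_peMl// ler1n.
have ie := integrable_step q0 e0 eC.
have iep := integrable_step_pred q0 e0 eC.
have ik := integrable_step q0 k0 kC.
have -> : int_push a n = v * (\int[mu]_(t in `[0%R, +oo[) mean_exp a n (grid_index n t).-1)%R
    - int_exp a n - int_kill a n.
  rewrite -RintegralZl// -RintegralB//; last exact: integrable_scale.
  have i1 : mu.-integrable `[(0:R), +oo[ (EFin \o (fun t => v * mean_exp a n (grid_index n t).-1)).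
    exact: integrable_scale.
  rewrite -RintegralB//; last exact: (integrableB _ i1 ie).
  apply: eq_Rintegral => t _.
  have [_ ->] := integrable_push_exp Y0 indY statY phiE f01 mf q0 theta0 tau0 n (grid_index n t).-1 a0.
  by rewrite -/v [v * _]mulrC.
rewrite (Rintegral_step_pred q0 e0 eC) mean_exp0 -/(int_exp a n).
rewrite 2!mulrBr mulrDr mulrDr !mulrA [n.+1%:R * v]mulrC mulfK//.
ring.
Qed.

Lemma cvg_workload t w : 0 <= t -> (walk Y f tau n (grid_index n t) w).1 @[n --> \oo] --> workload t w.
Proof. by move=> t0; apply: cvg_grid_state1. Qed.

Lemma cvg_killing t w : 0 <= t ->
  killing Y f q theta tau n (grid_index n t) w @[n --> \oo] --> weight f t w.
Proof.
move=> t0; apply: (@cvg_comp _ _ _ (fun n => - (q * grid_time n t + theta * (grid_state (fun s => Y s w) f tau n t).2))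
    expR _ (nbhs (- (q * t + theta * (\int[mu]_(s in `[0%R, t]) f (workload s w))%R)))); last exact: continuous_expR.
apply: cvgN; apply: cvgD; apply: cvgMr; first exact: cvg_grid_time.
exact: cvg_grid_state2.
Qed.

Lemma cvg_killed_exp a t w : 0 <= t ->
  killed_exp Y f q theta tau a n (grid_index n t) w @[n --> \oo] --> weight f t w * expR (- (a * workload t w)).
Proof.
move=> t0; apply: cvgM; first exact: cvg_killing.
apply: (@cvg_comp _ _ _ (fun n => - (a * (walk Y f tau n (grid_index n t) w).1))
    expR _ (nbhs (- (a * workload t w)))); last exact: continuous_expR.
by apply: cvgN; apply: cvgMr; exact: cvg_workload.
Qed.

Lemma cvg_kill_exp a t w : 0 <= t ->
  n.+1%:R * kill_exp Y f q theta tau a n (grid_index n t) w @[n --> \oo] -->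
  weight f t w * expR (- (a * workload t w)) * (q + theta * f (workload t w)).
Proof.
move=> t0; rewrite /kill_exp; under eq_fun do rewrite mulrCA.
apply: cvgM; first exact: cvg_killed_exp.
under eq_fun do rewrite [X in expR X]mulrC.
apply: (@cvg_nat_expRB1 R (fun n => q + theta * f (walk Y f tau n (grid_index n t) w).1)).
apply: cvgD; first exact: cvg_cst.
apply: cvgMr; apply: (@cvg_comp _ _ _ (fun n => (walk Y f tau n (grid_index n t) w).1) f _ (nbhs (workload t w))).
  exact: cvg_workload.
exact: cf.
Qed.

Lemma limit_killed_exp a : 0 <= a ->
  [/\ forall t, 0 <= t -> P.-integrable setT
        (EFin \o (fun w => weight f t w * expR (- (a * workload t w)))),
      mu.-integrable `[(0:R), +oo[
        (fun t => (\int[P]_w (weight f t w * expR (- (a * workload t w))))%R%:E) &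
      int_exp a n @[n --> \oo] -->
        potential (fun t w => weight f t w * expR (- (a * workload t w)))].
Proof.
move=> a0; apply: (@iterated_dominated_cvg R d T P
  (fun n t => killed_exp Y f q theta tau a n (grid_index n t))
  (fun t w => weight f t w * expR (- (a * workload t w))) 1 q q0).
- by move=> n t t0; exact: measurable_killed_exp.
- by move=> n; apply: measurable_funTS; exact: (measurable_step n (mean_exp a n) id).
- move=> n t w t0; rewrite ger0_norm ?killed_exp_ge0// mul1r.
  rewrite (le_trans (killed_exp_le Y q f01 theta0 tau0 _ _ _ a0))//.
  by rewrite ler_expR lerN2 ler_wpM2l ?(ltW q0)//; exact/ltW/grid_time_gt.
- by move=> t w t0; exact: cvg_killed_exp.
Qed.

Lemma limit_kill_exp a : 0 <= a ->
  [/\ forall t, 0 <= t -> P.-integrable setT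
        (EFin \o (fun w => weight f t w * expR (- (a * workload t w)) * (q + theta * f (workload t w)))),
      mu.-integrable `[(0:R), +oo[
        (fun t => (\int[P]_w (weight f t w * expR (- (a * workload t w)) *
                              (q + theta * f (workload t w))))%R%:E) &
      n.+1%:R * int_kill a n @[n --> \oo] -->
        potential (fun t w => weight f t w * expR (- (a * workload t w)) * (q + theta * f (workload t w)))].
Proof.
move=> a0.
have ik n i := integrable_kill_exp Y f01 mf q0 theta0 tau0 n i a0.
have -> : (fun n => n.+1%:R * int_kill a n) = (fun n => \int[mu]_(t in `[0%R, +oo[)
   (\int[P]_w (n.+1%:R * kill_exp Y f q theta tau a n (grid_index n t) w)))%R.
  apply/funext => n; rewrite /int_kill -RintegralZl//; last first.
    have k0 := mean_kill_ge0 Y tau f01 q0 theta0 a n.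
    have kC i : mean_kill a n i <= Mk * expR (- (q * (i%:R / n.+1%:R))).
      by apply: le_trans (mean_kill_le n i a0); rewrite ler_peMl// ler1n.
    exact: (integrable_step q0 k0 kC).
  by apply: eq_Rintegral => t _; rewrite /mean_kill RintegralZl.
apply: (@iterated_dominated_cvg R d T P
  (fun n t w => n.+1%:R * kill_exp Y f q theta tau a n (grid_index n t) w)
  (fun t w => weight f t w * expR (- (a * workload t w)) * (q + theta * f (workload t w))) Mk q q0).
- by move=> n t t0; apply: measurable_funM => //; exact: measurable_kill_exp.
- move=> n; apply: measurable_funTS.
  exact: (measurable_step n (fun i => \int[P]_w (n.+1%:R * kill_exp Y f q theta tau a n i w))%R id).
- move=> n t w t0; rewrite (ger0_norm (mulr_ge0 (ler0n _ _) (kill_exp_ge0 Y tau f01 q0 theta0 _ _ _ _))).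
  rewrite (le_trans (kill_exp_le Y f01 q0 theta0 tau0 _ _ _ a0))//.
  rewrite ler_wpM2l ?mulr_ge0 ?expR_ge0 ?addr_ge0 ?(ltW q0)//.
  by rewrite ler_expR lerN2 ler_wpM2l ?(ltW q0)//; exact/ltW/grid_time_gt.
- by move=> t w t0; exact: cvg_kill_exp.
Qed.

(** In [int_pushE] the factor [(n + 1) (exp (phi a / (n + 1)) - 1)] tends to
    [phi a], and the killing loss per unit of time to [q + theta f]. *)
Lemma cvg_int_push a : 0 <= a -> n.+1%:R * int_push a n @[n --> \oo] --> boundary_term f a.
Proof.
move=> a0; under eq_fun do rewrite int_pushE//.
rewrite (_ : boundary_term f a = expR 0 * expR (- (a * tau))
  + phi a * potential (fun t w => weight f t w * expR (- (a * workload t w)))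
  - potential (fun t w => weight f t w * expR (- (a * workload t w)) * (q + theta * f (workload t w)))); last first.
  by rewrite /boundary_term expR0 mul1r; congr (_ - _); rewrite addrC.
apply: cvgB; last by have [] := limit_kill_exp a0.
apply: cvgD.
  have c0 : phi a / n.+1%:R @[n --> \oo] --> (0 : R).
    by rewrite -[X in _ --> X](mulr0 (phi a)); apply: cvgMr; exact: cvg_invSn.
  by apply: cvgMl; apply: cvg_comp c0 _; exact: continuous_expR.
apply: cvgM; last by have [] := limit_killed_exp a0.
by apply: cvg_nat_expRB1; exact: cvg_cst.
Qed.

Lemma boundary_term0 : boundary_term f 0 = 0.
Proof.
have e n : n.+1%:R * int_push 0 n = 0.
  rewrite /int_push; under eq_Rintegral => t _.
    rewrite /mean_push; under eq_Rintegral do rewrite /push_exp mul0r expR0 subrr mulr0.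
    rewrite Rintegral_prob_cst; over.
  by rewrite /Rintegral integral0 mulr0.
have := cvg_int_push (lexx 0); under eq_fun do rewrite e.
by move=> /cvg_lim <-//; rewrite lim_cst.
Qed.

Definition drop_prob n (dlt : R) : R := fine (P [set w | Y n.+1%:R^-1 w < - dlt]).

(** By [expRB1_compare] the regulator terms at [a] and [b], divided by [a] and
    [b], differ by a small multiple of the term at [2 (a + b)] unless the
    overshoot exceeds [dlt]. As the walk is nonnegative, the latter forces an
    increment below [- dlt]. *)
Lemma mean_push_compare a b e : 0 < a -> 0 < b -> 0 < e ->
  exists dlt C, [/\ 0 < dlt, 0 <= C & forall n i,
    `|mean_push a n i / a - mean_push b n i / b| <=
      e * mean_push (2 * (a + b)) n i + C * drop_prob n dlt * expR (- (q * (i%:R / n.+1%:R)))].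
Proof.
move=> a0 b0 e0; have [dlt [C [dlt0 C0 H]]] := expRB1_compare a0 b0 e0.
exists dlt, C; split=> // n i.
have c0 : 0 <= 2 * (a + b) by rewrite mulr_ge0// addr_ge0 ?ltW.
have ip s : 0 <= s -> P.-integrable setT (EFin \o push_exp Y f q theta tau s n i).
  by move=> s0; have [] := integrable_push_exp Y0 indY statY phiE f01 mf q0 theta0 tau0 n i s0.
have ia := ip a (ltW a0); have ib := ip b (ltW b0); have ic := ip _ c0.
pose B w : R := (grid_incr Y n i w < - dlt)%R%:R.
have mset : measurable [set w | grid_incr Y n i w < - dlt].
  rewrite (_ : [set _ | _] = grid_incr Y n i @^-1` `]-oo, - dlt[).
    by rewrite -[X in measurable X]setTI; exact: measurable_funP.
  by apply/seteqP; split=> w /=; rewrite in_itv.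
have BE : B = \1_[set w | grid_incr Y n i w < - dlt].
  by apply/funext => w; rewrite indicE /B; congr (nat_of_bool _)%:R; apply/idP/idP; rewrite inE.
have mB : measurable_fun setT B by rewrite BE; exact: measurable_indic.
have iB : P.-integrable setT (EFin \o B).
  by apply: (@integrable_bounded R d T P B 1) => // w; exact: bool_norm_le1.
have EB : (\int[P]_w B w)%R = drop_prob n dlt.
  rewrite BE /Rintegral integral_indic// setIT; congr fine.
  have -> : [set w | grid_incr Y n i w < - dlt] = grid_incr Y n i @^-1` `]-oo, - dlt[.
    by apply/seteqP; split=> w /=; rewrite in_itv.
  apply: (etrans (grid_incr_dist Y0 statY n i (measurable_itv `]-oo, - dlt[))).
  by congr (P _); apply/seteqP; split=> w /=; rewrite in_itv.
set E := expR (- (q * (i%:R / n.+1%:R))).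
have iae : P.-integrable setT (EFin \o (fun w => push_exp Y f q theta tau a n i w / a)).
  by under [X in _.-integrable _ (EFin \o X)]eq_fun do rewrite mulrC; exact: integrable_scale.
have ibe : P.-integrable setT (EFin \o (fun w => push_exp Y f q theta tau b n i w / b)).
  by under [X in _.-integrable _ (EFin \o X)]eq_fun do rewrite mulrC; exact: integrable_scale.
have ice : P.-integrable setT (EFin \o (fun w => e * push_exp Y f q theta tau (2 * (a + b)) n i w)).
  exact: integrable_scale.
have iBe : P.-integrable setT (EFin \o (fun w => (C * E) * B w)) by exact: integrable_scale.
rewrite /mean_push -!RintegralZr// -RintegralB// -(RintegralZl e)//.
have -> : C * drop_prob n dlt * E = (\int[P]_w ((C * E) * B w))%R.
  by rewrite RintegralZl// EB; ring.
rewrite -RintegralD//; apply: Rintegral_norm_le => //.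
- exact: (integrableB measurableT iae ibe).
- exact: (integrableD measurableT ice iBe).
move=> w _; set y := overshoot Y f tau n i w.
have y0 : 0 <= y by exact: overshoot_ge0.
have K0 : 0 <= killing Y f q theta tau n i w by exact: killing_ge0.
have KE : killing Y f q theta tau n i w <= E by exact: killing_le.
rewrite /push_exp; move: (killing Y f q theta tau n i w) K0 KE => K K0 KE; rewrite -/y.
have -> : K * (expR (a * y) - 1) / a - K * (expR (b * y) - 1) / b =
    K * ((expR (a * y) - 1) / a - (expR (b * y) - 1) / b) by ring.
rewrite normrM (ger0_norm K0).
rewrite (le_trans (ler_wpM2l K0 (H y y0)))// mulrDr lerD//; first by rewrite mulrCA.
rewrite mulrCA -[leRHS]mulrA ler_wpM2l// ler_pM//.
rewrite /B ler_nat; have [//|ydlt] := leP y dlt.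
have := ydlt; rewrite /y /overshoot lt_max ltNge (ltW dlt0)/= ltrNr => h.
by rewrite (le_lt_trans _ h)// lerDr; exact: (walk1_ge0 Y f tau0).
Qed.

Lemma int_push_compare a b e : 0 < a -> 0 < b -> 0 < e ->
  exists dlt C, 0 < dlt /\ forall n,
    `|int_push a n / a - int_push b n / b| <=
      e * int_push (2 * (a + b)) n + C * drop_prob n dlt.
Proof.
move=> a0 b0 e0; have [dlt [C [dlt0 C0 H]]] := mean_push_compare a0 b0 e0.
exists dlt, (C * (expR q / q)); split=> // n.
have c0 : 0 <= 2 * (a + b) by rewrite mulr_ge0// addr_ge0 ?ltW.
have bd s (s0 : 0 <= s) := conj (fun i => mean_push_ge0 Y f q theta tau n i s0)
  (fun i => mean_push_le n i s0).
have D0 : 0 <= C * drop_prob n dlt by rewrite mulr_ge0// fine_ge0.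
rewrite mulrAC; apply: (Rintegral_step_pred_compare q0 (bd a (ltW a0)) (bd b (ltW b0)) (bd _ c0) D0).
exact: H.
Qed.

(** The comparison error is a small multiple of a convergent sequence plus a
    multiple of [(n + 1) P(increment < - dlt)], which vanishes in the limit. *)
Lemma boundary_term_linear a b : 0 < a -> 0 < b -> boundary_term f a / a = boundary_term f b / b.
Proof.
move=> a0 b0; apply/eqP; rewrite -subr_eq0 -normr_le0; apply/ler_addgt0Pr => e e0; rewrite add0r.
have c0 : 0 <= 2 * (a + b) by rewrite mulr_ge0// addr_ge0 ?ltW.
set K := boundary_term f (2 * (a + b)).
have K0 : 0 < `|K| + 1 by rewrite ltr_wpDl.
have e'0 : 0 < e / (`|K| + 1) by rewrite divr_gt0.
have [dlt [C [dlt0 H]]] := int_push_compare a0 b0 e'0.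
have h1 : `|n.+1%:R * int_push a n / a - n.+1%:R * int_push b n / b| @[n --> \oo] -->
    `|boundary_term f a / a - boundary_term f b / b|.
  by apply: cvg_norm; apply: cvgB; apply: cvgMl; apply: cvg_int_push; exact: ltW.
have h2 : e / (`|K| + 1) * (n.+1%:R * int_push (2 * (a + b)) n) + C * (n.+1%:R * drop_prob n dlt)
   @[n --> \oo] --> e / (`|K| + 1) * K + C * 0.
  apply: cvgD; apply: cvgMr; first exact: cvg_int_push.
  exact: drops.
have le12 : `|boundary_term f a / a - boundary_term f b / b| <= e / (`|K| + 1) * K + C * 0.
  apply: (ler_cvg_to h1 h2); apply: nearW => n.
  have -> : n.+1%:R * int_push a n / a - n.+1%:R * int_push b n / b =
    n.+1%:R * (int_push a n / a - int_push b n / b) by rewrite mulrBr !mulrA.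
  have -> : e / (`|K| + 1) * (n.+1%:R * int_push (2 * (a + b)) n) + C * (n.+1%:R * drop_prob n dlt) =
    n.+1%:R * (e / (`|K| + 1) * int_push (2 * (a + b)) n + C * drop_prob n dlt).
    by rewrite [RHS]mulrDr; congr (_ + _); rewrite mulrCA.
  by rewrite normrM normr_nat ler_wpM2l.
apply: (le_trans le12); rewrite mulr0 addr0 -mulrA ler_piMr ?(ltW e0)//.
rewrite mulrC ler_pdivrMr// mul1r (le_trans (ler_norm _))// lerDl//.
Qed.

End workload_limit.

Lemma cvg_seq_eq (R : realType) (u v : nat -> R) (l m : R) :
  u n @[n --> \oo] --> l -> v n @[n --> \oo] --> m -> u =1 v -> l = m.
Proof. by move=> ul + uv; rewrite -(funext uv) => /cvg_lim <-//; rewrite (cvg_lim _ ul). Qed.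

Section sharp_killing.
Context (R : realType) d (T : measurableType d) (P : probability T R).
Local Notation mu := (@lebesgue_measure R).
Variable Y : R -> {RV P >-> R}.
Hypothesis Y0 : forall w, Y 0 w = 0.
Hypothesis cY : forall w, cadlag (fun t => Y t w).
Hypothesis indY : independent_increments Y.
Hypothesis statY : stationary_increments Y.
Variable phi : R -> R.
Hypothesis phiE : forall a, 0 <= a ->
  (\int[P]_w (expR (- (a * Y 1 w)))%:E = (expR (phi a))%:E)%E.
Hypothesis drops : forall dlt : R, 0 < dlt ->
  n.+1%:R * fine (P [set w | Y n.+1%:R^-1 w < - dlt]) @[n --> \oo] --> (0 : R).
Variables (q theta tau : R).
Hypotheses (q0 : 0 < q) (theta0 : 0 <= theta) (tau0 : 0 <= tau).

Local Notation workload := (workload Y tau).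
Local Notation weight := (weight Y q theta tau).
Local Notation potential := (potential P).
Local Notation boundary_term := (boundary_term Y phi q theta tau).

(** Continuous functions decreasing to the indicator of [x <= tau], because
    [x - tau + |x - tau|] vanishes exactly there. *)
Definition ramp n (x : R) : R := expR (- (n%:R * (x - tau + `|x - tau|))).

Definition below (x : R) : R := (x <= tau)%R%:R.

Lemma ramp01 n x : 0 <= ramp n x <= 1.
Proof.
rewrite expR_ge0/= -[leRHS]expR0 ler_expR oppr_le0 mulr_ge0//.
by rewrite -lerBlDl sub0r -normrN ler_norm.
Qed.

Lemma below01 x : 0 <= below x <= 1.
Proof. by rewrite /below; case: (x <= tau); rewrite ?lexx ?ler01. Qed.

Lemma continuous_ramp n : continuous (ramp n).
Proof.
move=> x; have h : y - tau @[y --> x] --> x - tau by apply: cvgB => //; exact: cvg_cst.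
have h2 : - (n%:R * (y - tau + `|y - tau|)) @[y --> x] --> - (n%:R * (x - tau + `|x - tau|)).
  by apply: cvgN; apply: cvgMr; apply: cvgD => //; exact: cvg_norm.
by apply: cvg_comp h2 _; exact: continuous_expR.
Qed.

Lemma cvg_ramp x : ramp n x @[n --> \oo] --> below x.
Proof.
rewrite /below; have [xt|tx] := leP x tau.
  apply: cvg_near_cst; apply: nearW => n; rewrite /ramp.
  by rewrite ler0_norm ?subr_le0// subrr mulr0 oppr0 expR0.
by apply: cvg_expRN_nat; rewrite gtr0_norm ?subr_gt0// addr_gt0 ?subr_gt0.
Qed.

Lemma measurable_workload t : 0 <= t -> measurable_fun setT (workload t).
Proof.
move=> t0; apply: (measurable_fun_cvg (h := fun n w => (walk Y (ramp 0) tau n (grid_index n t) w).1)).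
  move=> n; apply: measurable_walk1; apply: continuous_measurable_fun; exact: continuous_ramp.
by move=> w _; exact: cvg_workload.
Qed.

Lemma workload_ge0 t w : 0 <= t -> 0 <= workload t w.
Proof.
move=> t0.
have h : (walk Y (ramp 0) tau n (grid_index n t) w).1 @[n --> \oo] --> workload t w.
  exact: cvg_workload.
apply: (cvgr_to_ge h); by apply: nearW => n; exact: walk1_ge0.
Qed.

Lemma measurable_workload_path w : measurable_fun `[(0:R), +oo[ (fun t => workload t w).
Proof.
apply: (measurable_fun_cvg (h := fun n t => (walk Y (ramp 0) tau n (grid_index n t) w).1)).
  move=> n; apply: measurable_funTS.
  apply: (measurable_fun_select (i := grid_index n) (F := fun k _ => (walk Y (ramp 0) tau n k w).1)) => //.
  exact: measurable_grid_index.
by move=> t; rewrite /= in_itv/= andbT => t0; exact: cvg_workload.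
Qed.

Lemma cvg_weight t w : 0 <= t -> weight (ramp n) t w @[n --> \oo] --> weight below t w.
Proof.
move=> t0; have [||||_ cv] := @Rintegral_dominated_cvg _ _ _ mu `[0%R, t] (measurable_itv _)
  (fun n s => ramp n (workload s w)) (fun s => below (workload s w)) (cst 1).
- move=> n; apply: measurableT_comp.
    by apply: continuous_measurable_fun; exact: continuous_ramp.
  apply: measurable_funS (measurable_workload_path w) => //.
  by move=> s; rewrite /= !in_itv/= andbT => /andP[].
- by move=> s _; exact: cvg_ramp.
- by apply: (@integrable_bounded_itv R (cst 1) 0 t 1) => // s; rewrite normr1.
- by move=> n s _; exact: (unit_norm_le1 _ (ramp01 n)).
have h : - (q * t + theta * (\int[mu]_(s in `[0%R, t]) ramp n (workload s w))%R) @[n --> \oo] -->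
    - (q * t + theta * (\int[mu]_(s in `[0%R, t]) below (workload s w))%R).
  by apply: cvgN; apply: cvgD; [exact: cvg_cst|exact: cvgMr].
by apply: cvg_comp h _; exact: continuous_expR.
Qed.

Lemma weight_ge0 F t w : 0 <= weight F t w. Proof. exact: expR_ge0. Qed.

Lemma weight_le (F : R -> R) t w : (forall x, 0 <= F x) -> weight F t w <= expR (- (q * t)).
Proof.
move=> F0; rewrite ler_expR lerN2 lerDl mulr_ge0//; apply: Rintegral_ge0 => s _.
exact: F0.
Qed.

Lemma weight_exp_bound (F : R -> R) a t w : (forall x, 0 <= F x) -> 0 <= a -> 0 <= t ->
  `|weight F t w * expR (- (a * workload t w))| <= 1 * expR (- (q * t)).
Proof.
move=> F0 a0 t0; rewrite ger0_norm ?mulr_ge0 ?expR_ge0// mul1r.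
apply: le_trans (weight_le t w F0); rewrite ler_piMr ?weight_ge0//.
by rewrite -[leRHS]expR0 ler_expR oppr_le0 mulr_ge0// workload_ge0.
Qed.

Lemma weight_kill_bound (F : R -> R) a t w : (forall x, 0 <= F x <= 1) -> 0 <= a -> 0 <= t ->
  `|weight F t w * expR (- (a * workload t w)) * (q + theta * F (workload t w))| <=
  (q + theta) * expR (- (q * t)).
Proof.
move=> F01 a0 t0; have /andP[F0 F1] := F01 (workload t w).
have F0' x : 0 <= F x by have /andP[] := F01 x.
rewrite normrM mulrC ler_pM//.
  rewrite ger0_norm; first by rewrite lerD2l ler_piMr.
  by rewrite addr_ge0 ?(ltW q0)// mulr_ge0.
by have := weight_exp_bound w F0' a0 t0; rewrite mul1r.
Qed.

Lemma cvg_potential_exp a : 0 <= a ->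
  potential (fun t w => weight (ramp n) t w * expR (- (a * workload t w))) @[n --> \oo] -->
  potential (fun t w => weight below t w * expR (- (a * workload t w))).
Proof.
move=> a0; have L n := limit_killed_exp Y0 cY (ramp01 n) (@continuous_ramp n) q0 theta0 tau0 a0.
have [||||_ _] := @iterated_dominated_cvg R d T P
  (fun n t w => weight (ramp n) t w * expR (- (a * workload t w)))
  (fun t w => weight below t w * expR (- (a * workload t w))) 1 q q0.
- by move=> n t t0; have [/(_ t t0)/measurable_int/measurable_EFinP] := L n.
- by move=> n; have [_ /measurable_int/measurable_EFinP] := L n.
- by move=> n t w t0; apply: weight_exp_bound => // x; have /andP[] := ramp01 n x.
- by move=> t w t0; apply: cvgMl; exact: cvg_weight.
exact.
Qed.

Lemma cvg_potential_kill a : 0 <= a ->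
  potential (fun t w => weight (ramp n) t w * expR (- (a * workload t w)) * (q + theta * ramp n (workload t w)))
   @[n --> \oo] -->
  potential (fun t w => weight below t w * expR (- (a * workload t w)) * (q + theta * below (workload t w))).
Proof.
move=> a0; have L n := limit_kill_exp Y0 cY (ramp01 n) (@continuous_ramp n) q0 theta0 tau0 a0.
have [||||_ _] := @iterated_dominated_cvg R d T P
  (fun n t w => weight (ramp n) t w * expR (- (a * workload t w)) * (q + theta * ramp n (workload t w)))
  (fun t w => weight below t w * expR (- (a * workload t w)) * (q + theta * below (workload t w)))
  (q + theta) q q0.
- by move=> n t t0; have [/(_ t t0)/measurable_int/measurable_EFinP] := L n.
- by move=> n; have [_ /measurable_int/measurable_EFinP] := L n.
- by move=> n t w t0; apply: weight_kill_bound => // x; exact: ramp01.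
- move=> t w t0; apply: cvgM; first by apply: cvgMl; exact: cvg_weight.
  by apply: cvgD; [exact: cvg_cst|apply: cvgMr; exact: cvg_ramp].
exact.
Qed.

Lemma cvg_boundary_term a : 0 <= a -> boundary_term (ramp n) a @[n --> \oo] --> boundary_term below a.
Proof.
move=> a0; apply: cvgB; last exact: cvg_potential_kill.
by apply: cvgD; [apply: cvgMr; exact: cvg_potential_exp|exact: cvg_cst].
Qed.

Lemma boundary_term_below0 : boundary_term below 0 = 0.
Proof.
have := cvg_boundary_term (lexx 0).
under eq_fun => n do rewrite (boundary_term0 Y0 cY indY statY phiE (ramp01 n) (@continuous_ramp n) q0 theta0 tau0).
by move=> /cvg_lim <-//; rewrite lim_cst.
Qed.

Lemma boundary_term_below_linear a b : 0 < a -> 0 < b ->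
  boundary_term below a / a = boundary_term below b / b.
Proof.
move=> a0 b0.
have ha : boundary_term (ramp n) a / a @[n --> \oo] --> boundary_term below a / a.
  by apply: cvgMl; apply: cvg_boundary_term; exact: ltW.
have hb : boundary_term (ramp n) b / b @[n --> \oo] --> boundary_term below b / b.
  by apply: cvgMl; apply: cvg_boundary_term; exact: ltW.
apply: (cvg_seq_eq ha hb) => n.
exact: (boundary_term_linear Y0 cY indY statY phiE drops (ramp01 n) (@continuous_ramp n) q0 theta0 tau0 a0 b0).
Qed.

End sharp_killing.

(** * Mass of the killed workload *)

Section time_sample_measure.
Context (R : realType) d (T : measurableType d) (P : probability T R).
Local Notation mu := (@lebesgue_measure R).

(** A name of its own, so that the product of time and sample space can carry a
    proof of sigma-finiteness. *)
Definition time_sample_measure : set (measurableTypeR R * T) -> \bar R := (mu \x P)%E.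

HB.instance Definition _ := Measure.on time_sample_measure.

Let time_sample_sigma_finite : sigma_finite setT time_sample_measure.
Proof.
have /sigma_finiteP[F [TF ndF Foo]] := sigma_finiteT mu.
exists (fun n => F n `*` setT).
  by rewrite -setX_bigcupl -TF setXTT.
move=> k; have [? ?] := Foo k; split; first exact: measurableX.
rewrite /time_sample_measure product_measure1E// lte_mul_pinfty//.
  by rewrite ge0_fin_numE.
by apply: (@le_lt_trans _ _ 1%E); [exact: sprobability_setT|exact: ltry].
Qed.

HB.instance Definition _ :=
  Measure_isSigmaFinite.Build _ _ _ time_sample_measure time_sample_sigma_finite.

End time_sample_measure.

Section time_sample_product.
Context (R : realType) d (T : measurableType d) (P : probability T R).
Local Notation mu := (@lebesgue_measure R).
Local Notation m := (mu \x P)%E.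
Implicit Types (V : R -> T -> R) (z : measurableTypeR R * T).

(** A process on [0, +oo[ as a function on time and sample space, extended by 0
    to negative times. *)
Definition uncurry_pos V z : R := (0 <= z.1)%R%:R * V z.1 z.2.

Lemma measurable_pos : measurable_fun [set: measurableTypeR R * T] (fun z => (0 <= z.1)%R%:R : R).
Proof.
rewrite (_ : (fun _ => _) = fun z => \1_`[0, +oo[ z.1).
  apply: measurableT_comp => //; exact: measurable_indic.
by apply/funext => z; rewrite indicE mem_setE in_itv/= andbT.
Qed.

Lemma measurable_uncurry_grid V (F : nat -> nat -> T -> R) :
  (forall n k, measurable_fun setT (F n k)) ->
  (forall t w, 0 <= t -> F n (grid_index n t) w @[n --> \oo] --> V t w) ->
  measurable_fun setT (uncurry_pos V).
Proof.
move=> mF cF.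
apply: (measurable_fun_cvg (h := fun n z => (0 <= z.1)%R%:R * F n (grid_index n z.1) z.2)).
  move=> n; apply: measurable_funM; first exact: measurable_pos.
  apply: (measurable_fun_select (i := fun z => grid_index n z.1) (F := fun k z => F n k z.2)).
    move=> k; rewrite -[X in measurable X]setTI.
    have m1 : measurable_fun [set: measurableTypeR R * T] (fun z => z.1 : R) by exact: measurable_fst.
    exact: (m1 measurableT _ (measurable_grid_index n k)).
  by move=> k; exact: measurableT_comp.
move=> z _; rewrite /uncurry_pos; have [z0|z0] := leP 0 z.1; last first.
  by under eq_fun do rewrite mul0r; rewrite mul0r; exact: cvg_cst.
by apply: cvgMr; exact: cF.
Qed.

(** Fubini's theorem: potentials become integrals against one measure, the
    setting of [occupation_mass_formula]. *)
Lemma uncurry_potential V (C q : R) : 0 < q ->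
  measurable_fun setT (uncurry_pos V) ->
  (forall t, 0 <= t -> measurable_fun setT (V t)) ->
  (forall t w, 0 <= t -> `|V t w| <= C * expR (- (q * t))) ->
  m.-integrable setT (EFin \o uncurry_pos V) /\
  (\int[m]_z uncurry_pos V z)%R = potential P V.
Proof.
move=> q0 mV mVt VC.
pose D (t : R) (w : T) : R := expR (- (q * t)).
have mD : measurable_fun setT (uncurry_pos D).
  apply: measurable_funM; first exact: measurable_pos.
  by apply: (measurableT_comp (f := fun x : R => expR (- (q * x)))) => //; exact: measurable_expRNM.
have iD : m.-integrable setT (EFin \o uncurry_pos D).
  apply/integrableP; split; first exact/measurable_EFinP.
  under eq_integral => z _ do rewrite /= ger0_norm ?mulr_ge0 ?expR_ge0//.
  rewrite (fubini_tonelli1 (EFin \o uncurry_pos D))//; last 2 first.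
  - exact/measurable_EFinP.
  - by move=> z; rewrite lee_fin mulr_ge0 ?expR_ge0.
  have -> : (\int[mu]_x fubini_F P (EFin \o uncurry_pos D) x =
      \int[mu]_(t in `[0%R, +oo[) (expR (- (q * t)))%:E)%E.
    rewrite [RHS]integral_mkcond; apply: eq_integral => t _.
    rewrite /fubini_F /uncurry_pos /D patchE mem_setE in_itv/= andbT.
    rewrite [LHS](integral_prob_cst P); case: (0 <= t); rewrite ?mul1r ?mul0r//.
  have /integrableP[_] := integrable_expR_tail 0 q0.
  by under eq_integral => t _ do rewrite /= ger0_norm ?expR_ge0//.
have iV : m.-integrable setT (EFin \o uncurry_pos V).
  have iCD : m.-integrable setT (EFin \o (fun z => C * uncurry_pos D z)) by exact: integrable_scale.
  apply: (integrable_le _ _ iCD) => // z _; rewrite /uncurry_pos.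
  have [z0|z0] := leP 0 z.1; last by rewrite !mul0r mulr0 normr0.
  by rewrite !mul1r VC.
split => //; rewrite {1}/Rintegral -integral12_prod_meas1// /potential {1}/Rintegral.
congr fine; rewrite [RHS]integral_mkcond; apply: eq_integral => t _.
rewrite /fubini_F /uncurry_pos patchE mem_setE in_itv/= andbT.
have [t0|t0] := leP 0 t.
  rewrite EFin_Rintegral//; first by apply: eq_integral => w _; rewrite mul1r.
  by apply: (@integrable_bounded R d T P (V t) (C * expR (- (q * t)))) => [|w]; [exact: mVt|exact: VC].
by rewrite integral0_eq// => w _; rewrite mul0r.
Qed.

End time_sample_product.

Section workload_mass.
Context (R : realType) d (T : measurableType d) (P : probability T R).
Local Notation mu := (@lebesgue_measure R).
Local Notation m := (time_sample_measure P).
Variable Y : R -> {RV P >-> R}.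
Hypothesis Y0 : forall w, Y 0 w = 0.
Hypothesis cY : forall w, cadlag (fun t => Y t w).
Hypothesis indY : independent_increments Y.
Hypothesis statY : stationary_increments Y.
Variable phi : R -> R.
Hypothesis phiE : forall a, 0 <= a ->
  (\int[P]_w (expR (- (a * Y 1 w)))%:E = (expR (phi a))%:E)%E.
Hypothesis drops : forall dlt : R, 0 < dlt ->
  n.+1%:R * fine (P [set w | Y n.+1%:R^-1 w < - dlt]) @[n --> \oo] --> (0 : R).
Variables (q theta tau : R).
Hypotheses (q0 : 0 < q) (theta0 : 0 <= theta) (tau0 : 0 <= tau).

Local Notation workload := (workload Y tau).
Local Notation weight := (weight Y q theta tau).
Local Notation potential := (potential P).
Local Notation boundary_term := (boundary_term Y phi q theta tau).
Local Notation below := (below tau).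
Local Notation ramp := (ramp tau).
Local Notation k := (uncurry_pos (weight below)).
Local Notation Q := (uncurry_pos workload).

Lemma measurable_ramp n : measurable_fun setT (ramp n).
Proof. by apply: continuous_measurable_fun; exact: continuous_ramp. Qed.

Lemma measurable_weight t : 0 <= t -> measurable_fun setT (weight below t).
Proof.
move=> t0; apply: (measurable_fun_cvg (h := fun n => weight (ramp n) t)).
  move=> n; apply: (measurable_fun_cvg (h := fun j => killing Y (ramp n) q theta tau j (grid_index j t))).
    by move=> j; apply: measurable_killing; exact: measurable_ramp.
  by move=> w _; apply: cvg_killing => //; [exact: ramp01|exact: continuous_ramp].
by move=> w _; exact: cvg_weight.
Qed.

Lemma measurable_uncurry_weight : measurable_fun setT k.
Proof.
apply: (measurable_fun_cvg (h := fun n => uncurry_pos (weight (ramp n)))).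
  move=> n; apply: (measurable_uncurry_grid (F := fun j i => killing Y (ramp n) q theta tau j i)).
    by move=> j i; apply: measurable_killing; exact: measurable_ramp.
  by move=> t w t0; apply: cvg_killing => //; [exact: ramp01|exact: continuous_ramp].
move=> z _; rewrite /uncurry_pos; have [z0|z0] := leP 0 z.1; last first.
  by under eq_fun do rewrite mul0r; rewrite mul0r; exact: cvg_cst.
by apply: cvgMr; exact: cvg_weight.
Qed.

Lemma measurable_uncurry_workload : measurable_fun setT Q.
Proof.
apply: (measurable_uncurry_grid (F := fun j i w => (walk Y (ramp 0) tau j i w).1)).
  by move=> j i; apply: measurable_walk1; exact: measurable_ramp.
by move=> t w t0; exact: cvg_workload.
Qed.

Lemma uncurry_weight_ge0 z : 0 <= k z. Proof. by rewrite mulr_ge0// weight_ge0. Qed.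

Lemma uncurry_workload_ge0 z : 0 <= Q z.
Proof.
rewrite /uncurry_pos; have [z0|_] := leP 0 z.1; last by rewrite mul0r.
by rewrite mul1r; apply: workload_ge0.
Qed.

Lemma potential_product (G : R -> R) (c : R) : measurable_fun setT G ->
  (forall x, 0 <= x -> `|G x| <= c) ->
  (\int[m]_z (k z * G (Q z)))%R = potential (fun t w => weight below t w * G (workload t w)).
Proof.
move=> mG Gc; have c0 : 0 <= c by exact: le_trans (Gc 0 (lexx 0)).
have E : uncurry_pos (fun t w => weight below t w * G (workload t w)) = (fun z => k z * G (Q z)).
  apply/funext => z; rewrite /uncurry_pos; case: (0 <= z.1); rewrite ?mul0r// !mul1r//.
have [|||_ <-] := @uncurry_potential R d T P (fun t w => weight below t w * G (workload t w)) c q q0.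
- by rewrite E; apply: measurable_funM; [exact: measurable_uncurry_weight|apply: measurableT_comp => //; exact: measurable_uncurry_workload].
- move=> t t0; apply: measurable_funM; first exact: measurable_weight.
  by apply: measurableT_comp => //; exact: measurable_workload.
- move=> t w t0; rewrite normrM mulrC ler_pM//; first by apply: Gc; exact: workload_ge0.
  by rewrite ger0_norm ?weight_ge0// weight_le.
by rewrite E.
Qed.

Lemma integrable_uncurry_weight : m.-integrable setT (EFin \o k).
Proof.
have [|||//] := @uncurry_potential R d T P (weight below) 1 q q0.
- exact: measurable_uncurry_weight.
- by move=> t t0; exact: measurable_weight.
- move=> t w t0; by rewrite mul1r ger0_norm ?weight_ge0// weight_le.
Qed.

Lemma exponent_at0 : phi 0 = 0.
Proof.
have := phiE (lexx 0); under eq_integral do rewrite mul0r oppr0 expR0.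
rewrite integral_prob_cst => -[] h.
by apply: (@expR_inj R); rewrite -h expR0.
Qed.

Lemma boundary_termE a : 0 <= a -> boundary_term below a =
  (phi a - q) * (\int[m]_z (k z * expR (- (a * Q z))))%R + expR (- (a * tau))
  - theta * (\int[m]_z (k z * expR (- (a * Q z)) * (Q z <= tau)%R%:R))%R.
Proof.
move=> a0.
have mexp : measurable_fun setT (fun x : R => expR (- (a * x))) by exact: measurable_expRNM.
have mb : measurable_fun setT below.
  rewrite (_ : below = \1_`]-oo, tau]); first exact: measurable_indic.
  by apply/funext => x; rewrite indicE mem_setE in_itv.
have exp_le (x : R) : 0 <= x -> `|expR (- (a * x))| <= 1.
  by move=> x0; rewrite ger0_norm ?expR_ge0// -[leRHS]expR0 ler_expR oppr_le0 mulr_ge0.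
have b1 x : `|below x| <= 1 by exact: bool_norm_le1.
have e1 := potential_product mexp exp_le.
have mkill : measurable_fun setT (fun x => expR (- (a * x)) * (q + theta * below x)).
  by apply: measurable_funM => //; apply: measurable_funD => //; exact: measurable_funM.
have kill_le (x : R) : 0 <= x -> `|expR (- (a * x)) * (q + theta * below x)| <= q + theta.
  move=> x0; have /andP[h0 h1] := below01 tau x.
  have r0 : 0 <= q + theta * below x by rewrite addr_ge0 ?(ltW q0)// mulr_ge0.
  rewrite normrM -[leRHS]mul1r ler_pM// ?exp_le// ger0_norm//.
  by rewrite lerD2l ler_piMr.
have e2 := potential_product mkill kill_le.
have pm : forall V V' : R -> T -> R, (forall t w, V t w = V' t w) -> potential V = potential V'.
  by move=> V V' h; congr potential; apply/funext => t; apply/funext => w; exact: h.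
rewrite /boundary_term -e1.
rewrite (pm (fun t w => weight below t w * expR (- (a * workload t w)) * (q + theta * below (workload t w)))
  (fun t w => weight below t w * (expR (- (a * workload t w)) * (q + theta * below (workload t w))))); last first.
  by move=> t w; rewrite mulrA.
rewrite -e2.
have i1 := @integrable_weight_exp R _ _ m k Q measurable_uncurry_weight measurable_uncurry_workload uncurry_weight_ge0 uncurry_workload_ge0 integrable_uncurry_weight a a0.
have i2 := @integrable_weight_exp_le R _ _ m k Q measurable_uncurry_weight measurable_uncurry_workload uncurry_weight_ge0 uncurry_workload_ge0
  integrable_uncurry_weight tau a a0.
have -> : (\int[m]_z (k z * (expR (- (a * Q z)) * (q + theta * below (Q z)))))%R =
    q * (\int[m]_z (k z * expR (- (a * Q z))))%R +
    theta * (\int[m]_z (k z * expR (- (a * Q z)) * (Q z <= tau)%R%:R))%R.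
  rewrite -!RintegralZl// -RintegralD//; last 2 first.
  - exact: integrable_scale.
  - exact: integrable_scale.
  by apply: eq_Rintegral => z _; rewrite /below; ring.
ring.
Qed.

Variables (W : R -> R) (c b0 : R).
Hypotheses (c0 : 0 < c) (phic : phi c = q).
Hypothesis phiNp : forall a, b0 < a -> phi a != q + theta.
Hypothesis mW : {within `[0%R, +oo[, continuous W}.
Hypothesis WE : forall a, b0 < a ->
  (\int[mu]_(x in `[0%R, +oo[) (expR (- (a * x)) * W x)%:E)%E =
  ((phi a - (q + theta))^-1)%:E.

(** The Kella-Whitt identity in the form required by [occupation_mass_formula],
    with [l] the boundary term at 1. *)
Lemma potential_weight :
  potential (weight below) = q^-1 *
   (c * (1 + theta * (\int[mu]_(y in `[0%R, tau]) (expR (- (c * y)) * W y))%R) /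
    (theta * (expR (- (c * tau)) * W tau) +
     c * (1 + theta * (\int[mu]_(y in `[0%R, tau]) (expR (- (c * y)) * W y))%R))).
Proof.
have e : potential (weight below) = (\int[m]_z k z)%R.
  have [|||_ ->//] := @uncurry_potential R d T P (weight below) 1 q q0.
  - exact: measurable_uncurry_weight.
  - by move=> t t0; exact: measurable_weight.
  - move=> t w t0; by rewrite mul1r ger0_norm ?weight_ge0// weight_le.
rewrite e; apply: (@occupation_mass_formula R _ _ m k Q measurable_uncurry_weight measurable_uncurry_workload uncurry_weight_ge0 uncurry_workload_ge0
  integrable_uncurry_weight phi W q theta tau c (boundary_term below 1) b0) => //.
- move=> a a0; have h := boundary_term_below_linear Y0 cY indY statY phiE drops q0 theta0 tau0 a0 ltr01.
  have scale (u v : R) : u / a = v / 1 -> u = a * v.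
    by rewrite divr1 => <-; rewrite mulrC divfK ?gt_eqF.
  have := boundary_termE (ltW a0); rewrite (scale _ _ h).
  move: (\int[m]_z _)%R (\int[m]_z _)%R (boundary_term below 1) => I1 I2 l ->.
  by ring.
- have := boundary_term_below0 Y0 cY indY statY phiE q0 theta0 tau0.
  rewrite boundary_termE// exponent_at0 mul0r oppr0 expR0 sub0r => h.
  have e0 F : (\int[m]_z (k z * expR (- (0 * Q z)) * F z))%R = (\int[m]_z (k z * F z))%R.
    by apply: eq_Rintegral => z _; rewrite mul0r oppr0 expR0 mulr1.
  have e1 : (\int[m]_z (k z * expR (- (0 * Q z))))%R = (\int[m]_z k z)%R.
    by apply: eq_Rintegral => z _; rewrite mul0r oppr0 expR0 mulr1.
  by move: h; rewrite e0 e1; lra.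
Qed.

End workload_mass.

(** * Lower integrals and a regular version of the process *)

Section lower_integral.
Import HBNNSimple.
Context d (T : measurableType d) (R : realType) (mu : {measure set T -> \bar R}).
Implicit Types f g : T -> \bar R.
Local Open Scope ereal_scope.

(** The integral of a nonnegative function is the supremum of the integrals of
    its simple minorants, so monotonicity needs no measurability. The jump
    counting function, and the occupation time outside the event of good paths,
    are not known to be measurable. *)
Lemma ge0_le_lower_integral f g : (forall x, 0 <= f x) -> (forall x, f x <= g x) ->
  \int[mu]_x f x <= \int[mu]_x g x.
Proof.
move=> f0 fg; rewrite !ge0_integralTE//; last by move=> x; exact: le_trans (fg x).
by apply: ereal_sup_le => _ [h hf <-]; exists h => // x; exact: le_trans (fg x).
Qed.

(** Each simple minorant, being measurable, keeps its integral when restricted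
    to a set of full measure. *)
Lemma lower_integral_restrict (C : set T) f : measurable C -> mu (~` C) = 0 ->
  (forall x, 0 <= f x) -> \int[mu]_x f x = \int[mu]_(x in C) f x.
Proof.
move=> mC C0 f0; rewrite [RHS]integral_mkcond; apply/eqP; rewrite eq_le; apply/andP; split; last first.
  apply: ge0_le_lower_integral => x; rewrite patchE; case: ifP => // _; exact: f0.
rewrite [leLHS]ge0_integralTE//; apply: ge_ereal_sup => _ [h /= hf <-].
have := integral_nnsfun mu measurableT h; rewrite patch_setT => <-.
rewrite (@ge0_negligible_integral _ _ _ _ _ (~` C))//; last 2 first.
- by apply/measurable_EFinP; exact: measurable_funP.
- by move=> x _; rewrite lee_fin.
  rewrite setTD setCK integral_mkcond.
  by apply: ge0_le_lower_integral => x; rewrite !patchE; case: ifP => // _; rewrite ?lee_fin.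
exact: measurableC.
Qed.

Lemma eq_lower_integral (C : set T) f g : measurable C -> mu (~` C) = 0 ->
  (forall x, 0 <= f x) -> (forall x, 0 <= g x) -> {in C, f =1 g} ->
  \int[mu]_x f x = \int[mu]_x g x.
Proof.
by move=> mC C0 f0 g0 fg; rewrite !(lower_integral_restrict mC)//; exact: eq_integral.
Qed.

Lemma lower_integral_eq0 f (A : set T) : measurable A -> (forall x, 0 <= f x) ->
  (forall x, A x -> 1 <= f x) -> \int[mu]_x f x = 0 -> mu A = 0.
Proof.
move=> mA f0 f1 fi; apply/eqP; rewrite eq_le measure_ge0 andbT -fi.
have := integral_indic mu measurableT mA; rewrite setIT => <-.
apply: ge0_le_lower_integral => x; rewrite indicE ?lee_fin//.
by have [/set_mem/f1|_] := boolP (x \in A).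
Qed.

Lemma eq_measure_full (C A B : set T) : measurable C -> mu (~` C) = 0 ->
  measurable A -> measurable B -> A `&` C = B `&` C -> mu A = mu B.
Proof.
move=> mC C0 mA mB AB.
have null D : measurable D -> mu D = mu (D `&` C).
  move=> mD; rewrite (measureDI mu mD mC) [X in X + _](_ : _ = 0) ?add0e//.
  apply: (@subset_measure0 _ _ _ mu _ (~` C)); [exact: measurableD|exact: measurableC| |exact: C0].
  by move=> x [].
by rewrite null// AB -null.
Qed.

End lower_integral.

Section regular_version.
Context (R : realType) d (T : measurableType d) (P : probability T R).
Variable X : R -> {RV P >-> R}.
Variable C : set T.
Hypothesis mC : measurable C.
Hypothesis PC : P (~` C) = 0%E.

Lemma measurable_cut t : measurable_fun setT (fun w => \1_C w * X t w).
Proof. by apply: measurable_funM => //; exact: measurable_indic. Qed.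

(** The process frozen at 0 outside the event [C], so that properties that hold
    on [C] become sure ones. *)
Definition cut t : {RV P >-> R} :=
  HB.pack (fun w => \1_C w * X t w) (isMeasurableFun.Build _ _ _ _ _ (measurable_cut t)).

Lemma cutE t w : C w -> cut t w = X t w.
Proof. by move=> Cw; rewrite /= indicE mem_set// mul1r. Qed.

Lemma cut_out t w : ~ C w -> cut t w = 0.
Proof. by move=> Cw; rewrite /= indicE memNset// mul0r. Qed.

Lemma measurable_increment (Y : R -> {RV P >-> R}) s t (B : set R) : measurable B ->
  measurable (increment Y s t @^-1` B).
Proof.
move=> mB; rewrite -[X in measurable X]setTI.
by apply: (measurable_funB (f := Y t) (g := Y s)) => //.
Qed.

Lemma increment_cut s t w : C w -> increment cut s t w = increment X s t w.
Proof. by move=> Cw; rewrite /increment !cutE. Qed.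

Lemma prob_increment_cut s t (B : set R) : measurable B ->
  P (increment cut s t @^-1` B) = P (increment X s t @^-1` B).
Proof.
move=> mB; apply: (eq_measure_full mC PC); [exact: measurable_increment..|].
by apply/seteqP; split=> w [/= Bw Cw]; split=> //; move: Bw; rewrite increment_cut.
Qed.

Lemma cut_independent : independent_increments X -> independent_increments cut.
Proof.
move=> indX n t t0 tm B mB; under eq_bigr do rewrite prob_increment_cut//.
rewrite -(indX n t t0 tm B mB); apply: (eq_measure_full mC PC).
- by apply: fin_bigcap_measurable => // i _; exact: measurable_increment.
- by apply: fin_bigcap_measurable => // i _; exact: measurable_increment.
- by apply/seteqP; split=> w [/= Bw Cw]; split=> // i /Bw /=; rewrite increment_cut.
Qed.

Lemma cut_stationary : stationary_increments X -> stationary_increments cut.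
Proof. by move=> sX s t s0 st B mB; rewrite !prob_increment_cut// sX. Qed.

Lemma cut0 : (forall w, C w -> X 0 w = 0) -> forall w, cut 0 w = 0.
Proof.
by move=> X0 w; have [Cw|Cw] := pselect (C w); [rewrite cutE// X0|rewrite cut_out].
Qed.

Lemma cut_cadlag : (forall w, C w -> cadlag (fun t => X t w)) ->
  forall w, cadlag (fun t => cut t w).
Proof.
move=> cX w; have [Cw|Cw] := pselect (C w).
  by rewrite (_ : (fun _ => _) = (fun t => X t w)) ?funeqE; [exact: cX|move=> t; exact: cutE].
rewrite (_ : (fun _ => _) = cst 0); last by apply/funext => t; exact: cut_out.
by split=> t _; [exact: cvg_cst|exact: is_cvg_cst].
Qed.

Lemma counting_ge1 (S : choiceType) (A : set S) x : A x -> (1 <= counting A :> \bar R)%E.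
Proof.
move=> Ax; rewrite /counting; case: ifPn => [/asboolP fA|_]; last exact: leey.
rewrite lee_fin ler1n finmap.cardfs_gt0; apply/finmap.fset0Pn; exists x.
by rewrite in_fset_set// mem_set.
Qed.

Lemma counting_ge0 (S : choiceType) (A : set S) : (0 <= counting A :> \bar R)%E.
Proof. by rewrite /counting; case: ifP. Qed.

(** On the event [A] at least one jump is counted by the Levy measure of the
    complement of the positive half-line. The event [A] is measurable even if
    the set of all paths with a negative jump is not. *)
Lemma cut_no_negative_jump : levy_measure X (~` `]0, +oo[) = 0%E ->
  forall A, measurable A ->
  (forall w, A w -> exists2 t, 0 < t <= 1 & cut t w < lim (cut s w @[s --> t^'-])) ->
  P A = 0%E.
Proof.
move=> lX A mA hA.
apply: (lower_integral_eq0 mA _ _ lX) => w; first exact: counting_ge0.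
move=> /hA[t t01 ht]; have Cw : C w.
  apply: contrapT => Cw; move: ht.
  rewrite (_ : (fun _ => _) = cst 0); last by apply/funext => s; exact: cut_out.
  by rewrite lim_cst// cut_out// ltxx.
apply: (@counting_ge1 _ _ t); split => //.
  move: ht; rewrite cutE// (_ : (fun _ => _) = (fun s => X s w)).
    by rewrite /jump subr_eq0 => h; rewrite lt_eqF.
  by apply/funext => s; exact: cutE.
move: ht; rewrite cutE// (_ : (fun _ => _) = (fun s => X s w)).
  by move=> h; rewrite /= in_itv/= andbT subr_gt0; apply/negP; rewrite -leNgt ltW.
by apply/funext => s; exact: cutE.
Qed.

End regular_version.

(** * Consequences of the absence of negative jumps *)

Section small_drops.
Context (R : realType) d (T : measurableType d) (P : probability T R).
Variable Y : R -> {RV P >-> R}.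
Hypothesis Y0 : forall w, Y 0 w = 0.
Hypothesis cY : forall w, cadlag (fun t => Y t w).
Hypothesis indY : independent_increments Y.
Hypothesis statY : stationary_increments Y.
Hypothesis no_jumps : forall A, measurable A ->
  (forall w, A w -> exists2 t, 0 < t <= 1 & Y t w < lim (Y s w @[s --> t^'-])) ->
  P A = 0%E.
Variable dlt : R.
Hypothesis dlt0 : 0 < dlt.

Let stay : set R := `[- dlt, +oo[.
Let no_drop n : set T := box (grid_incr Y n) (fun=> stay) 0 n.+1.

Let measurable_no_drop n : measurable (no_drop n).
Proof. by apply: measurable_box => j; exact: measurable_itv. Qed.

(** A path with drops on infinitely many grids has a negative jump
    ([cadlag_grid_increments]). *)
Let drop_lim_sup : P (lim_sup_set (fun n => ~` no_drop n)) = 0%E.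
Proof.
apply: no_jumps.
  apply: bigcapT_measurable => n; apply: bigcup_measurable => j _; exact: measurableC.
move=> w Ew; apply: contrapT => nj.
have [|N _ H] := @cadlag_grid_increments R (fun t => Y t w) dlt (cY w) dlt0.
  move=> t t0 t1; rewrite leNgt; apply/negP => h; apply: nj.
  by exists t; rewrite ?t0.
have [n /= Nn] := Ew N I; apply => j /andP[_ jn].
have := H n Nn (j%:R / n.+1%:R) _ _; rewrite -[X in _ + X]mul1r -mulrDl natr1 => {}H.
rewrite /stay /= in_itv/= andbT /grid_increment lerNl opprB H// ?divr_ge0//.
by rewrite ler_pdivrMr// mul1r ler_nat.
Qed.

Let cvg_drop : fine (P (~` no_drop n)) @[n --> \oo] --> (0 : R).
Proof.
have mD n : measurable (~` no_drop n) by exact: measurableC.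
have h : P (\bigcup_(k in [set k | (n <= k)%N]) (~` no_drop k)) @[n --> \oo] --> 0%E.
  rewrite -drop_lim_sup; apply: lim_sup_set_cvg => //.
  apply: (@le_lt_trans _ _ 1%E); last exact: ltry.
  by apply: probability_le1; exact: bigcup_measurable.
have {}h : P (~` no_drop n) @[n --> \oo] --> 0%E.
  apply: squeeze_cvge (cvg_cst 0%E) h; apply: nearW => n.
  rewrite measure_ge0/=; apply: le_measure; rewrite ?inE//.
    exact: bigcup_measurable.
  by move=> w Hw; exists n => //=.
exact: (fine_cvg h).
Qed.

(** Independence turns the vanishing probability of seeing some drop on the
    grid of [0, 1] into a bound on the expected number of drops:
    [(1 - p) ^ n <= exp (- n p)]. *)
Lemma cvg_small_drops :
  n.+1%:R * fine (P [set w | Y n.+1%:R^-1 w < - dlt]) @[n --> \oo] --> (0 : R).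
Proof.
have mstay : measurable stay by exact: measurable_itv.
pose p n := fine (P [set w | Y n.+1%:R^-1 w < - dlt]).
have mp n : measurable [set w | Y n.+1%:R^-1 w < - dlt].
  rewrite (_ : [set _ | _] = Y n.+1%:R^-1 @^-1` `]-oo, - dlt[).
    by rewrite -[X in measurable X]setTI; exact: measurable_funP.
  by apply/seteqP; split=> w /=; rewrite in_itv.
have p0 n : 0 <= p n by exact: fine_ge0.
have pE n : P [set w | Y n.+1%:R^-1 w < - dlt] = (p n)%:E.
  by rewrite /p fineK// fin_num_measure.
have stayE n : P (Y n.+1%:R^-1 @^-1` stay) = (1 - p n)%:E.
  rewrite (_ : _ @^-1` _ = ~` [set w | Y n.+1%:R^-1 w < - dlt]).
    by rewrite probability_setC// pE.
  apply/seteqP; split=> w /=; rewrite /stay /= in_itv/= andbT.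
    by move=> h; apply/negP; rewrite -leNgt.
  by move=> /negP; rewrite -leNgt.
have key n : 1 - fine (P (~` no_drop n)) <= expR (- (n.+1%:R * p n)).
  rewrite probability_setC// (grid_incr_indep indY n n.+1 (fun=> mstay)).
  under eq_bigr do rewrite (grid_incr_dist Y0 statY)// stayE.
  rewrite big_mkord prodEFin/= prodr_const card_ord opprB addrC subrK.
  rewrite -mulrN mulrC expRM_natr lerXn2r ?nnegrE ?expR_ge0//.
    by rewrite -lee_fin -stayE measure_ge0.
  by have := expR_ge1Dx (- p n); rewrite addrC.
have up : - ln (1 - fine (P (~` no_drop n))) @[n --> \oo] --> (0 : R).
  have h1 : 1 - fine (P (~` no_drop n)) @[n --> \oo] --> (1 : R).
    by rewrite -[X in _ --> X]subr0; apply: cvgB; [exact: cvg_cst|exact: cvg_drop].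
  rewrite -oppr0 -[in X in _ --> X](@ln1 R); apply: cvgN.
  by apply: cvg_comp h1 _; apply: continuous_ln.
have near1 : \forall n \near \oo, 0 < 1 - fine (P (~` no_drop n)).
  have /cvgrPdist_lt/(_ 1 ltr01) := cvg_drop; apply: filterS => n.
  by rewrite sub0r normrN subr_gt0; apply: le_lt_trans; exact: ler_norm.
apply: squeeze_cvgr (cvg_cst 0) up.
apply: filterS near1 => n n1; rewrite mulr_ge0 ?fine_ge0//=.
by rewrite lerNr -ler_expR lnK.
Qed.

End small_drops.

(** * The Laplace exponent *)

Section exponent.
Context (R : realType) d (T : measurableType d) (P : probability T R).
Local Notation mu := (@lebesgue_measure R).

Lemma mmt_gen_funE (Z : T -> R) a :
  ('M_P Z (- a) = \int[P]_w (expR (- (a * Z w)))%:E)%E.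
Proof.
by rewrite /mmt_gen_fun unlock; apply: eq_integral => w _; rewrite /= mulrN mulrC.
Qed.

Lemma measurable_exp_rv (Z : {RV P >-> R}) a :
  measurable_fun setT (fun w => (expR (- (a * Z w)))%:E).
Proof.
apply/measurable_EFinP; apply: (measurableT_comp (f := fun x => expR (- (a * x)))) => //.
exact: measurable_expRNM.
Qed.

(** Since [exp (- a x) <= 1 + exp (- b x)]. *)
Lemma mmt_gen_fun_le (Z : {RV P >-> R}) a b : 0 <= a -> a <= b ->
  ('M_P Z (- b) < +oo -> 'M_P Z (- a) < +oo)%E.
Proof.
move=> a0 ab; rewrite !mmt_gen_funE => hb.
have mE := measurable_exp_rv Z.
apply: (@le_lt_trans _ _ (\int[P]_w ((expR (- (b * Z w)))%:E + 1%:E))%E).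
  apply: ge0_le_lower_integral => w; first by rewrite lee_fin expR_ge0.
  rewrite -EFinD lee_fin.
  have [z0|z0] := leP 0 (Z w).
    by rewrite ler_wpDl ?expR_ge0// -[leRHS]expR0 ler_expR oppr_le0 mulr_ge0.
  by rewrite ler_wpDr// ler_expR lerN2 ler_wnM2r// ltW.
rewrite ge0_integralD//.
by apply: lte_add_pinfty => //; rewrite (integral_prob_cst P 1) ltry.
Qed.

Lemma mmt_gen_fun_gt0 (Z : {RV P >-> R}) a : (0 < 'M_P Z (- a))%E.
Proof.
rewrite lt_neqAle; apply/andP; split; last first.
  by rewrite mmt_gen_funE integral_ge0// => w _; rewrite lee_fin expR_ge0.
apply/eqP; rewrite mmt_gen_funE => /esym h.
have mexp := measurable_exp_rv Z a.
have : (\int[P]_w `|(expR (- (a * Z w)))%:E| = 0)%E.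
  by rewrite -[RHS]h; apply: eq_integral => w _; rewrite gee0_abs// lee_fin expR_ge0.
move=> /(ae_eq_integral_abs P measurableT mexp)[N [mN N0 sN]].
have : P setT = 0%E.
  apply/eqP; rewrite eq_le measure_ge0 andbT -N0 le_measure ?inE//.
  move=> w _; apply: sN => /= /(_ I) [] /eqP; apply/negP; rewrite gt_eqF//.
  exact: expR_gt0.
by rewrite probability_setT => /eqP; rewrite onee_eq0.
Qed.

Variables (X : R -> {RV P >-> R}) (psi : R -> R).

Lemma scale_function_measurable p Wp : scale_function X psi p Wp ->
  measurable_fun `[(0:R), +oo[ Wp.
Proof. by move=> [_ _ cW _]; apply: subspace_continuous_measurable_fun. Qed.

(** An infinite moment would give the exponent its default value [ln 0 = 0]. At
    large arguments this is excluded: the transform [1 / (phi a - 1)] of the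
    scale function tends to 0 and cannot stay at [- 1]. *)
Lemma exponent_eventually_neq0 Wp : scale_function X psi 1 Wp ->
  forall b, exists2 k, b <= k & laplace_exponent X k != 0.
Proof.
move=> sW; have mW := scale_function_measurable sW; have [_ _ _ LW] := sW.
have h n : psi 1 < n%:R -> laplace_integrable Wp n%:R /\
    laplace Wp n%:R = (laplace_exponent X n%:R - 1)^-1.
  by move=> hn; apply: laplace_integrable_fin_num => //; exact: LW.
have cut (c : R) : \forall n \near \oo, c < n%:R by exact: nbhs_infty_gtr.
have [N _ /(_ N (leqnn N)) hN] := cut (psi 1).
have /cvgrPdist_lt/(_ 1 ltr01) L0 := laplace_cvg0 mW (h N hN).1.
move=> b; have : \forall n \near \oo, [/\ `|0 - laplace Wp n%:R| < 1, psi 1 < n%:R & b < n%:R].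
  near=> n; split; near: n => //; exact: cut.
move=> [M _ /(_ M (leqnn M))[l1 pM bM]]; exists M%:R; first exact: ltW.
apply: contraTneq l1 => e; rewrite (h M pM).2 e !sub0r normrN invrN1 normrN1.
by rewrite ltxx.
Unshelve. all: by end_near. Qed.

Lemma laplace_exponentE Wp : scale_function X psi 1 Wp -> forall a, 0 <= a ->
  (\int[P]_w (expR (- (a * X 1 w)))%:E = (expR (laplace_exponent X a))%:E)%E.
Proof.
move=> sW a a0; have [k ak k0] := exponent_eventually_neq0 sW a.
have fa : ('M_P (X 1) (- a) < +oo)%E.
  apply: (mmt_gen_fun_le a0 ak); move: k0; apply: contraNT.
  rewrite -leNgt leye_eq => /eqP h.
  by rewrite /laplace_exponent h /= ln0.
rewrite -mmt_gen_funE /laplace_exponent; have := mmt_gen_fun_gt0 (X 1) a.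
case: ('M_P _ _)%E fa => [r _|//|//]; rewrite lte_fin => r0 /=.
by rewrite lnK.
Qed.

Lemma laplace_exponent0 Wp : scale_function X psi 1 Wp -> laplace_exponent X 0 = 0.
Proof.
move=> sW; apply: (@expR_inj R); rewrite expR0; apply: (@EFin_inj R).
rewrite -(laplace_exponentE sW (lexx 0)).
under eq_integral do rewrite mul0r oppr0 expR0.
exact: integral_prob_cst.
Qed.

(** As [phi 0 = 0], the inverse cannot vanish at [q > 0]. *)
Lemma exponent_inverse_gt0 q Wp : exponent_inverse X psi -> scale_function X psi 1 Wp ->
  0 < q -> 0 < psi q /\ laplace_exponent X (psi q) = q.
Proof.
move=> [neg pos] sW q0.
have [p0 pq] : 0 <= psi q /\ laplace_exponent X (psi q) = q.
  have [n|n] := pselect ('E_P[X 1] < 0)%E; first by have [h _] := neg n; apply: h; exact: ltW.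
  by have [] := pos n q (ltW q0).
split=> //; rewrite lt_neqAle p0 andbT; apply/eqP => e.
by move: q0; rewrite -pq -e (laplace_exponent0 sW) ltxx.
Qed.

Lemma exponent_inverse_neq p a : exponent_inverse X psi -> 0 <= p ->
  psi p < a -> laplace_exponent X a != p.
Proof.
move=> [neg pos] p0 pa; apply/eqP => e.
have [n|n] := pselect ('E_P[X 1] < 0)%E.
  have [h1 h2] := neg n; have [ps _] := h1 p p0.
  have := h2 a (le_trans ps (ltW pa)); rewrite e => e'.
  by move: pa; rewrite e' ltxx.
have [ps _ h] := pos n p p0.
by have := h a (le_trans ps (ltW pa)) e; rewrite leNgt pa.
Qed.

End exponent.

(** * The transform of the occupation time *)

Section laplace_at_zero.
Context (R : realType).
Local Notation mu := (@lebesgue_measure R).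
Variable h : R -> R.
Hypothesis mh : measurable_fun `[(0:R), +oo[ h.
Hypothesis h0 : forall t, 0 <= h t.

Let F (p : R) := (\int[mu]_(t in `[0%R, +oo[) (expR (- (p * t)) * h t)%:E)%E.

Let mI p : measurable_fun `[(0:R), +oo[ (fun t => (expR (- (p * t)) * h t)%:E).
Proof.
by apply/measurable_EFinP; apply: measurable_funM => //; exact: measurable_expRNM.
Qed.

(** The transform is monotone in [p], hence has a limit at [0^'+]; along
    [p = 1 / (n + 1)] the limit is given by monotone convergence. It may be
    infinite. *)
Lemma laplace_at_right0 : F p @[p --> 0^'+] --> F 0.
Proof.
have F_le p p' : p <= p' -> (F p' <= F p)%E.
  move=> pp; apply: ge0_le_integral => //.
  - by move=> t _; rewrite lee_fin mulr_ge0 ?expR_ge0.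
  - exact: mI.
  - exact: mI.
  - move=> t /=; rewrite in_itv/= andbT => t0.
    by rewrite lee_fin ler_wpM2r// ler_expR lerN2 ler_wpM2r.
have /cvg_ex[/= l Fl] : cvg (F p @[p --> 0^'+]).
  apply/cvg_ex; exists (ereal_sup [set F x | x in [set` Interval (BRight 0) (BInfty R false)]]).
  by apply: nonincreasing_at_right_cvge => // p p' _ _; exact: F_le.
have Fh : F n.+1%:R^-1 @[n --> \oo] --> l.
  have h1 : n.+1%:R^-1 @[n --> \oo] --> (0 : R)^'+.
    move=> A [e /= e0 eA]; have /cvgrPdist_lt/(_ e e0) := @cvg_invSn R.
    by apply: filterS => n ne; apply: eA => //=; rewrite invr_gt0.
  exact: cvg_comp h1 Fl.
suff F0 : F n.+1%:R^-1 @[n --> \oo] --> F 0.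
  by move: Fl; rewrite (cvg_unique _ Fh F0).
have := @cvg_monotone_convergence _ _ _ mu `[(0:R), +oo[ (measurable_itv _)
  (fun n t => (expR (- (n.+1%:R^-1 * t)) * h t)%:E) (fun n => mI _).
rewrite (_ : (\int[mu]_(x in _) _)%E = F 0); last first.
  apply: eq_integral => t; rewrite inE/= in_itv/= andbT => t0.
  apply/cvg_lim => //; apply: cvg_EFin; first exact: nearW.
  have ct : - (n.+1%:R^-1 * t) @[n --> \oo] --> - (0 * t).
    by apply: cvgN; apply: cvgMl; exact: cvg_invSn.
  by apply: cvgMl; apply: cvg_comp ct _; exact: continuous_expR.
apply.
- by move=> n t _; rewrite lee_fin mulr_ge0 ?expR_ge0.
- move=> t /=; rewrite in_itv/= andbT => t0 n m nm.
  rewrite lee_fin ler_wpM2r// ler_expR lerN2 ler_wpM2r// lef_pV2 ?posrE//.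
  by rewrite ler_nat.
Qed.

End laplace_at_zero.

Section transform.
Context (R : realType) d (T : measurableType d) (P : probability T R).
Local Notation mu := (@lebesgue_measure R).
Variable Y : R -> {RV P >-> R}.
Hypothesis Y0 : forall w, Y 0 w = 0.
Hypothesis cY : forall w, cadlag (fun t => Y t w).
Variables theta tau : R.
Hypotheses (theta0 : 0 <= theta) (tau0 : 0 <= tau).

Local Notation discount q := (weight Y q theta tau (below tau)).

Lemma weight_split q t w : discount q t w = expR (- (q * t)) * discount 0 t w.
Proof. by rewrite /weight -expRD mul0r add0r opprD. Qed.

Lemma below_ge0 x : 0 <= below tau x. Proof. by have /andP[] := below01 tau x. Qed.

Definition mean_weight t : R := (\int[P]_w discount 0 t w)%R.

Lemma integrable_weight0 t : 0 <= t -> P.-integrable setT (EFin \o discount 0 t).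
Proof.
move=> t0; apply: (@integrable_bounded R d T P _ 1); first exact: measurable_weight.
move=> w; rewrite ger0_norm ?weight_ge0//.
by have := weight_le Y 0 tau theta0 t w below_ge0; rewrite mul0r oppr0 expR0.
Qed.

Lemma mean_weight_ge0 t : 0 <= mean_weight t.
Proof. by apply: Rintegral_ge0 => w _; exact: weight_ge0. Qed.

Lemma measurable_mean_weight : measurable_fun `[(0:R), +oo[ mean_weight.
Proof.
pose V := uncurry_pos (discount 0).
have mV : measurable_fun setT (EFin \o V).
  by apply/measurable_EFinP; exact: measurable_uncurry_weight.
have V0 z : (0 <= (EFin \o V) z)%E by rewrite lee_fin mulr_ge0 ?weight_ge0.
have mF := @measurable_fun_fubini_tonelli_F _ _ _ _ R P _ mV V0.
apply: (eq_measurable_fun (fine \o fubini_F P (EFin \o V))).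
  move=> t; rewrite inE/= in_itv/= andbT => t0; congr fine.
  by rewrite /fubini_F; apply: eq_integral => w _; rewrite /V /uncurry_pos /= t0 mul1r.
apply: measurable_funTS.
by apply: (measurableT_comp (f := @fine R)); [exact: fine_measurable|exact: mF].
Qed.

Lemma potential_mean_weight q : 0 < q ->
  (potential P (discount q))%:E =
  (\int[mu]_(t in `[0%R, +oo[) (expR (- (q * t)) * mean_weight t)%:E)%E.
Proof.
move=> q0.
have e t : 0 <= t -> (\int[P]_w discount q t w)%R = expR (- (q * t)) * mean_weight t.
  move=> t0; rewrite -RintegralZl//; last exact: integrable_weight0.
  by apply: eq_Rintegral => w _; exact: weight_split.
have -> : potential P (discount q) =
    (\int[mu]_(t in `[0%R, +oo[) (expR (- (q * t)) * mean_weight t))%R.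
  by apply: eq_Rintegral => t; rewrite inE/= in_itv/= andbT => t0; exact: e.
rewrite EFin_Rintegral//.
apply: (integrable_le _ _ (integrable_expR_tail 0 q0)) => //.
  by apply: measurable_funM; [exact: measurable_expRNM|exact: measurable_mean_weight].
move=> t /=; rewrite in_itv/= andbT => t0.
rewrite ger0_norm ?mulr_ge0 ?expR_ge0 ?mean_weight_ge0// ler_piMr ?expR_ge0//.
rewrite -[leRHS](Rintegral_prob_cst P); apply: le_Rintegral => //.
- exact: integrable_weight0.
- exact: finite_measure_integrable_cst.
- move=> w _.
  by have := weight_le Y 0 tau theta0 t w below_ge0; rewrite mul0r oppr0 expR0.
Qed.

End transform.

Section levy_transform.
Context (R : realType) d (T : measurableType d) (P : probability T R).
Local Notation mu := (@lebesgue_measure R).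
Variables (X : R -> {RV P >-> R}) (C : set T).
Hypotheses (mC : measurable C) (PC : P (~` C) = 0%E).
Hypothesis X0 : forall w, C w -> X 0 w = 0.
Hypothesis cX : forall w, C w -> cadlag (fun t => X t w).
Variables theta tau : R.
Hypotheses (theta0 : 0 <= theta) (tau0 : 0 <= tau).

Let Y := cut X mC.

(** On good paths the killing factor is a measurable function of the sample
    point, since it is one for the version that is good everywhere. *)
Lemma occupation_time_cut t w : C w ->
  expR (- (theta * occupation_time X tau t w)) = weight Y 0 theta tau (below tau) t w.
Proof.
move=> Cw; have pathE : (fun u => Y u w) = (fun u => X u w).
  by apply/funext => u; exact: cutE.
rewrite /weight mul0r add0r; congr (expR (- (theta * _))).
apply: eq_Rintegral => s _; rewrite indicE /below /workload pathE.
by congr (nat_of_bool _)%:R; apply/idP/idP => [/set_mem|h]; last exact/mem_set.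
Qed.

(** The expectation of the possibly nonmeasurable integrand equals that of a
    measurable one which agrees with it almost surely. *)
Lemma occupation_transformE q : occupation_transform X tau q theta =
  (\int[mu]_(t in `[0%R, +oo[) (expR (- (q * t)) * mean_weight Y theta tau t)%:E)%E.
Proof.
have Y0 : forall w, Y 0 w = 0 by exact: cut0.
have cY : forall w, cadlag (fun t => Y t w) by exact: cut_cadlag.
apply: eq_integral => t; rewrite inE/= in_itv/= andbT => t0.
rewrite EFinM; congr (_ * _)%E.
rewrite EFin_Rintegral//; last exact: integrable_weight0.
rewrite unlock; apply: (eq_lower_integral mC PC) => w.
- by rewrite lee_fin expR_ge0.
- by rewrite lee_fin weight_ge0.
- by rewrite inE => Cw /=; rewrite occupation_time_cut.
Qed.

End levy_transform.

Section levy_good_paths.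
Context (R : realType) d (T : measurableType d) (P : probability T R).
Variable X : R -> {RV P >-> R}.

Lemma levy_good_paths : levy_process X -> exists2 C : set T,
  measurable C /\ P (~` C) = 0%E &
  forall w, C w -> X 0 w = 0 /\ cadlag (fun t => X t w).
Proof.
move=> [[A [mA A0 sA]] _ _ [B [mB B0 sB]]].
exists (~` (A `|` B)); first split.
- by apply: measurableC; exact: measurableU.
- have : (P (A `|` B) <= P A + P B)%E by exact: measureU2.
  by rewrite A0 B0 adde0 measure_le0 setCK => /eqP.
- move=> w; rewrite setCU => -[nA nB]; split; apply: contrapT => h.
    by apply: nA; exact: sA.
  by apply: nB; exact: sB.
Qed.

End levy_good_paths.

Theorem theorem3p4 (R : realType) (d : measure_display) (T : measurableType d)
    (P : probability T R) (X : R -> {RV P >-> R})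
    (psi : R -> R) (W : R -> R -> R) (tau q theta : R)
    (hX : spectrally_positive_levy X)
    (hpsi : exponent_inverse X psi)
    (hW : forall p : R, 0 <= p -> scale_function X psi p (W p))
    (htau : 0 <= tau) (hq : 0 <= q) (htheta : 0 <= theta) :
  (0 < q ->
     occupation_transform X tau q theta =
     (occupation_formula psi W tau q theta)%:E) /\
  (q = 0 ->
     (occupation_formula psi W tau p theta)%:E @[p --> 0^'+] -->
     occupation_transform X tau q theta).
Proof.
have [lX jX] := hX; have [_ indX statX _] := lX.
have [C [mC PC] goodC] := levy_good_paths lX.
have X0 w : C w -> X 0 w = 0 by move=> /goodC[].
have cX w : C w -> cadlag (fun t => X t w) by move=> /goodC[].
(* Changing [X] on a null event alters neither the law of its increments nor the transform. *)
pose Y := cut X mC.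
have Y0 : forall w, Y 0 w = 0 by exact: cut0.
have cY : forall w, cadlag (fun t => Y t w) by exact: cut_cadlag.
have indY : independent_increments Y by exact: cut_independent.
have statY : stationary_increments Y by exact: cut_stationary.
have drops dlt := @cvg_small_drops R d T P Y Y0 cY indY statY (cut_no_negative_jump jX) dlt.
have sW1 := hW 1 ler01.
have phiE a : 0 <= a -> (\int[P]_w (expR (- (a * Y 1 w)))%:E = (expR (laplace_exponent X a))%:E)%E.
  move=> a0; rewrite -(laplace_exponentE sW1 a0); apply: (eq_lower_integral mC PC) => w.
  - by rewrite lee_fin expR_ge0.
  - by rewrite lee_fin expR_ge0.
  - by rewrite inE => Cw; rewrite cutE.
have pos p : 0 < p -> occupation_transform X tau p theta = (occupation_formula psi W tau p theta)%:E.
  move=> p0; have [c0 phic] := exponent_inverse_gt0 hpsi sW1 p0.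
  have pt0 : 0 <= p + theta by rewrite addr_ge0// ltW.
  have [_ _ cW LW] := hW _ pt0.
  rewrite (occupation_transformE mC PC)// -potential_mean_weight//.
  congr EFin; apply: (@potential_weight R d T P Y Y0 cY indY statY (laplace_exponent X) phiE drops
    p theta tau p0 htheta htau (W (p + theta)) (psi p) (psi (p + theta))) => //.
  by move=> a ha; exact: (exponent_inverse_neq hpsi pt0 ha).
split=> [/pos//|q0].
have L := laplace_at_right0 (measurable_mean_weight Y0 cY theta htau)
  (mean_weight_ge0 Y theta tau).
rewrite q0 (occupation_transformE mC PC)//.
apply: cvg_trans L; apply: near_eq_cvg; near=> p.
by rewrite -(occupation_transformE mC PC)// pos//; near: p; exact: nbhs_right_gt.
Unshelve. all: by end_near. Qed.
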